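(* Let $\alpha\in(0,1)$. Assume: (1) (i) for every $p>1$, $\sup_{t\in[0,T]}\|\sigma_t\|_p<\infty$ and there is a constant $C(p)$ with $\|\widetilde\sigma_t-\widetilde\sigma_s\|_p\le C(p)|t-s|^{1/2}$ for all $s,t\in[0,T]$; (ii) $\sup_{t\in[0,T]}\|b_t\|_p<\infty$ for every $p>1$; (iii) $\sigma_t\neq0$ a.s. for every $t\in[0,T]$, and $\sup_{t\in[0,T]}\|\sigma_t^{-1}\|_p<\infty$ for every $p>1$. (2) (i) $S_{n,j-1}>0$ a.s. and $\sup_{n\in\mathbb N}\sup_{j\in I_n}\|S_{n,j-1}^{-1}\|_p<\infty$ for every $p>1$; (ii) there exist constants $\gamma_0>0$ and $c>0$ such that $\sup_{n\in\mathbb N}\sup_{j\in I_n}n^{\gamma_0}\big\|1_{\{j\in\mathcal L_n^c\}}\big(\sigma_{t_{j-1}}^2-c\,S_{n,j-1}\big)\big\|_p<\infty$ for every $p>1$. (3) There exists a constant $\xi\ge0$ such that $\|\#\mathfrak L_n\|_p=O(n^{\xi})$ as $n\to\infty$ for every $p>1$. Suppose that $\xi<\frac12$, that $\beta_0<\min\{\gamma_0,\frac12-\xi\}$, and that $\kappa_n=O(n^{1/2})$. Then $$\big\|\mathbb W_n(\alpha)-\Theta\big\|_p=O(n^{-\beta_0})\qquad(n\to\infty)$$ for every $p>1$.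
   Context: Setting. Fix $T>0$ and a filtered probability space $(\Omega,\mathcal F,P)$ with filtration $(\mathcal F_t)_{t\in[0,T]}$; $\|\cdot\|_p$ is the $L^p(P)$-norm. $X_t=X_0+\int_0^tb_s\,ds+\int_0^t\sigma_s\,dw_s+J_t$, $t\in[0,T]$, is a real semimartingale, where $X_0$ is $\mathcal F_0$-measurable, $b$ and $\sigma$ are càdlàg adapted processes, $w$ is a standard Wiener process with respect to the filtration, and $J_t=\sum_{s\in(0,t]}\Delta J_s$ is finitely active, i.e. $\sum_{t\in[0,T]}1_{\{\Delta J_t\ne0\}}<\infty$ a.s. Put $\Theta=\int_0^T\sigma_t^2\,dt$, $t_j=t_j^n=jT/n$, $h=T/n$, $I_n=\{1,\dots,n\}$, $\Delta_jU=U_{t_j}-U_{t_{j-1}}$ for a process $U$. Jumps. $N_t=\sum_{s\in(0,t]}1_{\{\Delta J_s\ne0\}}$, $J^\sigma_t=\sum_{s\in(0,t]}\Delta\sigma_s$, $\widetilde\sigma=\sigma-J^\sigma$, $N^\sigma_t=\sum_{s\in(0,t]}1_{\{\Delta J^\sigma_s\ne0\}}$, with $N^\sigma_T<\infty$ a.s., and $\overline N=N+N^\sigma$. For an interval $A$, $\overline N(A)$ is the number of points of $\overline N$ in $A$. The jump parts $J$ and $J^\sigma$ (hence $X,\sigma,\overline N,\Theta$) are allowed to depend on $n$, this dependence being suppressed from the notation; all bounds on $\sigma,\widetilde\sigma,b$ are understood to be uniform in $n$. $\mathfrak L_n=\{j\in I_n:\Delta_j\overline N\ne0\}$. Local windows.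 $\kappa_n$ are nonnegative integers with $2\kappa_n+1\le n$. Set $\underline j_n=1$ if $j\le\kappa_n$, $\underline j_n=j-\kappa_n$ if $\kappa_n+1\le j\le n-\kappa_n$, $\underline j_n=n-2\kappa_n$ if $j\ge n-\kappa_n+1$. $\mathtt I_{n,j}=(t_{\underline j_n-1},t_{\underline j_n+2\kappa_n}]$ and $\mathcal L_n=\{j\in I_n:\overline N(\mathtt I_{n,j})\ne0\}$; $\mathcal L_n^c=I_n\setminus\mathcal L_n$. Winsorized global realized volatility. Given random variables $S_{n,j-1}$ ($j\in I_n$, $n\in\mathbb N$), put $V_j=|S_{n,j-1}^{-1/2}\Delta_jX|$, $s_n(\alpha)=\lfloor n(1-\alpha)\rfloor$, $V_{(1)}\le\dots\le V_{(n)}$ the order statistics of $\{V_k\}_{k\in I_n}$ (with $V_{(0)}:=0$), $K_{n,j}=1_{\{|\Delta_jX|\le n^{-1/4}\}}$. For $\zeta\sim N(0,1)$, $c(\alpha)$ is defined by $P[\zeta^2\le c(\alpha)]=1-\alpha$, and $\mathsf w(\alpha)=E[\zeta^2\wedge c(\alpha)]$. Finally $$\mathbb W_n(\alpha)=\sum_{j=1}^n\mathsf w(\alpha)^{-1}\big\{|\Delta_jX|\wedge\big(S_{n,j-1}^{1/2}V_{(s_n(\alpha))}\big)\big\}^2K_{n,j}.$$ *)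

(* Defs.v *)
From HB Require Import structures.
From mathcomp Require Import all_boot all_order all_algebra.
From mathcomp Require Import all_classical all_reals all_analysis.
Set Implicit Arguments.
Unset Strict Implicit.
Unset Printing Implicit Defensive.
Import Order.TTheory GRing.Theory Num.Theory.
Import numFieldNormedType.Exports.
Local Open Scope classical_set_scope.
Local Open Scope ring_scope.

(* Time runs over the reals; only the values of a process on [0, T], and of a
   path functional at points of ]0, T], are ever used. *)

Section paths.
Variable R : realType.
Implicit Types (f : R -> R) (t T : R) (A : set R).

Definition cadlag_path T f :=
  (forall t, 0 <= t < T -> f x @[x --> t^'+] --> f t) /\
  (forall t, 0 < t <= T -> cvg (f x @[x --> t^'-])).

Definition jump f t : R := f t - lim (f x @[x --> t^'-]).

(* The finitely supported sum is 0 by convention when f has infinitely many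
   jumps in ]0, t], so it is to be used with [jump_count f `]0, T] < +oo]. *)
Definition jump_part f t : R := \sum_(s \in `]0, t]) jump f s.

Definition jump_count f A : \bar R :=
  (\esum_(s in A) (jump f s != 0)%:R%:E)%E.

(* Since the jumps of [jump_part f] are those of f, the point process of the
   jumps of J^sigma is read off sigma itself. *)
Definition Nbar (J sigma : R -> R) A : \bar R :=
  (jump_count J A + jump_count sigma A)%E.

End paths.

Section processes.
Context d (Omega : measurableType d) (R : realType) (P : probability Omega R).
Variables (F : R -> set (set Omega)) (T : R).
Implicit Types U sigma b w M J X : R -> Omega -> R.

Definition is_filtration :=
  [/\ forall t, 0 <= t <= T -> sigma_algebra setT (F t),
      forall t, 0 <= t <= T -> F t `<=` measurable &
      forall s t, 0 <= s -> s <= t -> t <= T -> F s `<=` F t].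

Definition measurable_at t (Y : Omega -> R) :=
  forall B : set R, measurable B -> F t (Y @^-1` B).

Definition adapted U := forall t, 0 <= t <= T -> measurable_at t (U t).

Definition cadlag_adapted U :=
  adapted U /\ forall omega, cadlag_path T (U ^~ omega).

Definition wiener w :=
  [/\ adapted w,
      {ae P, forall omega, w 0 omega = 0},
      {ae P, forall omega, {within `[0, T], continuous (w ^~ omega)}},
      forall s t, 0 <= s -> s < t -> t <= T ->
        forall B : set R, measurable B ->
        P [set omega | B (w t omega - w s omega)%R] =
        normal_prob 0 (Num.sqrt (t - s)) B &
      forall s t, 0 <= s -> s < t -> t <= T ->
        forall (A : set Omega) (B : set R), F s A -> measurable B ->
        P (A `&` [set omega | B (w t omega - w s omega)%R]) =
        (P A * P [set omega | B (w t omega - w s omega)%R])%E].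

Definition cvg_in_probability_to0 (Y : nat -> Omega -> R) :=
  forall e : R, 0 < e ->
    P [set omega | e <= `|Y k omega|] @[k --> \oo] --> 0%E.

(* The integrand sum_(i < size) coef i 1_(]time i, time i.+1]). *)
Record simple_process := SimpleProcess {
  sp_size : nat ;
  sp_time : nat -> R ;
  sp_coef : nat -> Omega -> R }.

Definition simple_predictable (H : simple_process) :=
  [/\ forall i, (i <= sp_size H)%N -> 0 <= sp_time H i <= T,
      forall i, (i < sp_size H)%N -> sp_time H i <= sp_time H i.+1,
      forall i, (i < sp_size H)%N ->
        measurable_at (sp_time H i) (sp_coef H i) &
      exists C : R, forall i omega, (i < sp_size H)%N ->
        `|sp_coef H i omega| <= C].

Definition sp_value (H : simple_process) (s : R) (omega : Omega) : R :=
  \sum_(i < sp_size H)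
    sp_coef H i omega * (sp_time H i < s <= sp_time H i.+1)%R%:R.

Definition sp_integral w (H : simple_process) (t : R) (omega : Omega) : R :=
  \sum_(i < sp_size H)
    sp_coef H i omega * (w (Num.min (sp_time H i.+1) t) omega
                         - w (Num.min (sp_time H i) t) omega).

(* M_t = int_0^t sigma_s dw_s on [0, T]: Ito's integral of an adapted sigma
   with int_0^T sigma^2 ds < oo a.s., as the continuous process that is the
   limit in probability of the integrals of simple processes H_k such that
   int_0^T (H_k - sigma)^2 ds -> 0 in probability. *)
Definition ito_integral w sigma M :=
  [/\ adapted M,
      {ae P, forall omega, {within `[0, T], continuous (M ^~ omega)}} &
      exists H : nat -> simple_process,
        [/\ forall k, simple_predictable (H k),
            cvg_in_probability_to0 (fun k omega =>
              \int[lebesgue_measure]_(s in `[0, T])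
                (sp_value (H k) s omega - sigma s omega) ^+ 2) &
            forall t, 0 <= t <= T ->
              cvg_in_probability_to0 (fun k omega =>
                sp_integral w (H k) t omega - M t omega)]].

(* J_t = sum_(0 < s <= t) Delta J_s with finitely many jumps on ]0, T]. *)
Definition finitely_active_jump_process J :=
  [/\ cadlag_adapted J,
      {ae P, forall omega, (jump_count (J ^~ omega) `]0%R, T] < +oo)%E} &
      {ae P, forall omega, forall t, 0 <= t <= T ->
        J t omega = jump_part (J ^~ omega) t}].

Definition ito_semimartingale w (X0 : Omega -> R) b sigma J X :=
  cadlag_adapted X /\
  exists M, ito_integral w sigma M /\
    {ae P, forall omega, forall t, 0 <= t <= T ->
      X t omega = X0 omega + (\int[lebesgue_measure]_(s in `[0, t]) b s omega)
                  + M t omega + J t omega}.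

Definition Theta sigma (omega : Omega) : R :=
  \int[lebesgue_measure]_(t in `[0, T]) sigma t omega ^+ 2.

Definition Lpnorm (p : R) (Y : Omega -> R) : \bar R :=
  ('N[P]_(p%:E)[EFin \o Y])%E.

Definition tgrid (n j : nat) : R := j%:R * T / n%:R.

(* The index j ranges over 1, ..., n. *)
Definition incr (n : nat) U (j : nat) (omega : Omega) : R :=
  U (tgrid n j) omega - U (tgrid n j.-1) omega.

Definition frakL (n : nat) J sigma (omega : Omega) : seq nat :=
  [seq j <- iota 1 n |
    (Nbar (J ^~ omega) (sigma ^~ omega) `]0%R, tgrid n j]
     - Nbar (J ^~ omega) (sigma ^~ omega) `]0%R, tgrid n j.-1] != 0)%E].

Definition window_start (kappa n j : nat) : nat :=
  if (j <= kappa)%N then 1%N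
  else if (j <= n - kappa)%N then (j - kappa)%N
  else (n - kappa.*2)%N.

Definition window (kappa n j : nat) : set R :=
  `]tgrid n (window_start kappa n j).-1,
    tgrid n (window_start kappa n j + kappa.*2)].

Definition calL (kappa n : nat) J sigma (omega : Omega) : seq nat :=
  [seq j <- iota 1 n |
    (Nbar (J ^~ omega) (sigma ^~ omega) (window kappa n j) != 0)%E].

End processes.

Section winsorized.
Context d (Omega : measurableType d) (R : realType).
Variables (T : R) (alpha : R).

(* c(alpha), for a given alpha, is the number c with P[zeta^2 <= c] = 1 - alpha
   for zeta ~ N(0,1). *)
Definition is_chi2_quantile (c : R) :=
  normal_prob (0 : R) 1 [set x : R | x ^+ 2 <= c] = (1 - alpha)%:E.

Definition wfactor (c : R) : R :=
  \int[normal_prob (0 : R) 1]_(x in setT) Num.min (x ^+ 2) c.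

Definition s_ (n : nat) : nat := Num.truncn (n%:R * (1 - alpha)).

(* [Sn i] is S_{n,i}, 0 <= i < n. *)
Definition V (n : nat) (Sn : nat -> Omega -> R) (X : R -> Omega -> R)
    (j : nat) (omega : Omega) : R :=
  `|(Num.sqrt (Sn j.-1 omega))^-1 * incr T n X j omega|.

Definition Vord (n : nat) (Sn : nat -> Omega -> R) (X : R -> Omega -> R)
    (k : nat) (omega : Omega) : R :=
  nth 0 (0 :: sort <=%O [seq V n Sn X j omega | j <- iota 1 n]) k.

Definition K_ (n : nat) (X : R -> Omega -> R) (j : nat) (omega : Omega) : R :=
  (`|incr T n X j omega| <= n%:R `^ (- 4^-1))%R%:R.

Definition WRV (c : R) (n : nat) (Sn : nat -> Omega -> R)
    (X : R -> Omega -> R) (omega : Omega) : R :=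
  \sum_(1 <= j < n.+1)
    (wfactor c)^-1 *
    Num.min `|incr T n X j omega|
      (Num.sqrt (Sn j.-1 omega) * Vord n Sn X (s_ n) omega) ^+ 2 *
    K_ n X j omega.

End winsorized.

(* a_n = O(n^e) for nonnegative, possibly infinite a_n. *)
Definition bigO_pow (R : realType) (a : nat -> \bar R) (e : R) :=
  exists C : R, \forall n \near \oo, (a n <= (C * n%:R `^ e)%:E)%E.

(* Main.v *)
Require Import Defs.
From HB Require Import structures.
From mathcomp Require Import all_boot all_order all_algebra.
From mathcomp Require Import all_classical all_reals all_analysis.
From mathcomp Require Import measurable_realfun ring lra zify.
Set Implicit Arguments.
Unset Strict Implicit.
Unset Printing Implicit Defensive.
Import Order.TTheory GRing.Theory Num.Theory.
Import numFieldNormedType.Exports.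
Local Open Scope classical_set_scope.
Local Open Scope ring_scope.

(* Everything is controlled on events whose complements have probability O(n^-L) for
   every L; there |W_n - Theta| is bounded pathwise by n^-beta up to a small power of n,
   with beta = min(gamma_0, 1/2 - xi), and off these events the crude bound |W_n| <= C
   n^(1/2) and the moments of Theta suffice. Write q^2 = c(alpha), h = T/n, and let Z_j
   be the standardized Wiener increments. On a window without jumps, the moments of
   sigma, b, S^-1 and of the increments of sigma-tilde, together with exponential
   martingales for the stochastic integral, give Delta_j X = sigma_(t_(j-1)) h^(1/2) Z_j
   + O(n^(-1+e)) and sigma_(t_(j-1))^2 = c S_(n,j-1) + O(n^(-gamma_0+e)), so that the
   V_j of the cells with such windows are close to (c h)^(1/2) |Z_j|. By Azuma's
   inequality the empirical distribution function of the |Z_j| is within n^(-1/2+e) of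
   its limit, whose density is bounded below near q; all but n^(1/2+xi+e) windows being
   free of jumps, the order statistic V_(s_n) is (c h)^(1/2) (q + O(n^(-beta+e))). Hence
   the summand of W_n on a cell with jump-free window is w(alpha)^-1 h sigma_(t_(j-1))^2
   min(Z_j^2, q^2) up to O(n^(-1-beta+e)); the other cells contribute O(n^(-beta+e)) by
   the truncation K_(n,j), and Azuma's inequality replaces min(Z_j^2, q^2) by its mean
   w(alpha). *)

(** * Integration tools *)

(** Two effects limit the rate. The proxy error n^-gamma_0 shifts every threshold S^(1/2) V_(s_n).
    The n^xi cells with jumps are controlled by [K_] alone, up to n^(-1/2) each, and the fraction of
    windows spoilt by jumps is of order n^(xi-1/2), which displaces the order statistic by as much.
    The constant c cancels, since S^(1/2) V does not change when S is multiplied by a constant. S is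
    measurable but not adapted, so it enters only through pathwise inequalities; martingale bounds
    concern functions of the Z_j with weights known at the left end of the cell. The Ito integral is
    given as a limit in probability of simple integrals, so Gaussian tails are proved for simple
    integrands and passed to the limit at two fixed times. Many events, and W_n - Theta itself, come
    without measurability: probabilities are bounded through measurable covers, moments through
    measurable majorants. Each random quantity may lose a factor n^e; in total the losses amount to
    n^(7e). *)

Section integral_tools.
Context d (Omega : measurableType d) (R : realType) (P : probability Omega R).
Local Open Scope ereal_scope.

(* The integral of a nonnegative function is a supremum over the simple functions below
   it, whence no measurability is needed here. *)
Lemma ge0_le_integral_in d' (U : measurableType d') (m : {measure set U -> \bar R})
    (D : set U) (f g : U -> \bar R) :
  (forall x, D x -> 0 <= f x) -> (forall x, D x -> f x <= g x) ->
  \int[m]_(x in D) f x <= \int[m]_(x in D) g x.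
Proof.
move=> f0 fg; rewrite [leLHS]integral_mkcond [leRHS]integral_mkcond.
have f0' x : 0 <= (f \_ D) x by apply: erestrict_ge0 => y /f0.
have fg' x : (f \_ D) x <= (g \_ D) x.
  by rewrite !patchE; case: ifPn => // /set_mem/fg.
rewrite !ge0_integralTE//; last by move=> x; exact: le_trans (fg' x).
apply: le_ereal_sup => _ [h /= hf <-]; exists h => // x.
exact: le_trans (hf x) (fg' x).
Qed.

Lemma ge0_le_integral_pointwise (f g : Omega -> \bar R) :
  (forall x, 0 <= f x) -> (forall x, f x <= g x) ->
  \int[P]_x f x <= \int[P]_x g x.
Proof. by move=> f0 fg; apply: ge0_le_integral_in. Qed.

Lemma Lpnorm_powR_le (p : R) (Y : Omega -> R) (C : R) : (0 < p)%R ->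
  Lpnorm P p Y <= C%:E -> \int[P]_x (`|Y x| `^ p)%:E <= (C `^ p)%:E.
Proof.
move=> p0; rewrite /Lpnorm => YC.
have h : 'N[P]_(p%:E)[EFin \o Y] `^ p <= (C%:E) `^ p.
  apply: gt0_ler_poweR => //.
  - exact: ltW.
  - by rewrite in_itv/= leey Lnorm_ge0.
  - by rewrite in_itv/= leey (le_trans _ YC)// Lnorm_ge0.
by move: h; rewrite poweR_Lnorm ?gt_eqF// poweR_EFin.
Qed.

Lemma Lpnorm_exprn_le (k : nat) (Y : Omega -> R) (C : R) : (0 < k)%N ->
  Lpnorm P k%:R Y <= C%:E -> \int[P]_x (`|Y x| ^+ k)%:E <= (C ^+ k)%:E.
Proof.
move=> k0 YC; have C0 : (0 <= C)%R.
  by rewrite -lee_fin (le_trans _ YC)// Lnorm_ge0.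
have := @Lpnorm_powR_le k%:R Y C; rewrite ltr0n => /(_ k0 YC).
by rewrite powR_mulrn//; under eq_integral do rewrite powR_mulrn//.
Qed.

Lemma Lpnorm_le (p C : R) (Y : Omega -> R) : (0 < p)%R -> (0 <= C)%R ->
  \int[P]_x (`|Y x| `^ p)%:E <= (C `^ p)%:E -> Lpnorm P p Y <= C%:E.
Proof.
move=> p0 C0 h; rewrite /Lpnorm unlock.
have pp : (C `^ p `^ p^-1)%:E = C%:E.
  by rewrite -powRrM mulfV ?gt_eqF// powRr1.
rewrite -[leRHS]pp -poweR_EFin; apply: gt0_ler_poweR => //.
- by rewrite invr_ge0 ltW.
- by rewrite in_itv/= leey integral_ge0.
- by rewrite in_itv/= leey lee_fin powR_ge0.
Qed.

(** [Y] may fail to be measurable: x^k times the indicator of the measurable set [A] lies below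
    |Y|^k, and integrals of nonnegative functions are monotone. *)
Lemma markov_cover (k : nat) (Y : Omega -> R) (K x : R) (A : set Omega) :
  measurable A -> (0 < x)%R -> (forall o, A o -> x <= `|Y o|)%R ->
  \int[P]_o (`|Y o| ^+ k)%:E <= K%:E -> P A <= (K / x ^+ k)%:E.
Proof.
move=> mA x0 AY YK.
have xk : (0 < x ^+ k)%R by rewrite exprn_gt0.
rewrite EFinM lee_pdivlMr//; apply: le_trans YK.
have -> : P A * (x ^+ k)%:E = \int[P]_o ((x ^+ k)%:E * (\1_A o)%:E).
  rewrite ge0_integralZl_EFin ?ltW//; last first.
    exact/measurable_EFinP/measurable_indic.
  by rewrite integral_indic// setIT muleC.
apply: ge0_le_integral_pointwise => o; first by rewrite -EFinM lee_fin mulr_ge0// ltW.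
rewrite -EFinM lee_fin indicE; have [/set_mem Ao|nAo] := boolP (o \in A).
  by rewrite mulr1 lerXn2r ?nnegrE ?(ltW x0)// AY.
by rewrite mulr0 exprn_ge0.
Qed.

End integral_tools.

Section measurable_sets.
Context d (U : measurableType d) (R : realType).
Implicit Types f g : U -> R.

Lemma measurable_set_le f g : measurable_fun setT f -> measurable_fun setT g ->
  measurable [set x | f x <= g x].
Proof.
by move=> mf mg; rewrite -[X in measurable X]setTI; exact: measurable_fun_le.
Qed.

Lemma measurable_set_lt f g : measurable_fun setT f -> measurable_fun setT g ->
  measurable [set x | f x < g x].
Proof.
move=> mf mg; rewrite (_ : [set x | _] = ~` [set x | g x <= f x]).
  by apply: measurableC; exact: measurable_set_le.
by apply/seteqP; split => x /=; rewrite real_ltNge ?num_real// => /negP.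
Qed.

End measurable_sets.

(** * Gaussian increments and exponential martingales *)

Section gaussian.
Context {R : realType}.
Local Notation mu := (@lebesgue_measure R).
Local Open Scope ereal_scope.
Import HBNNSimple.

(** Decomposing [f] along its level sets reduces the identity to indicators, where it is the
    definition of [normal_prob] through its density. *)
Lemma normal_prob_integral_nnsfun (m s : R) (f : {nnsfun measurableTypeR R >-> R}) :
  \int[normal_prob m s]_x (f x)%:E = \int[mu]_x ((f x)%:E * (normal_pdf m s x)%:E).
Proof.
under [LHS]eq_integral do rewrite fimfunE -fsumEFin//.
rewrite [LHS]ge0_integral_fsum//; last 2 first.
  - by move=> r; exact/measurable_EFinP/measurableT_comp.
  - by move=> n x _; rewrite EFinM nnfun_muleindic_ge0.
under [RHS]eq_integral.
  move=> x xD; rewrite fimfunE -fsumEFin// muleC ge0_mule_fsumr; last first.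
    by move=> r; rewrite EFinM nnfun_muleindic_ge0.
  over.
rewrite [RHS]ge0_integral_fsum//; last 2 first.
  - move=> r; apply: emeasurable_funM.
      by apply/measurable_EFinP; exact: measurable_normal_pdf.
    by apply/measurable_EFinP; do 2 apply/measurableT_comp => //.
  - move=> n x _; rewrite EFinM mule_ge0//; last by rewrite nnfun_muleindic_ge0.
    by rewrite lee_fin normal_pdf_ge0.
apply: eq_fsbigr => r _.
rewrite integralZl_indic_nnsfun//= integral_indic// setIT.
under [RHS]eq_integral do rewrite EFinM muleCA.
have [r0|r0] := ltP r 0%R; first by rewrite preimage_nnfun0// measure0 mule0 integral0_eq// => x _; rewrite indicE in_set0 !mule0.
rewrite ge0_integralZl//; last 2 first.
  - apply: emeasurable_funM.
      by apply/measurable_EFinP; exact: measurable_normal_pdf.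
    by apply/measurable_EFinP; apply/measurable_indic.
  - by move=> x _; rewrite mule_ge0// lee_fin// normal_pdf_ge0.
congr (_ * _); rewrite /normal_prob [LHS]integral_mkcond; apply: eq_integral => x _.
by rewrite patchE indicE; case: ifP => xf; rewrite ?xf ?mule1 ?mule0.
Qed.

(** The left side is a supremum over simple functions below [f]. Each of them satisfies the identity
    above, and multiplication by the density preserves the order. *)
Lemma normal_prob_integral_le (m s : R) (f : R -> \bar R) :
  (forall x, 0 <= f x) ->
  \int[normal_prob m s]_x f x <= \int[mu]_x (f x * (normal_pdf m s x)%:E).
Proof.
move=> f0; rewrite [leLHS]ge0_integralTE//.
apply: ge_ereal_sup => _ [h /= hf <-].
rewrite -integralT_nnsfun/= normal_prob_integral_nnsfun.
have p0 x : 0 <= (normal_pdf m s x)%:E by rewrite lee_fin normal_pdf_ge0.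
rewrite !ge0_integralTE//; last 2 first.
- by move=> x; rewrite mule_ge0.
- by move=> x; rewrite mule_ge0// lee_fin.
apply: le_ereal_sup => _ [g /= gf <-]; exists g => // x.
by apply: le_trans (gf x) _; rewrite lee_wpmul2r.
Qed.

(** Completing the square: exp(theta x) times the density of standard deviation [s] centred at 0 is
    exp(theta^2 s^2 / 2) times the density centred at theta s^2, whose integral is 1. *)
Lemma normal_mgf_le (s theta : R) : (s != 0)%R ->
  \int[normal_prob 0 s]_x (expR (theta * x))%:E <= (expR (theta ^+ 2 * s ^+ 2 / 2))%:E.
Proof.
move=> s0; apply: le_trans (normal_prob_integral_le _ _ _) _.
  by move=> x; rewrite lee_fin expR_ge0.
rewrite (_ : (fun x => _) = (fun x => (expR (theta ^+ 2 * s ^+ 2 / 2))%:E *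
     (normal_pdf (theta * s ^+ 2) s x)%:E)).
  rewrite ge0_integralZl//=.
  - by rewrite integral_normal_pdf mule1.
  - by apply/measurable_EFinP; exact: measurable_normal_pdf.
  - by move=> x _; rewrite lee_fin normal_pdf_ge0.
apply/funext => x; rewrite -!EFinM !normal_pdfE//; congr EFin.
rewrite mulrCA [RHS]mulrCA; congr (_ * _)%R.
rewrite /normal_fun -!expRD; congr expR.
by field.
Qed.

End gaussian.

(** * Integration over an increment independent of the past *)

Section freezing.
Context d (Omega : measurableType d) (R : realType) (P : probability Omega R).
Variable G : set (set Omega).
Hypotheses (sG : sigma_algebra setT G) (Gm : G `<=` measurable).
Local Notation OG := (g_sigma_algebraType G).
Local Open Scope ereal_scope.

Lemma sub_sigma_algebra_measurable_fun d' (T' : measurableType d')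
    (Y : Omega -> T') :
  measurable_fun (setT : set OG) (Y : OG -> T') -> measurable_fun setT Y.
Proof.
move=> mY _ B mB; rewrite setTI; apply: Gm; rewrite -(sigma_algebra_id sG).
by have := mY measurableT _ mB; rewrite setTI.
Qed.

(* Pushing P forward by (id, Z), with the sigma-algebra G on the first factor, gives the
   product of P and the law of Z. *)
Lemma integral_indep_freeze (Z : Omega -> R) (N : probability (measurableTypeR R) R)
    (phi : OG * measurableTypeR R -> \bar R) :
  measurable_fun setT Z ->
  (forall A (B : set (measurableTypeR R)), G A -> measurable B ->
     P (A `&` Z @^-1` B) = P A * N B) ->
  measurable_fun setT phi -> (forall z, 0 <= phi z) ->
  \int[P]_o phi (o, Z o) = \int[P]_o \int[N]_z phi (o, z).
Proof.
move=> mZ indep mphi phi0.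
have mid : measurable_fun setT (id : Omega -> OG).
  by move=> _ B mB; rewrite setTI; apply: Gm; rewrite -(sigma_algebra_id sG).
have mpair : measurable_fun setT (fun o : Omega => (o : OG, Z o : measurableTypeR R)).
  exact/measurable_fun_pair.
pose idm : {mfun Omega >-> OG} := HB.pack (id : Omega -> OG) (isMeasurableFun.Build _ _ _ _ _ mid).
pose pairm : {mfun Omega >-> (OG * measurableTypeR R)%type} := HB.pack (fun o : Omega => (o : OG, Z o : measurableTypeR R)) (isMeasurableFun.Build _ _ _ _ _ mpair).
pose PG := distribution P idm.
pose PZ := distribution P pairm.
have PGE A : measurable A -> PG A = P A by [].
have prodE : forall X, measurable X -> (PG \x N) X = PZ X.
  apply: product_measure_unique => A B mA mB.
  rewrite -[RHS]/(P A * N B) -indep//.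
  by rewrite -(sigma_algebra_id sG).
transitivity (\int[PZ]_z phi z).
  by rewrite ge0_integral_distribution.
transitivity (\int[PG \x N]_z phi z).
  by apply: eq_measure_integral => A mA _; exact/esym/prodE.
rewrite fubini_tonelli1// /fubini_F.
rewrite ge0_integral_distribution//; last by move=> x; exact: integral_ge0.
exact: measurable_fun_fubini_tonelli_F.
Qed.

End freezing.

Section normal_scale.
Context {R : realType}.
Local Notation mu := (@lebesgue_measure R).
Local Open Scope ereal_scope.

Lemma normal_pdf_scale (s z : R) : (0 < s)%R ->
  normal_pdf 0 s z = (s^-1 * normal_pdf 0 1 (z / s))%R.
Proof.
move=> s0; rewrite !normal_pdfE ?oner_eq0 ?gt_eqF// mulrA; congr (_ * _)%R.
  rewrite /normal_peak -invfM; congr (_^-1)%R.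
  rewrite -mulrnAr sqrtrM ?sqr_ge0// sqrtr_sqr gtr0_norm//.
  by rewrite expr1n mul1r.
rewrite /normal_fun !subr0 expr1n; congr expR.
by field; rewrite gt_eqF.
Qed.

(** Change of variables z -> z / s. Lebesgue measure equals 1/s times its image under this map, by
    uniqueness on half-open intervals, and [normal_pdf_scale] matches the densities. *)
Lemma normal_prob_scale (s : R) (B : set (measurableTypeR R)) : (0 < s)%R ->
  measurable B -> normal_prob 0 s ((fun z => z / s)%R @^-1` B) = normal_prob 0 1 B.
Proof.
move=> s0 mB.
have md : measurable_fun setT (fun z : measurableTypeR R => (z / s)%R : measurableTypeR R).
  by apply: measurable_funM => //.
pose f : {mfun measurableTypeR R >-> measurableTypeR R} :=
  HB.pack (fun z : measurableTypeR R => (z / s)%R : measurableTypeR R)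
  (isMeasurableFun.Build _ _ _ _ _ md).
have sV0 : (0 <= s^-1)%R by rewrite invr_ge0 ltW.
have [nu nuE] : exists nu : {measure set (measurableTypeR R) -> \bar R},
    nu = mscale (NngNum sV0) (pushforward mu f) :> (set (measurableTypeR R) -> \bar R).
  by unshelve eexists (mscale (NngNum sV0) (pushforward mu f)).
have muE A : measurable A -> mu A = nu A.
  apply: lebesgue_measure_unique => _ [[a b]] _ <-.
  have pre : f @^-1` `]a, b]%classic = `](a * s)%R, (b * s)%R]%classic.
    by apply/seteqP; split => z /=; rewrite !in_itv/= ltr_pdivlMr// ler_pdivrMr.
  rewrite nuE -[LHS]/(mu `]a, b]%classic) -[RHS]/((s^-1)%:E * mu (f @^-1` `]a, b]%classic)).
  rewrite pre !lebesgue_measure_itv/= !lte_fin ltr_pM2r//.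
  case: ifP => // ab; last by rewrite ?mule0.
  by rewrite -!EFinD -EFinM; congr EFin; field; rewrite gt_eqF.
have mpdf : measurable_fun setT (fun x : measurableTypeR R => (normal_pdf 0 1 x)%:E).
  by apply/measurable_EFinP; exact: measurable_normal_pdf.
rewrite /normal_prob.
transitivity (\int[nu]_(x in B) (normal_pdf 0 1 x)%:E); last first.
  by apply: eq_measure_integral => A mA _; exact/esym/muE.
rewrite nuE ge0_integral_mscale//; last 2 first.
  exact: measurable_funTS.
  by move=> x _; rewrite lee_fin normal_pdf_ge0.
rewrite ge0_integral_pushforward//; last 2 first.
  exact: measurable_funTS.
  by move=> x _; rewrite lee_fin normal_pdf_ge0.
rewrite -ge0_integralZl//=.
- by apply: eq_integral => x _; rewrite normal_pdf_scale.
- by rewrite -[X in measurable X]setTI; exact: (md measurableT B mB).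
- apply/measurable_funTS/measurable_EFinP.
  apply: measurableT_comp; [exact: measurable_normal_pdf|exact: (md)].
- by move=> x _; rewrite lee_fin normal_pdf_ge0.
Qed.

End normal_scale.

(** Squaring 1 - x/2 <= exp(-x/2) gives exp(x) (1 - x/2)^2 <= 1. The product of 1 + x + x^2 with (1
    - x/2)^2 is 1 + (x^2 / 4)(1 - 3x + x^2), at least 1 for every x <= 1/4, negative x included. *)
Lemma expR_le_quadratic {R : realType} (x : R) : x <= 4^-1 -> expR x <= 1 + x + x ^+ 2.
Proof.
move=> x4.
have h1 : 1 - x / 2 <= expR (- (x / 2)) by exact: expR_ge1Dx.
have h0 : 0 < 1 - x / 2 by lra.
have h2 : expR x * (1 - x / 2) ^+ 2 <= 1.
  have e : expR x * expR (- (x / 2)) ^+ 2 = 1.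
    rewrite expr2 -!expRD (_ : _ + _ = 0) ?expR0//; by field.
  rewrite -[leRHS]e ler_wpM2l ?expR_ge0// lerXn2r// nnegrE ?expR_ge0//; exact: ltW.
have h3 : 1 <= (1 + x + x ^+ 2) * (1 - x / 2) ^+ 2.
  have -> : (1 + x + x ^+ 2) * (1 - x / 2) ^+ 2 =
    1 + x ^+ 2 / 4 * (1 - 3 * x + x ^+ 2) by field.
  rewrite lerDl mulr_ge0// ?divr_ge0 ?sqr_ge0//.
  have := sqr_ge0 x; lra.
by rewrite -(ler_pM2r (exprn_gt0 2 h0)) (le_trans h2 h3).
Qed.

Section brownian_steps.
Context d (Omega : measurableType d) (R : realType) (P : probability Omega R).
Variables (F : R -> set (set Omega)) (T : R) (w : R -> Omega -> R).
Hypotheses (filtF : is_filtration F T) (wienerw : wiener P F T w).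
Local Notation OF t := (g_sigma_algebraType (F t)).

(** Measurability on the type carrying the sigma-algebra [F t], so that the closure properties of
    measurable functions apply directly; [FmeasP] identifies it with [measurable_at]. *)
Definition Fmeas t (Y : Omega -> R) := measurable_fun (setT : set (OF t)) (Y : OF t -> R).

Lemma filtration_sigma t : 0 <= t <= T -> sigma_algebra setT (F t).
Proof. by case: filtF => + _ _; exact. Qed.

Lemma filtration_sub t : 0 <= t <= T -> F t `<=` measurable.
Proof. by case: filtF => _ + _; exact. Qed.

Lemma FmeasP t Y : 0 <= t <= T -> Fmeas t Y <-> measurable_at F t Y.
Proof.
move=> /filtration_sigma st; split => [mY B mB|mY _ B mB].
  rewrite -(sigma_algebra_id st).
  by have := mY measurableT B mB; rewrite setTI.
rewrite setTI; have := mY _ mB.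
by rewrite -[in X in X -> _](sigma_algebra_id st).
Qed.

Lemma Fmeas_mono s t Y : 0 <= s -> s <= t -> t <= T -> Fmeas s Y -> Fmeas t Y.
Proof.
move=> s0 st tT; rewrite !FmeasP ?s0 ?(le_trans s0 st) ?tT ?(le_trans st tT)//.
by move=> mY B mB; case: filtF => _ _ h; apply: (h s t) => //; exact: mY.
Qed.

Lemma Fmeas_measurable t Y : 0 <= t <= T -> Fmeas t Y -> measurable_fun setT Y.
Proof.
move=> t0T; apply: sub_sigma_algebra_measurable_fun.
- exact: filtration_sigma.
- exact: filtration_sub.
Qed.

Lemma Fmeas_wiener t : 0 <= t <= T -> Fmeas t (w t).
Proof. by move=> t0T; apply/FmeasP => //; case: wienerw => + _ _ _ _; exact. Qed.

Definition winc s t (o : Omega) : R := (w t o - w s o) / Num.sqrt (t - s).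

Lemma wincE s t o : s < t -> w t o - w s o = Num.sqrt (t - s) * winc s t o.
Proof.
by move=> st; rewrite /winc mulrC divfK// gt_eqF// sqrtr_gt0 subr_gt0.
Qed.

Lemma measurable_wiener t : 0 <= t <= T -> measurable_fun setT (w t).
Proof. by move=> t0T; apply: (@Fmeas_measurable t) => //; exact: Fmeas_wiener. Qed.

Lemma measurable_winc s t : 0 <= s -> s < t -> t <= T -> measurable_fun setT (winc s t).
Proof.
move=> s0 st tT; apply: measurable_funM => //; apply: measurable_funB;
  apply: measurable_wiener.
- by rewrite tT (le_trans s0 (ltW st)).
- by rewrite s0 (le_trans (ltW st) tT).
Qed.

Lemma winc_indep s t A (B : set (measurableTypeR R)) :
  0 <= s -> s < t -> t <= T -> F s A -> measurable B ->
  P (A `&` winc s t @^-1` B) = (P A * normal_prob 0 1 B)%E.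
Proof.
move=> s0 st tT FA mB; have q0 : 0 < Num.sqrt (t - s) by rewrite sqrtr_gt0 subr_gt0.
have mB' : measurable ((fun z : measurableTypeR R => z / Num.sqrt (t - s)) @^-1` B).
  rewrite -[X in measurable X]setTI.
  have : measurable_fun setT (fun z : measurableTypeR R => z / Num.sqrt (t - s)).
    exact: measurable_funM.
  by apply.
case: wienerw => _ _ _ law ind.
have := ind s t s0 st tT A _ FA mB'.
by rewrite (law s t s0 st tT _ mB') normal_prob_scale.
Qed.

Lemma winc_freeze s t (phi : OF s * measurableTypeR R -> \bar R) :
  0 <= s -> s < t -> t <= T ->
  measurable_fun setT phi -> (forall z, (0 <= phi z)%E) ->
  (\int[P]_o phi (o, winc s t o) =
   \int[P]_o \int[normal_prob 0 1]_z phi (o, z))%E.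
Proof.
move=> s0 st tT mphi phi0; have s0T : 0 <= s <= T.
  by rewrite s0 (le_trans (ltW st) tT).
apply: integral_indep_freeze => //.
- exact: filtration_sigma.
- exact: filtration_sub.
- exact: measurable_winc.
- by move=> A B FA mB; exact: winc_indep.
Qed.

(** One step of the exponential supermartingale. With [Y] and [a] frozen at time [s] a Gaussian
    exponential moment remains, and [normal_mgf_le] bounds it by the inverse of the compensating
    factor. All integrands are nonnegative, so an unbounded [a] does no harm. *)
Lemma exp_step s t (Y a : Omega -> R) : 0 <= s -> s < t -> t <= T ->
  Fmeas s Y -> Fmeas s a -> (forall o, 0 <= Y o) ->
  (\int[P]_o (Y o * expR (a o * (w t o - w s o) - (a o) ^+ 2 * (t - s) / 2))%:E
   <= \int[P]_o (Y o)%:E)%E.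
Proof.
move=> s0 st tT mY ma Y0.
pose q := Num.sqrt (t - s).
have q2 : q ^+ 2 = t - s by rewrite sqr_sqrtr// subr_ge0 ltW.
pose phi (z : OF s * measurableTypeR R) : \bar R :=
  (Y z.1 * expR (a z.1 * q * z.2 - (a z.1) ^+ 2 * (t - s) / 2))%:E.
have m1 (f : OF s -> R) : measurable_fun setT f ->
   measurable_fun setT (fun z : OF s * measurableTypeR R => f z.1).
  by move=> mf; apply: measurableT_comp => //; exact: measurable_fst.
have mphi : measurable_fun setT phi.
  apply/measurable_EFinP; apply: measurable_funM; first exact: m1.
  apply: measurableT_comp => //; apply: measurable_funB.
    apply: measurable_funM; last exact: measurable_snd.
    by apply: measurable_funM => //; exact: m1.
  apply: measurable_funM => //; apply: measurable_funM => //.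
  by apply: measurable_funX; exact: m1.
have phi0 z : (0 <= phi z)%E by rewrite lee_fin mulr_ge0// expR_ge0.
have := winc_freeze s0 st tT mphi phi0; rewrite /phi/= => e.
under eq_integral do rewrite wincE// -/q mulrA.
rewrite e; apply: ge0_le_integral_pointwise => o.
  by apply: integral_ge0 => z _; exact: (phi0 (o, z)).
have -> : (fun z : measurableTypeR R => (Y o * expR (a o * q * z - a o ^+ 2 * (t - s) / 2))%:E) =
  (fun z => (Y o * expR (- (a o ^+ 2 * (t - s) / 2)))%:E * (expR (a o * q * z))%:E)%E.
  by apply/funext => z; rewrite -EFinM expRD; congr EFin; ring.
rewrite ge0_integralZl//=.
- rewrite -[in leRHS](mulr1 (Y o)).
  apply: (@le_trans _ _ ((Y o * expR (- (a o ^+ 2 * (t - s) / 2)))%:E * 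
    (expR ((a o * q) ^+ 2 * 1 ^+ 2 / 2))%:E)%E).
    by rewrite lee_wpmul2l ?lee_fin ?mulr_ge0 ?expR_ge0// normal_mgf_le// oner_eq0.
  by rewrite -EFinM lee_fin -(mulrA (Y o)) -expRD exprMn q2 expr1n mulr1 addNr expR0.
- apply/measurable_EFinP; apply: (measurableT_comp (@measurable_expR R)).
  by apply: measurable_funM.
- by rewrite lee_fin mulr_ge0// expR_ge0.
Qed.

(** After freezing, exp(a g) <= 1 + a g + (A B)^2 by [expR_le_quadratic]. The linear term integrates
    to 0 because [g] is centred, and 1 + (A B)^2 <= exp((A B)^2). *)
Lemma azuma_step s t (Y a : Omega -> R) (g : R -> R) (A B : R) :
  0 <= s -> s < t -> t <= T ->
  Fmeas s Y -> Fmeas s a -> (forall o, 0 <= Y o) ->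
  measurable_fun setT g -> (forall o, `|a o| <= A) -> (forall z, `|g z| <= B) ->
  (\int[normal_prob 0 1]_z (g z)%:E = 0)%E -> A * B <= 4^-1 ->
  (\int[P]_o (Y o * expR (a o * g (winc s t o)))%:E
   <= (expR ((A * B) ^+ 2))%:E * \int[P]_o (Y o)%:E)%E.
Proof.
move=> s0 st tT mY ma Y0 mg aA gB g0 AB.
have A0 (o : Omega) : 0 <= A by exact: le_trans (normr_ge0 _) (aA o).
have B0 : 0 <= B by exact: le_trans (normr_ge0 _) (gB 0).
pose phi (z : OF s * measurableTypeR R) : \bar R :=
  (Y z.1 * expR (a z.1 * g z.2))%:E.
have m1 (f : OF s -> R) : measurable_fun setT f ->
   measurable_fun setT (fun z : OF s * measurableTypeR R => f z.1).
  by move=> mf; apply: measurableT_comp => //; exact: measurable_fst.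
have mphi : measurable_fun setT phi.
  apply/measurable_EFinP; apply: measurable_funM; first exact: m1.
  apply: measurableT_comp => //; apply: measurable_funM; first exact: m1.
  by apply: measurableT_comp => //; exact: measurable_snd.
have phi0 z : (0 <= phi z)%E by rewrite lee_fin mulr_ge0// expR_ge0.
have := winc_freeze s0 st tT mphi phi0; rewrite /phi/= => ->.
have mYP : measurable_fun setT Y.
  apply: (@Fmeas_measurable s) => //.
  by rewrite s0 (le_trans (ltW st) tT).
have ing : (normal_prob 0 1).-integrable setT (fun z => (g z)%:E).
  apply: (@le_integrable _ _ _ _ _ measurableT _ (fun z => B%:E)) => //.
  - exact/measurable_EFinP.
  - by move=> z _; rewrite lee_fin (le_trans (gB z))// ler_norm.
  - exact: finite_measure_integrable_cst.
rewrite -ge0_integralZl//; last 2 first.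
- exact/measurable_EFinP.
- by move=> o _; rewrite lee_fin.
apply: ge0_le_integral_pointwise => o.
  by apply: integral_ge0 => z _; exact: (phi0 (o, z)).
have agAB z : `|a o * g z| <= A * B by rewrite normrM ler_pM.
have ptw z : expR (a o * g z) <= 1 + (A * B) ^+ 2 + a o * g z.
  apply: le_trans (expR_le_quadratic _) _.
    by apply: le_trans AB; exact: le_trans (ler_norm _) (agAB z).
  rewrite addrAC lerD2r lerD2l -real_normK ?num_real// lerXn2r ?nnegrE//.
  by rewrite mulr_ge0// (A0 o).
apply: (@le_trans _ _ (\int[normal_prob 0 1]_z
    ((Y o * (1 + (A * B) ^+ 2))%:E + (Y o * a o)%:E * (g z)%:E))%E).
  apply: ge0_le_integral_pointwise => z.
    by rewrite lee_fin mulr_ge0// expR_ge0.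
  rewrite -EFinM -EFinD lee_fin -mulrA -mulrDr ler_wpM2l//; exact: ptw.
rewrite integralD//=; last 2 first.
- exact: finite_measure_integrable_cst.
- exact: integrableZl.
rewrite integralZl// g0 mule0 adde0 integral_cst//=.
rewrite [X in (_ * X)%E]probability_setT mule1 -EFinM lee_fin mulrC ler_wpM2r//.
exact: expR_ge1Dx.
Qed.

End brownian_steps.

(** * Tail bounds for martingale transforms of the Wiener increments *)

Section exponential_inequalities.
Context d (Omega : measurableType d) (R : realType) (P : probability Omega R).
Variables (F : R -> set (set Omega)) (T : R) (w : R -> Omega -> R).
Hypotheses (filtF : is_filtration F T) (wienerw : wiener P F T w).
Local Notation Fmeas := (Fmeas F).

Lemma Fmeas_cst t (c : R) : Fmeas t (fun=> c).
Proof. exact: measurable_cst. Qed.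

Lemma FmeasD t (Y Z : Omega -> R) : Fmeas t Y -> Fmeas t Z -> Fmeas t (fun o => Y o + Z o).
Proof. exact: measurable_funD. Qed.

Lemma FmeasB t (Y Z : Omega -> R) : Fmeas t Y -> Fmeas t Z -> Fmeas t (fun o => Y o - Z o).
Proof. exact: measurable_funB. Qed.

Lemma FmeasM t (Y Z : Omega -> R) : Fmeas t Y -> Fmeas t Z -> Fmeas t (fun o => Y o * Z o).
Proof. exact: measurable_funM. Qed.

Lemma Fmeas_comp t (f : R -> R) (Y : Omega -> R) : measurable_fun setT f ->
  Fmeas t Y -> Fmeas t (fun o => f (Y o)).
Proof. exact: measurableT_comp. Qed.

Section stochastic_sum.
Variables (m : nat) (u : nat -> R) (eta : nat -> Omega -> R).
Hypotheses (u0T : forall i, (i <= m)%N -> 0 <= u i <= T)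
  (u_nd : forall i, (i < m)%N -> u i <= u i.+1)
  (meta : forall i, (i < m)%N -> u i < u i.+1 -> Fmeas (u i) (eta i)).

Let term (c : R) i o :=
  c * eta i o * (w (u i.+1) o - w (u i) o) - (c * eta i o) ^+ 2 * (u i.+1 - u i) / 2.

Let mterm c i : (i < m)%N -> Fmeas (u i.+1) (term c i).
Proof.
move=> im; have /andP[ui0 uiT] := u0T (ltnW im).
have /andP[uS0 uST] := u0T im.
have [ui|ui] := ltP (u i) (u i.+1); last first.
  have e : u i.+1 = u i by apply/le_anti; rewrite ui u_nd.
  rewrite (_ : term c i = fun=> 0); first exact: Fmeas_cst.
  by apply/funext => o; rewrite /term e !subrr !mulr0 mul0r subrr.
have me : Fmeas (u i.+1) (eta i).
  by apply: (@Fmeas_mono _ _ _ _ _ filtF (u i)) => //; [exact: ltW|exact: meta].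
have mc : Fmeas (u i.+1) (fun o => c * eta i o) by apply: FmeasM => //; exact: Fmeas_cst.
apply: FmeasB; apply: FmeasM.
- exact: mc.
- apply: FmeasB.
    by apply: (Fmeas_wiener filtF wienerw); rewrite uS0.
  apply: (@Fmeas_mono _ _ _ _ _ filtF (u i)) => //; first exact: ltW.
  by apply: (Fmeas_wiener filtF wienerw); rewrite ui0.
- apply: FmeasM; last exact: Fmeas_cst.
  by apply: measurable_funX.
- exact: Fmeas_cst.
Qed.

Let msum c k : (k <= m)%N -> Fmeas (u k) (fun o => \sum_(i < k) term c i o).
Proof.
elim: k => [|k IH] km.
  by under eq_fun do rewrite big_ord0; exact: Fmeas_cst.
under eq_fun do rewrite big_ord_recr/=.
apply: FmeasD; last exact: mterm.
have /andP[k0 kT] := u0T (ltnW km); have /andP[_ kST] := u0T km.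
by apply: (@Fmeas_mono _ _ _ _ _ filtF (u k)) => //; [exact: u_nd|exact: (IH (ltnW km))].
Qed.

Let exp_supermartingale c :
  (\int[P]_o (expR (\sum_(i < m) term c i o))%:E <= 1)%E.
Proof.
have : (m <= m)%N by []; elim: {-2}m => [|k IH] km.
  under eq_integral do rewrite big_ord0 expR0.
  by rewrite integral_cst//= probability_setT mule1.
apply: le_trans (IH (ltnW km)).
have /andP[k0 kT] := u0T (ltnW km); have /andP[_ kST] := u0T km.
under eq_integral do rewrite big_ord_recr/= expRD.
have [uk|uk] := ltP (u k) (u k.+1).
  have me : Fmeas (u k) (fun o => c * eta k o).
    by apply: FmeasM; [exact: Fmeas_cst|exact: meta].
  exact: (@exp_step _ Omega R P F T w filtF wienerw (u k) (u k.+1)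
    (fun o => expR (\sum_(i < k) term c i o)) (fun o => c * eta k o) k0 uk kST
    (Fmeas_comp (@measurable_expR R) (msum c (ltnW km))) me (fun o => expR_ge0 _)).
apply: ge0_le_integral_pointwise => o; first by rewrite lee_fin mulr_ge0 ?expR_ge0.
have e : u k.+1 = u k by apply/le_anti; rewrite uk u_nd.
by rewrite /term e !subrr !mulr0 mul0r subrr expR0 mulr1.
Qed.

Lemma measurable_stochastic_sum :
  measurable_fun setT (fun o => \sum_(i < m) eta i o * (w (u i.+1) o - w (u i) o)).
Proof.
apply: measurable_sum => i.
have [ui|ui] := ltP (u i) (u i.+1); last first.
  have e : u i.+1 = u i by apply/le_anti; rewrite ui u_nd.
  by under eq_fun do rewrite e subrr mulr0; exact: measurable_cst.
have im := ltn_ord i.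
apply: measurable_funM.
  apply: (Fmeas_measurable filtF (u0T (ltnW im))); exact: meta.
by apply: measurable_funB; apply: (measurable_wiener filtF wienerw); apply: u0T => //; exact: ltnW.
Qed.

Let one_sided (e x y : R) (A : set Omega) : measurable A -> 0 < x -> 0 < y -> e ^+ 2 = 1 ->
  (forall o, A o -> x <= e * \sum_(i < m) eta i o * (w (u i.+1) o - w (u i) o) /\
     \sum_(i < m) (eta i o) ^+ 2 * (u i.+1 - u i) <= y) ->
  (P A <= (expR (- (x ^+ 2 / (2 * y))))%:E)%E.
Proof.
move=> mA x0 y0 e2 hA.
(* x / y minimizes c^2 y / 2 - c x, with minimum -x^2 / (2 y); [e] is the sign of the tail
   considered. *)
pose c := e * (x / y).
pose G o := expR (\sum_(i < m) term c i o).
have GA o : A o -> expR (x ^+ 2 / (2 * y)) <= `|G o|.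
  move=> /hA[h1 h2]; rewrite ger0_norm ?expR_ge0// ler_expR.
  rewrite (_ : \sum_(i < m) term c i o =
    (x / y) * (e * \sum_(i < m) eta i o * (w (u i.+1) o - w (u i) o)) -
    (x / y) ^+ 2 / 2 * \sum_(i < m) (eta i o) ^+ 2 * (u i.+1 - u i)); last first.
    rewrite !mulr_sumr -sumrB; apply: eq_bigr => i _; rewrite /term /c.
    by rewrite !exprMn e2; ring.
  have := ler_wpM2l (ltW (divr_gt0 x0 y0)) h1.
  have := @ler_wpM2l _ ((x / y) ^+ 2 / 2) _ _ _ h2.
  rewrite divr_ge0 ?sqr_ge0// => /(_ isT).
  have -> : (x / y) ^+ 2 / 2 * y = x ^+ 2 / (2 * y) by field; rewrite gt_eqF.
  have -> : x / y * x = x ^+ 2 / (2 * y) *+ 2 by rewrite mulr2n; field; rewrite gt_eqF.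
  by rewrite mulr2n; lra.
have := @markov_cover _ Omega R P 1 G 1 _ A mA (expR_gt0 _) GA.
rewrite expr1 div1r expRN; apply.
under eq_integral do rewrite expr1 ger0_norm ?expR_ge0//.
exact: exp_supermartingale.
Qed.

(** Chernoff's bound is evaluated only on [A], so the quadratic variation has to be bounded on [A]
    alone and no stopping time is introduced. The factor 2 counts the two signs of the sum. *)
Lemma stochastic_sum_tail (x y : R) (A : set Omega) : measurable A -> 0 < x -> 0 < y ->
  (forall o, A o -> x <= `|\sum_(i < m) eta i o * (w (u i.+1) o - w (u i) o)| /\
     \sum_(i < m) (eta i o) ^+ 2 * (u i.+1 - u i) <= y) ->
  (P A <= (2 * expR (- (x ^+ 2 / (2 * y))))%:E)%E.
Proof.
move=> mA x0 y0 hA.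
pose I o := \sum_(i < m) eta i o * (w (u i.+1) o - w (u i) o).
have mI : measurable_fun setT I by exact: measurable_stochastic_sum.
have mp : measurable (I @^-1` `[0, +oo[%classic).
  by rewrite -[X in measurable X]setTI; exact: mI.
have -> : A = (A `&` I @^-1` `[0, +oo[%classic) `|` (A `&` ~` (I @^-1` `[0, +oo[%classic)).
  by rewrite -setIUr setUv setIT.
apply: le_trans (measureU2 _ _ _) _.
- exact: measurableI.
- by apply: measurableI => //; exact: measurableC.
rewrite mulr_natl mulr2n EFinD; apply: leeD.
- apply: (@one_sided 1) => //; rewrite ?expr1n//; first exact: measurableI.
  move=> o [Ao]; rewrite /= in_itv/= andbT => I0.
  by have [h1 h2] := hA o Ao; split => //; rewrite mul1r -[leRHS]/(I o) -(ger0_norm I0).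
- apply: (@one_sided (-1)) => //; rewrite ?sqrrN ?expr1n//.
    by apply: measurableI => //; exact: measurableC.
  move=> o [Ao]; rewrite /= in_itv/= andbT => /negP; rewrite -ltNge => I0.
  by have [h1 h2] := hA o Ao; split => //; rewrite mulN1r -[X in - X]/(I o) -(ltr0_norm I0).
Qed.

End stochastic_sum.

Section azuma.
Variables (m : nat) (u : nat -> R) (a : nat -> Omega -> R) (g : R -> R) (A B : R).
Hypotheses (u0T : forall i, (i <= m)%N -> 0 <= u i <= T)
  (u_inc : forall i, (i < m)%N -> u i < u i.+1)
  (ma : forall i, (i < m)%N -> Fmeas (u i) (a i))
  (mg : measurable_fun setT g) (aA : forall i o, (i < m)%N -> `|a i o| <= A)
  (gB : forall z, `|g z| <= B) (g0 : (\int[normal_prob 0 1]_z (g z)%:E = 0)%E).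
Local Notation D i o := (a i o * g (winc w (u i) (u i.+1) o)).

Let mD c i : (i < m)%N -> Fmeas (u i.+1) (fun o => c * D i o).
Proof.
move=> im; have /andP[ui0 uiT] := u0T (ltnW im).
have /andP[uS0 uST] := u0T im.
apply: FmeasM; first exact: Fmeas_cst.
apply: FmeasM.
  by apply: (@Fmeas_mono _ _ _ _ _ filtF (u i)) => //; [exact/ltW/u_inc|exact: ma].
apply: Fmeas_comp => //; apply: FmeasM; last exact: Fmeas_cst.
apply: FmeasB; first by apply: (Fmeas_wiener filtF wienerw); rewrite uS0.
apply: (@Fmeas_mono _ _ _ _ _ filtF (u i)) => //; first exact/ltW/u_inc.
by apply: (Fmeas_wiener filtF wienerw); rewrite ui0.
Qed.

Let msum c k : (k <= m)%N -> Fmeas (u k) (fun o => \sum_(i < k) c * D i o).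
Proof.
elim: k => [|k IH] km.
  by under eq_fun do rewrite big_ord0; exact: Fmeas_cst.
under eq_fun do rewrite big_ord_recr/=.
apply: FmeasD; last exact: mD.
have /andP[k0 kT] := u0T (ltnW km); have /andP[_ kST] := u0T km.
by apply: (@Fmeas_mono _ _ _ _ _ filtF (u k)) => //; [exact/ltW/u_inc|exact: (IH (ltnW km))].
Qed.

Let azuma_exp c k : `|c| * A * B <= 4^-1 -> (k <= m)%N ->
  (\int[P]_o (expR (\sum_(i < k) c * D i o))%:E <= (expR (k%:R * (c * A * B) ^+ 2))%:E)%E.
Proof.
move=> cAB; elim: k => [|k IH] km.
  under eq_integral do rewrite big_ord0 expR0.
  by rewrite integral_cst//= probability_setT mule1 mul0r expR0.
have /andP[k0 kT] := u0T (ltnW km); have /andP[_ kST] := u0T km.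
under eq_integral do rewrite big_ord_recr/= expRD.
rewrite -natr1 mulrDl mul1r expRD [(expR _ * _)%R]mulrC.
have := @azuma_step _ Omega R P F T w filtF wienerw (u k) (u k.+1)
    (fun o => expR (\sum_(i < k) c * D i o)) (fun o => c * a k o) g (`|c| * A) B.
move/(_ k0 (u_inc km) kST) => h.
under eq_integral do rewrite mulrA.
apply: le_trans (h _ _ _ _ _ _ _ _) _ => //.
- exact: (Fmeas_comp (@measurable_expR R) (msum c (ltnW km))).
- by apply: FmeasM; [exact: Fmeas_cst|exact: ma].
- by move=> o; rewrite normrM ler_wpM2l// aA.
rewrite [leRHS]EFinM; apply: lee_pmul; rewrite ?lee_fin ?expR_ge0//.
- by apply: integral_ge0 => o _; rewrite lee_fin expR_ge0.
- by rewrite -!mulrA !exprMn real_normK ?num_real.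
- exact: (IH (ltnW km)).
Qed.

(** The exponential parameter [c] stays free within the range where the quadratic bound of the
    exponential applies; [small_azuma] chooses it. *)
Lemma azuma_tail (c x : R) (E : set Omega) : measurable E -> 0 < c -> c * A * B <= 4^-1 ->
  (forall o, E o -> x <= `|\sum_(i < m) D i o|) ->
  (P E <= (2 * expR (m%:R * (c * A * B) ^+ 2 - c * x))%:E)%E.
Proof.
move=> mE c0 cAB hE.
have one_sided (e : R) (E' : set Omega) : measurable E' -> `|e| = 1 ->
  (forall o, E' o -> x <= e * \sum_(i < m) D i o) ->
  (P E' <= (expR (m%:R * (c * A * B) ^+ 2 - c * x))%:E)%E.
  move=> mE' e1 hE'.
  pose G o := expR (\sum_(i < m) (c * e) * D i o).
  have GE o : E' o -> expR (c * x) <= `|G o|.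
    move=> /hE' h; rewrite ger0_norm ?expR_ge0// ler_expR -mulr_sumr -mulrA.
    by rewrite ler_wpM2l// ltW.
  have := @markov_cover _ Omega R P 1 G (expR (m%:R * (c * A * B) ^+ 2)) _ E' mE' (expR_gt0 _) GE.
  rewrite expr1 expRD expRN; apply.
  under eq_integral do rewrite expr1 ger0_norm ?expR_ge0//.
  have -> : (c * A * B) ^+ 2 = (c * e * A * B) ^+ 2.
    by rewrite !exprMn -(real_normK (num_real e)) e1 expr1n mulr1.
  by apply: azuma_exp => //; rewrite normrM e1 mulr1 gtr0_norm.
pose I o := \sum_(i < m) 1 * D i o.
have IE o : I o = \sum_(i < m) D i o by apply: eq_bigr => i _; rewrite mul1r.
have mI : measurable_fun setT I.
  by apply: (Fmeas_measurable filtF (u0T (leqnn m))); exact: msum.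
have mp : measurable (I @^-1` `[0, +oo[%classic).
  by rewrite -[X in measurable X]setTI; exact: mI.
have -> : E = (E `&` I @^-1` `[0, +oo[%classic) `|` (E `&` ~` (I @^-1` `[0, +oo[%classic)).
  by rewrite -setIUr setUv setIT.
apply: le_trans (measureU2 _ _ _) _.
- exact: measurableI.
- by apply: measurableI => //; exact: measurableC.
rewrite mulr_natl mulr2n EFinD; apply: leeD.
- apply: (@one_sided 1) => //; rewrite ?normr1//; first exact: measurableI.
  move=> o [/hE]; rewrite /= in_itv/= andbT IE => h I0.
  by rewrite mul1r -(ger0_norm I0).
- apply: (@one_sided (-1)) => //; rewrite ?normrN1//.
    by apply: measurableI => //; exact: measurableC.
  move=> o [/hE]; rewrite /= in_itv/= andbT IE => h /negP; rewrite -ltNge => I0.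
  by rewrite mulN1r -(ltr0_norm I0).
Qed.

End azuma.
End exponential_inequalities.

(** * The law of |zeta| *)

Section standard_normal.
Context {R : realType}.
Local Notation mu := (@lebesgue_measure R).
Local Notation N := (normal_prob (0 : R) 1).

Definition absball (x : R) : set (measurableTypeR R) := [set z | `|z| <= x].

Lemma measurable_absball x : measurable (absball x).
Proof.
rewrite (_ : absball x = `[- x, x]%classic); first exact: measurable_itv.
by apply/seteqP; split => z; rewrite /absball /= in_itv/= ler_norml.
Qed.

(** The distribution function of |zeta|. *)
Definition pabs (x : R) : R := fine (N (absball x)).

Lemma pabsE x : N (absball x) = (pabs x)%:E.
Proof. by rewrite fineK// fin_num_measure//; exact: measurable_absball. Qed.

Lemma pabs_le1 x : 0 <= pabs x <= 1.
Proof.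
rewrite -!lee_fin -pabsE measure_ge0/= probability_le1//.
exact: measurable_absball.
Qed.

(** The Gaussian density decreases on [0, q], so its value at [q] serves as [c0]; of the two halves
    of the set x < |z| <= y the positive one is enough. *)
Lemma pabs_lower_density (q : R) : 0 <= q ->
  exists2 c0, 0 < c0 & forall x y, 0 <= x -> x <= y -> y <= q ->
    pabs x + c0 * (y - x) <= pabs y.
Proof.
move=> q0; exists (normal_pdf 0 1 q).
  rewrite normal_pdfE ?oner_eq0// mulr_gt0 ?expR_gt0// normal_peak_gt0//.
move=> x y x0 xy yq.
have mxy : measurable (`]x, y]%classic : set (measurableTypeR R)) by exact: measurable_itv.
have -> : y - x = fine (mu `]x, y]%classic).
  rewrite lebesgue_measure_itv/= lte_fin; case: ltP => // yx.
  by rewrite (_ : y = x) ?subrr//; apply/le_anti; rewrite xy yx.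
have mf : mu `]x, y]%classic \is a fin_num.
  by rewrite lebesgue_measure_itv/=; case: ifP.
rewrite -lee_fin EFinD EFinM -!pabsE fineK//.
have sub : absball x `|` `]x, y]%classic `<=` absball y.
  move=> z [|] /=; rewrite /absball/=; first by move=> h; exact: le_trans h xy.
  by rewrite in_itv/= => /andP[xz zy]; rewrite ger0_norm// (le_trans x0)// ltW.
apply: le_trans (le_measure N _ _ sub); rewrite ?inE; last 2 first.
- by apply: measurableU => //; exact: measurable_absball.
- exact: measurable_absball.
rewrite measureU//; last 2 first.
- exact: measurable_absball.
- apply/seteqP; split => z //= -[]; rewrite /absball/= in_itv/= => h /andP[xz _].
  by have := le_lt_trans (le_trans (ler_norm z) h) xz; rewrite ltxx.
rewrite leeD2l// /normal_prob.
have -> : ((normal_pdf 0 1 q)%:E * mu `]x, y]%classic = \int[mu]_(z in `]x, y]) (normal_pdf 0 1 q)%:E)%E.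
  by rewrite integral_cst.
apply: ge0_le_integral => //.
- by move=> z _; rewrite lee_fin normal_pdf_ge0.
- by apply/measurable_EFinP/measurable_funTS; exact: measurable_normal_pdf.
move=> z; rewrite /= in_itv/= => /andP[xz zy]; rewrite lee_fin !normal_pdfE ?oner_eq0//.
rewrite ler_wpM2l ?normal_peak_ge0// ler_expR !subr0.
rewrite ler_pM2r ?invr_gt0 ?expr1n// lerN2.
have zq := le_trans zy yq.
have z0 := ltW (le_lt_trans x0 xz).
by rewrite lerXn2r.
Qed.

Section quantile.
Variables (alpha c : R).
Hypotheses (alpha01 : 0 < alpha < 1) (cP : is_chi2_quantile alpha c).

(** For c <= 0 the set x^2 <= c lies in {0}, a null set, whereas its probability 1 - alpha is
    positive. *)
Lemma quantile_gt0 : 0 < c.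
Proof.
rewrite ltNge; apply/negP => c0.
have : N [set x : R | x ^+ 2 <= c] = 0%E.
  apply/eqP; rewrite -measure_le0/=.
  have := @normal_prob_dominates R 0 1.
  move/null_content_dominatesP => /(_ [set 0]) h.
  rewrite -h//; last exact: lebesgue_measure_set1.
  apply: le_measure; rewrite ?inE//.
    exact: (measurable_set_le (measurable_funX 2 (@measurable_id _ _ _)) (measurable_cst c)).
  by move=> z /= zc; have := le_trans zc c0; rewrite real_exprn_even_le0 ?num_real//= => /eqP.
rewrite cP => /eqP; rewrite eqe subr_eq0 => /eqP e; move: alpha01.
by rewrite -e ltxx andbF.
Qed.

Lemma pabs_quantile : pabs (Num.sqrt c) = 1 - alpha.
Proof.
apply: EFin_inj; rewrite -pabsE -cP; congr (N _).
apply/seteqP; split => z; rewrite /absball /=.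
  move=> h; rewrite -real_normK ?num_real// -(sqr_sqrtr (ltW quantile_gt0)).
  by rewrite lerXn2r// nnegrE.
by move=> h; rewrite -sqrtr_sqr ler_wsqrtr.
Qed.

Definition gmin (z : R) : R := Num.min (z ^+ 2) c.

Lemma measurable_gmin : measurable_fun setT gmin.
Proof. by apply: measurable_minr => //; apply: measurable_funX. Qed.

Lemma gmin_ge0 z : 0 <= gmin z.
Proof. by rewrite le_min sqr_ge0 ltW// quantile_gt0. Qed.

Lemma gmin_le z : gmin z <= c.
Proof. by rewrite ge_min lexx orbT. Qed.

Let igmin : N.-integrable setT (fun z : measurableTypeR R => (gmin z)%:E).
Proof.
apply: (@le_integrable _ _ _ _ _ measurableT _ (fun z => c%:E)) => //.
- by apply/measurable_EFinP; exact: measurable_gmin.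
- move=> z _; rewrite lee_fin ger0_norm ?gmin_ge0// gtr0_norm ?quantile_gt0//.
  exact: gmin_le.
- exact: finite_measure_integrable_cst.
Qed.

Lemma wfactorE : (\int[N]_z (gmin z)%:E = (wfactor c)%:E)%E.
Proof. by rewrite /wfactor /Rintegral fineK//; exact: integrable_fin_num. Qed.

(** [gmin] equals [c] where z^2 > c, an event of probability alpha, so the factor is at least c
    alpha. *)
Lemma wfactor_gt0 : 0 < wfactor c.
Proof.
have mA : measurable ([set x : measurableTypeR R | c < x ^+ 2]).
  exact: (measurable_set_lt (measurable_cst c) (measurable_funX 2 (@measurable_id _ _ _))).
have NA : N [set x : R | c < x ^+ 2] = alpha%:E.
  have mB : measurable ([set x : measurableTypeR R | x ^+ 2 <= c]).
    exact: (measurable_set_le (measurable_funX 2 (@measurable_id _ _ _)) (measurable_cst c)).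
  have -> : [set x : R | c < x ^+ 2] = ~` [set x : measurableTypeR R | x ^+ 2 <= c].
    by apply/seteqP; split => z /=; rewrite real_ltNge ?num_real// => /negP.
  have e : N [set x : measurableTypeR R | x ^+ 2 <= c] = (1 - alpha)%:E := cP.
  by rewrite [LHS]probability_setC// [X in (1 - X)%E]e -EFinB opprB addrC subrK.
have : ((c * alpha)%:E <= (wfactor c)%:E)%E.
  rewrite -wfactorE EFinM -NA.
  have -> : (c%:E * N [set x : R | (c < x ^+ 2)%R] =
     \int[N]_z (c%:E * (\1_[set x : R | (c < x ^+ 2)%R] z)%:E))%E.
    rewrite ge0_integralZl_EFin//; last 2 first.
    - by apply/measurable_EFinP/measurable_indic.
    - exact/ltW/quantile_gt0.
    by rewrite integral_indic// setIT.
  apply: ge0_le_integral_pointwise => z.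
    by rewrite -EFinM lee_fin mulr_ge0// ltW// quantile_gt0.
  rewrite -EFinM lee_fin indicE; have [/set_mem h|_] := boolP (z \in _).
    by rewrite mulr1 le_min lexx andbT ltW.
  by rewrite mulr0 gmin_ge0.
rewrite lee_fin; apply: lt_le_trans.
by rewrite mulr_gt0 ?quantile_gt0//; case/andP: alpha01.
Qed.

Lemma integral_gmin_centered : (\int[N]_z (gmin z - wfactor c)%:E = 0)%E.
Proof.
under eq_integral do rewrite EFinB.
rewrite integralB//=; last exact: finite_measure_integrable_cst.
by rewrite wfactorE integral_cst//= probability_setT mule1 subee.
Qed.

End quantile.

Lemma integral_absball_centered x :
  (\int[N]_z (\1_(absball x) z - pabs x)%:E = 0)%E.
Proof.
under eq_integral do rewrite EFinB.
have mb := measurable_absball x.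
rewrite integralB//=; last 2 first.
- exact: integrable_indic.
- exact: finite_measure_integrable_cst.
by rewrite integral_indic// setIT integral_cst//= probability_setT mule1 pabsE subee.
Qed.

End standard_normal.

(** * Cadlag paths and their jumps *)

Section joint_measurability.
Context d (Omega : measurableType d) (R : realType).
Variable U : R -> Omega -> R.
Hypotheses (mU : forall t, measurable_fun setT (U t))
  (rcU : forall o t, U x o @[x --> t^'+] --> U t o).

Let grid (m : nat) (t : R) : R := (Num.floor (t * m.+1%:R) + 1)%:~R / m.+1%:R.

Let grid_gt m t : t < grid m t.
Proof. by rewrite /grid ltr_pdivlMr ?ltr0n// floorD1_gt. Qed.

Let grid_le m t : grid m t <= t + m.+1%:R^-1.
Proof.
rewrite /grid ler_pdivrMr ?ltr0n// mulrDl mulVf ?pnatr_eq0// intrD lerD2r.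
exact: floor_le.
Qed.

(** [U] is the pointwise limit of the maps (t, o) -> U (grid m t) o, each a countable union of
    measurable rectangles. The grid point lies strictly to the right of t, as the right limit
    excludes t itself. *)
Lemma right_continuous_measurable_fun :
  measurable_fun setT (fun z : measurableTypeR R * Omega => U z.1 z.2).
Proof.
apply: (measurable_fun_cvg (h := fun m (z : measurableTypeR R * Omega) => U (grid m z.1) z.2)).
  move=> m _ B mB; rewrite setTI.
  rewrite (_ : _ @^-1` B = \bigcup_(i : int)
      (`[i%:~R / m.+1%:R, (i + 1)%:~R / m.+1%:R[%classic `*`
       U ((i + 1)%:~R / m.+1%:R) @^-1` B)).
    apply: countable_bigcupT_measurable => // i; apply: measurableX => //.
    by rewrite -[X in measurable X]setTI; exact: mU.
  apply/seteqP; split => -[t o] /=.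
    move=> h; exists (Num.floor (t * m.+1%:R)) => //; split => //=.
    rewrite in_itv/= ler_pdivrMr ?ltr0n// ltr_pdivlMr ?ltr0n//.
    exact: floor_itv.
  move=> [i _ [/=]]; rewrite in_itv/= ler_pdivrMr ?ltr0n// ltr_pdivlMr ?ltr0n//.
  by move=> /floor_def h; rewrite /grid h.
move=> [t o] _ /=.
have /cvg_at_rightP := @rcU o t; apply; split; first by move=> m; exact: grid_gt.
apply: (@squeeze_cvgr _ _ _ _ (fun=> t) (fun m => t + m.+1%:R^-1)).
- by apply: nearW => m; rewrite grid_le andbT ltW.
- exact: cvg_cst.
- rewrite -[X in _ --> X]addr0; apply: cvgD; first exact: cvg_cst.
  by have := @cvg_harmonic R.
Qed.

End joint_measurability.

Section paths.
Context {R : realType}.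
Implicit Types (f : R -> R) (T t a b e : R).

(** Paths are controlled on [0, T] only. Composed with [clamp] they become right-continuous on the
    whole line, hence jointly measurable, and are unchanged on [0, T]. *)
Definition clamp T t := Num.max 0 (Num.min T t).

Lemma clamp_in T t : 0 <= T -> 0 <= clamp T t <= T.
Proof. by move=> T0; rewrite /clamp le_max lexx/= ge_max T0 ge_min lexx. Qed.

Lemma clamp_id T t : 0 <= t <= T -> clamp T t = t.
Proof. by move=> /andP[t0 tT]; rewrite /clamp (min_idPr tT) (max_idPr t0). Qed.

Lemma clamp_right_continuous f T t : 0 < T -> cadlag_path T f ->
  f (clamp T x) @[x --> t^'+] --> f (clamp T t).
Proof.
move=> T0 [rc _]; have [t0|t0] := ltP t 0.
  apply: cvg_near_cst; near=> x.
  have x0 : x < 0 by near: x; apply: nbhs_right_lt.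
  by rewrite /clamp !(@min_r _ _ T)// ?max_l// ltW// (lt_trans _ T0).
have [tT|tT] := ltP t T.
  rewrite (clamp_id (t := t)) ?t0 ?ltW//.
  have := rc t; rewrite t0 tT => /(_ isT); apply: cvg_trans.
  apply: near_eq_cvg; near=> x; rewrite clamp_id//.
  apply/andP; split; first by apply: (le_trans t0); apply: ltW; near: x; exact: nbhs_right_gt.
  by apply: ltW; near: x; exact: nbhs_right_lt.
apply: cvg_near_cst; near=> x.
have xt : t < x by near: x; exact: nbhs_right_gt.
by rewrite /clamp !(@min_l _ _ T)// (le_trans tT)// ltW.
Unshelve. all: by end_near. Qed.

Lemma jump_part_no_jump f (s t : R) : 0 <= s -> s <= t ->
  (forall x, s < x <= t -> jump f x = 0) -> jump_part f s = jump_part f t.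
Proof.
move=> s0 st nj; apply: fsbig_widen => [x|x [/=]].
  by rewrite /= !in_itv/= => /andP[-> xs]; exact: le_trans st.
rewrite !in_itv/= => /andP[x0 xt] /negP; rewrite x0 /= -ltNge => sx.
by apply: nj; rewrite sx xt.
Qed.

Lemma jump_count_eq0 f (A : set R) : jump_count f A = 0%E <-> forall x, A x -> jump f x = 0.
Proof.
split=> [h x Ax|h]; last first.
  by apply: esum1 => x /h ->; rewrite eqxx.
apply/eqP; apply/negPn/negP => j0.
have : (1 <= jump_count f A)%E.
  apply: esum_ge; exists [set x]; first by split => // y ->.
  by rewrite fsbig_set1 j0.
by rewrite h lee_fin ler10.
Qed.

Lemma jump_count_ge0 f (A : set R) : (0 <= jump_count f A)%E.
Proof. by apply: esum_ge0 => x _; rewrite lee_fin. Qed.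

Lemma Nbar_eq0 f g (A : set R) : Nbar f g A = 0%E <->
  forall x, A x -> jump f x = 0 /\ jump g x = 0.
Proof.
rewrite /Nbar; split=> [|h].
  move/eqP; rewrite padde_eq0 ?jump_count_ge0// => /andP[/eqP/jump_count_eq0 h1 /eqP/jump_count_eq0 h2].
  by move=> x Ax; split; [exact: h1|exact: h2].
have -> : jump_count f A = 0%E by apply/jump_count_eq0 => x /h[].
by rewrite add0e; apply/jump_count_eq0 => x /h[].
Qed.

(** Turns the differences occurring in [frakL] into counts over a cell; finiteness excludes the
    indeterminate difference of infinities. *)
Lemma Nbar_itv_sub f g (s t : R) : 0 <= s -> s <= t ->
  (Nbar f g `]0%R, s] < +oo)%E ->
  (Nbar f g `]0%R, t] - Nbar f g `]0%R, s])%E = Nbar f g `]s, t].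
Proof.
move=> s0 st fin.
have split_itv h : jump_count h `]0, t] = (jump_count h `]0%R, s] + jump_count h `]s, t])%E.
  rewrite /jump_count (esumID `]0, s]); last by move=> i _; rewrite lee_fin.
  congr (_ + _)%E; congr (esum _ _); apply/seteqP; split => x /=; rewrite !in_itv/=.
  - by move=> [].
  - by move=> /andP[-> xs]; split => //; exact: le_trans st.
  - by move=> [/andP[-> ->]] /negP; rewrite -ltNge andbT.
  - by move=> /andP[sx ->]; rewrite (le_lt_trans s0 sx); split => //; apply/negP; rewrite -ltNge.
have -> : (Nbar f g `]0%R, t] = Nbar f g `]0%R, s] + Nbar f g `]s, t])%E.
  by rewrite /Nbar !split_itv addeACA.
rewrite addeAC subee ?add0e// ge0_fin_numE//.
by rewrite adde_ge0// jump_count_ge0.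
Qed.

End paths.

Section nojump.
Context {R : realType}.
Implicit Types (f : R -> R) (t T a b e : R).

Definition gridpt a b (l i : nat) : R := a + (b - a) * i%:R / l.+1%:R.

(* For a cadlag path the absence of jumps in ]a, b] is the vanishing of the increments
   over uniform grids of [a, b], a countable condition. *)
Definition small_grid_increments f a b :=
  forall m : nat, exists l0 : nat, forall l, (l0 <= l)%N -> forall i, (i <= l)%N ->
    `|f (gridpt a b l i.+1) - f (gridpt a b l i)| < m.+1%:R^-1.

Section cadlag_nojump.
Variables (T : R) (f : R -> R) (a b : R).
Hypotheses (cad : cadlag_path T f) (a0 : 0 <= a) (ab : a < b) (bT : b <= T).

Lemma gridpt_itv l i : (i <= l.+1)%N -> a <= gridpt a b l i <= b.
Proof.
move=> il; have ba : 0 < b - a by rewrite subr_gt0.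
rewrite /gridpt -mulrA lerDl mulr_ge0 ?divr_ge0 ?(ltW ba)//=.
rewrite -lerBrDl ger_pMr// ler_pdivrMr ?ltr0n// mul1r ler_nat//.
Qed.

Lemma gridptS l i : gridpt a b l i.+1 = gridpt a b l i + (b - a) / l.+1%:R.
Proof. by rewrite /gridpt -addn1 natrD; field; rewrite addrC natr1 pnatr_eq0. Qed.

Let local_osc x e : (forall t, a < t <= b -> jump f t = 0) -> a <= x <= b -> 0 < e ->
  exists2 de, 0 < de & forall y, a <= y <= b -> `|x - y| < de -> `|f x - f y| < e.
Proof.
move=> nj /andP[ax xb] e0.
have [rc lc] := cad.
have [d1 d10 H1] : exists2 d1, 0 < d1 & forall y, x < y <= b -> `|x - y| < d1 -> `|f x - f y| < e.
  have [xT|xT] := ltP x b; last first.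
    by exists 1 => // y /andP[xy yb]; have := lt_le_trans xy (le_trans yb xT); rewrite ltxx.
  have := rc x; rewrite (le_trans a0 ax) (lt_le_trans xT bT) => /(_ isT).
  move=> /cvgrPdist_lt /(_ e e0); rewrite near_withinE => /nbhs_ballP[d1 /= d10 H].
  by exists d1 => // y /andP[xy _] yd; apply: H.
have [d2 d20 H2] : exists2 d2, 0 < d2 & forall y, a <= y < x -> `|x - y| < d2 -> `|f x - f y| < e.
  have [xa|xa] := ltP a x; last first.
    by exists 1 => // y /andP[ay yx]; have := le_lt_trans (le_trans xa ay) yx; rewrite ltxx.
  have := lc x; rewrite (le_lt_trans a0 xa) (le_trans xb bT) => /(_ isT) cv.
  have L : lim (f x @[x --> x^'-]) = f x.
    by have := nj x; rewrite xa xb => /(_ isT)/eqP; rewrite subr_eq0 => /eqP.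
  move: cv; rewrite /cvg_to => cv; have {cv} : f y @[y --> x^'-] --> f x by rewrite -[X in _ --> X]L.
  move=> /cvgrPdist_lt /(_ e e0); rewrite near_withinE => /nbhs_ballP[d2 /= d20 H].
  by exists d2 => // y /andP[_ yx] yd; apply: H.
exists (Num.min d1 d2); first by rewrite lt_min d10.
move=> y /andP[ay yb]; rewrite lt_min => /andP[y1 y2].
have [xy|yx|->] := ltgtP x y.
- by apply: H1 => //; rewrite xy.
- by apply: H2 => //; rewrite ay.
- by rewrite subrr normr0.
Qed.

(** Without jumps the path is continuous relative to [a, b], and compactness makes its modulus of
    continuity uniform, so every sufficiently fine grid has small increments. *)
Lemma nojump_small_grid_increments :
  (forall t, a < t <= b -> jump f t = 0) -> small_grid_increments f a b.
Proof.
move=> nj m; set e := m.+1%:R^-1 : R.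
have e0 : 0 < e by rewrite invr_gt0 ltr0n.
have /compact_near_coveringP cov := @segment_compact R a b.
pose P' (l : nat) (x : R) := a <= x <= b -> forall y, a <= y <= b ->
  `|x - y| <= (b - a) / l.+1%:R -> `|f x - f y| < e.
have ba : 0 < b - a by rewrite subr_gt0.
have := cov nat \oo P' _; case.
- move=> x; rewrite /= in_itv/= => axb.
  have [de de0 H] := local_osc nj axb (divr_gt0 e0 (@ltr0n R 2)).
  have de2 : 0 < de / 2 by rewrite divr_gt0.
  exists (ball x (de / 2), [set l : nat | (b - a) / l.+1%:R < de / 2]).
    split => /=; first exact: nbhsx_ballx.
    have /cvgrPdist_lt/(_ (de / 2 / (b - a)) (divr_gt0 de2 ba)) := @cvg_harmonic R.
    apply: filterS => l; rewrite /= sub0r normrN gtr0_norm ?invr_gt0 ?ltr0n//.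
    by rewrite ltr_pdivlMr// mulrC.
  move=> [x' l] /= [bx' hl] ax'b y ayb yx'.
  rewrite [e]splitr (le_lt_trans (ler_distD (f x) _ _))// ltrD//.
    rewrite distrC H//; move: bx'; rewrite /ball/= => h.
    by rewrite (lt_le_trans h)// ler_pdivrMr// ler_pMr// ler1n.
  rewrite H// (le_lt_trans (ler_distD x' _ _))// [de]splitr ltrD//.
  exact: le_lt_trans yx' hl.
move=> l0 _ H; exists l0 => l l0l i il.
have := H l l0l (gridpt a b l i.+1); rewrite /P' /= in_itv/= gridpt_itv//.
apply => //; first by rewrite gridpt_itv// ltnW.
by rewrite gridptS addrAC subrr add0r ger0_norm// divr_ge0// ltW.
Qed.

(** The first grid point at or after t and its predecessor, strictly before t, have values close to
    f t and to the left limit. Their increment therefore approximates the jump, with three errors of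
    size e' / 3. *)
Lemma small_grid_increments_nojump :
  small_grid_increments f a b -> forall t, a < t <= b -> jump f t = 0.
Proof.
move=> sg t /andP[at_ tb]; have [rc lc] := cad.
have t0T : 0 < t <= T by rewrite (le_lt_trans a0 at_) (le_trans tb bT).
have cvL := lc t t0T; rewrite /jump; set L := lim _ in cvL *.
have ba : 0 < b - a by rewrite subr_gt0.
apply/eqP; rewrite -normr_le0; apply/ler_addgt0Pl => e' e'0; rewrite addr0.
pose e := e' / 3; have e0 : 0 < e by rewrite divr_gt0.
have [d2 d20 H2] : exists2 d2, 0 < d2 & forall y, y < t -> `|t - y| < d2 -> `|L - f y| < e.
  move: cvL => /cvgrPdist_lt /(_ e e0); rewrite near_withinE => /nbhs_ballP[d2 /= d20 H].
  by exists d2 => // y yx yd; apply: H.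
have [d1 d10 H1] : exists2 d1, 0 < d1 & forall y, t <= y <= b -> `|t - y| < d1 -> `|f t - f y| < e.
  (* For T <= t no right limit is provided, but then t is the only point of [t, b]. *)
  have [tT|tT] := ltP t T; last first.
    exists 1 => // y /andP[ty yb] _.
    have -> : y = t by apply/le_anti; rewrite ty (le_trans (le_trans yb bT) tT).
    by rewrite subrr normr0.
  have := rc t; rewrite (ltW (le_lt_trans a0 at_)) tT => /(_ isT).
  move=> /cvgrPdist_lt /(_ e e0); rewrite near_withinE => /nbhs_ballP[d1 /= d10 H].
  exists d1 => // y /andP[ty yb] yd.
  move: ty; rewrite le_eqVlt => /predU1P[->|ty]; first by rewrite subrr normr0.
  exact: H.
have [m hm] : exists m : nat, m.+1%:R^-1 < e.
  have /cvgrPdist_lt/(_ e e0)[m _ /(_ m (leqnn m))] := @cvg_harmonic R.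
  by rewrite /= sub0r normrN gtr0_norm ?invr_gt0 ?ltr0n// => h; exists m.
have [l0 Hl0] := sg m.
have dm0 : 0 < Num.min d1 d2 by rewrite lt_min d10.
have [l [l0l hl]] : exists l, (l0 <= l)%N /\ (b - a) / l.+1%:R < Num.min d1 d2.
  have /cvgrPdist_lt/(_ _ (divr_gt0 dm0 ba))[l1 _ H] := @cvg_harmonic R.
  exists (maxn l0 l1); split; first exact: leq_maxl.
  have := H (maxn l0 l1) (leq_maxr _ _).
  rewrite /= sub0r normrN gtr0_norm ?invr_gt0 ?ltr0n//.
  by rewrite ltr_pdivlMr// mulrC.
have hex : exists i, t <= gridpt a b l i.
  by exists l.+1; rewrite /gridpt mulfK ?pnatr_eq0// subrKC.
have [i ti imin] := ex_minnP hex.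
case: i => [|i] in ti imin *.
  by move: ti; rewrite /gridpt mulr0 mul0r addr0 leNgt at_.
have it : gridpt a b l i < t.
  by rewrite ltNge; apply/negP => /imin; rewrite ltnn.
have il : (i <= l)%N.
  by have := imin l.+1; rewrite /gridpt mulfK ?pnatr_eq0// subrKC => /(_ tb).
move: hl; rewrite lt_min => /andP[hl1 hl2].
have h3 := lt_trans (Hl0 l l0l i il) hm.
have e3 : e' = e + e + e by rewrite /e; field.
have h1 : `|f t - f (gridpt a b l i.+1)| < e.
  apply: H1; first by rewrite ti; have /andP[] := @gridpt_itv l i.+1 il.
  rewrite distrC ger0_norm ?subr_ge0// (le_lt_trans _ hl1)//.
  by rewrite gridptS lerBlDr addrC lerD2l ltW.
have h2 : `|L - f (gridpt a b l i)| < e.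
  apply: H2 => //; rewrite gtr0_norm ?subr_gt0// (le_lt_trans _ hl2)//.
  by rewrite lerBlDl -gridptS.
rewrite e3; apply: ltW; rewrite distrC in h2.
rewrite (_ : f t - L = (f t - f (gridpt a b l i.+1)) + (f (gridpt a b l i.+1) - f (gridpt a b l i)) + (f (gridpt a b l i) - L)); last by ring.
by rewrite (le_lt_trans (ler_normD _ _))// ltrD// (le_lt_trans (ler_normD _ _))// ltrD.
Qed.

End cadlag_nojump.
End nojump.

Section nojump_event.
Context d (Omega : measurableType d) (R : realType).

Definition nojump_event (U V : R -> Omega -> R) (a b : R) : set Omega :=
  [set o | forall t, a < t <= b -> jump (U ^~ o) t = 0 /\ jump (V ^~ o) t = 0].

Lemma measurable_nojump_event (T : R) (U V : R -> Omega -> R) (a b : R) :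
  (forall t, 0 <= t <= T -> measurable_fun setT (U t)) ->
  (forall t, 0 <= t <= T -> measurable_fun setT (V t)) ->
  (forall o, cadlag_path T (U ^~ o)) -> (forall o, cadlag_path T (V ^~ o)) ->
  0 <= a -> a < b -> b <= T -> measurable (nojump_event U V a b).
Proof.
move=> mU mV cU cV a0 ab bT.
have mS (W : R -> Omega -> R) : (forall t, 0 <= t <= T -> measurable_fun setT (W t)) ->
    measurable [set o | small_grid_increments (W ^~ o) a b].
  move=> mW.
  rewrite (_ : [set o | _] = \bigcap_m \bigcup_l0 \bigcap_(l in [set l | (l0 <= l)%N])
    \bigcap_(i in [set i | (i <= l)%N])
     [set o | `|W (gridpt a b l i.+1) o - W (gridpt a b l i) o| < m.+1%:R^-1]).
    apply: bigcapT_measurable => m; apply: bigcupT_measurable => l0.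
    apply: bigcap_measurable; first by exists l0 => /=.
    move=> l /= l0l; apply: bigcap_measurable; first by exists 0%N.
    move=> i /= il; apply: (@measurable_set_lt _ _ _ (fun o => `|W (gridpt a b l i.+1) o - W (gridpt a b l i) o|) (fun=> m.+1%:R^-1)) => //.
    apply: measurableT_comp => //; apply: measurable_funB; apply: mW.
      have /andP[h1 h2] := @gridpt_itv _ a b ab l i.+1 il.
      by rewrite (le_trans a0 h1) (le_trans h2 bT).
    have /andP[h1 h2] := @gridpt_itv _ a b ab l i (leqW il).
    by rewrite (le_trans a0 h1) (le_trans h2 bT).
  apply/seteqP; split => o /=.
    by move=> h m _; have [l0 hl0] := h m; exists l0 => // l l0l i il; exact: hl0.
  by move=> h m; have [l0 _ hl0] := h m I; exists l0 => l l0l i il; apply: (hl0 l l0l i il).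
rewrite (_ : nojump_event U V a b = [set o | small_grid_increments (U ^~ o) a b] `&`
  [set o | small_grid_increments (V ^~ o) a b]).
  by apply: measurableI; exact: mS.
apply/seteqP; split => o /=.
  move=> h; split; apply: (@nojump_small_grid_increments _ T) => //.
    by move=> t /h[].
  by move=> t /h[].
move=> [hU hV] t tab; split.
  exact: (@small_grid_increments_nojump _ T (U ^~ o) a b).
exact: (@small_grid_increments_nojump _ T (V ^~ o) a b).
Qed.

End nojump_event.

(** * Events of overwhelming probability *)

Section powR_nat.
Context {R : realType}.
Implicit Types (e : R) (n : nat).

Lemma powRn_gt0 n e : (0 < n)%N -> 0 < n%:R `^ e :> R.
Proof. by move=> n0; rewrite powR_gt0// ltr0n. Qed.

Lemma powRn_le n e e' : (0 < n)%N -> e <= e' -> n%:R `^ e <= n%:R `^ e' :> R.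
Proof. by move=> n0 ee; rewrite ler_powR// ler1n. Qed.

Lemma powRnD n e e' : (0 < n)%N -> n%:R `^ (e + e') = n%:R `^ e * n%:R `^ e' :> R.
Proof. by move=> n0; rewrite powRD// pnatr_eq0 -lt0n n0 implybT. Qed.

Lemma powRn_exp n e k : (n%:R `^ e) ^+ k = n%:R `^ (e * k%:R) :> R.
Proof. by rewrite -powR_mulrn ?powR_ge0// powRrM. Qed.

Lemma near_powRn_ge (e C : R) : 0 < e -> \forall n \near \oo, C <= n%:R `^ e.
Proof.
move=> e0; near=> n.
have n0 : (0 < n)%N by near: n; exact: nbhs_infty_gt.
have h : `|C| `^ e^-1 <= n%:R.
  by near: n; exact: nbhs_infty_ger.
apply: (le_trans (ler_norm C)).
have -> : `|C| = (`|C| `^ e^-1) `^ e by rewrite -powRrM mulVf ?gt_eqF// powRr1.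
by apply: ge0_ler_powR => //; [exact: ltW|rewrite nnegrE powR_ge0|rewrite nnegrE].
Unshelve. all: by end_near. Qed.

End powR_nat.

Section small_events.
Context d (Omega : measurableType d) (R : realType) (P : probability Omega R).
Implicit Types (A B : set Omega) (p : R).

(** A bound on the outer probability: exceptional sets defined through path integrals or almost sure
    identities need not be measurable. *)
Definition covered B p := exists A, [/\ measurable A, B `<=` A & (P A <= p%:E)%E].

Lemma coveredS B B' p p' : B `<=` B' -> p' <= p -> covered B' p' -> covered B p.
Proof.
move=> BB pp [A [mA BA PA]]; exists A; split => //; first exact: subset_trans BA.
by rewrite (le_trans PA)// lee_fin.
Qed.

Lemma coveredU B B' p p' : covered B p -> covered B' p' -> covered (B `|` B') (p + p').
Proof.
move=> [A [mA BA PA]] [A' [mA' BA' PA']]; exists (A `|` A'); split.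
- exact: measurableU.
- by move=> x [/BA|/BA']; [left|right].
- by rewrite (le_trans (measureU2 _ mA mA'))// EFinD leeD.
Qed.

Lemma covered0 : covered set0 0.
Proof. by exists set0; split => //; rewrite measure0. Qed.

Lemma covered_bigcup (B : nat -> set Omega) (n : nat) p :
  (forall j, (1 <= j <= n)%N -> covered (B j) p) ->
  covered (\bigcup_(j in [set j | (1 <= j <= n)%N]) B j) (n%:R * p).
Proof.
elim: n => [|n IH] h.
  rewrite mul0r bigcup0; first exact: covered0.
  by move=> [|i] //= /andP[].
have h1 : covered (\bigcup_(j in [set j | (1 <= j <= n)%N]) B j) (n%:R * p).
  by apply: IH => j /andP[j1 jn]; apply: h; rewrite j1 (leq_trans jn).
have h2 : covered (B n.+1) p by apply: h; rewrite ltnS leqnn.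
have := coveredU h1 h2; rewrite -[X in _ + X]mul1r -mulrDl natr1.
apply: coveredS => // x [j /= /andP[j1 jn] Bx].
move: jn; rewrite leq_eqVlt => /predU1P[jn|jn]; first by right; rewrite -jn.
by left; exists j => //=; rewrite j1.
Qed.

Lemma covered_negligible B : P.-negligible B -> covered B 0.
Proof. by move=> [A [mA PA BA]]; exists A; split => //; rewrite PA. Qed.

Lemma covered_ae (Q : Omega -> Prop) B :
  {ae P, forall o, Q o} -> (forall o, B o -> ~ Q o) -> covered B 0.
Proof.
move=> aeQ BQ; apply: covered_negligible.
by apply: negligibleS aeQ => o /= /BQ.
Qed.

(** Decay faster than every power of n, uniformly over the cells; the constant may depend on [L].
    The free choice of [L] later pays for union bounds and for polynomially growing moments. *)
Definition usmall (B : nat -> nat -> set Omega) := forall L : nat, exists C : R,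
  \forall n \near \oo, forall j, (1 <= j <= n)%N ->
    covered (B n j) (C * n%:R `^ (- L%:R)).

Definition small (B : nat -> set Omega) := forall L : nat, exists C : R,
  \forall n \near \oo, covered (B n) (C * n%:R `^ (- L%:R)).

(** A union bound over n cells, with the exponent L + 1 absorbing the factor n. *)
Lemma usmall_small (B : nat -> nat -> set Omega) : usmall B ->
  small (fun n => \bigcup_(j in [set j | (1 <= j <= n)%N]) B n j).
Proof.
move=> uB L; have [C hC] := uB L.+1; exists C; near=> n.
have n0 : (0 < n)%N by near: n; exact: nbhs_infty_gt.
have hn : forall j, (1 <= j <= n)%N -> covered (B n j) (C * n%:R `^ (- L.+1%:R)).
  by near: n.
have -> : C * n%:R `^ (- L%:R) = n%:R * (C * n%:R `^ (- L.+1%:R)).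
  rewrite mulrCA; congr (_ * _).
  rewrite -{2}(powRr1 (ler0n R n)) -powRnD//; congr (_ `^ _).
  by rewrite -natr1 opprD addrCA subrr addr0.
exact: covered_bigcup.
Unshelve. all: by end_near. Qed.

Lemma smallU (B B' : nat -> set Omega) : small B -> small B' -> small (fun n => B n `|` B' n).
Proof.
move=> sB sB' L; have [C hC] := sB L; have [C' hC'] := sB' L; exists (C + C').
by near=> n; rewrite mulrDl; apply: coveredU; near: n.
Unshelve. all: by end_near. Qed.

Lemma usmallU (B B' : nat -> nat -> set Omega) : usmall B -> usmall B' -> usmall (fun n j => B n j `|` B' n j).
Proof.
move=> sB sB' L; have [C hC] := sB L; have [C' hC'] := sB' L; exists (C + C').
near=> n; move=> j jn; rewrite mulrDl; apply: coveredU; move: j jn; near: n => //.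
Unshelve. all: by end_near. Qed.

Lemma smallS (B B' : nat -> set Omega) : (\forall n \near \oo, B n `<=` B' n) -> small B' -> small B.
Proof.
move=> BB sB L; have [C hC] := sB L; exists C; near=> n.
have h : covered (B' n) (C * n%:R `^ (- L%:R)) by near: n.
apply: coveredS h => //; near: n; exact: BB.
Unshelve. all: by end_near. Qed.

Lemma usmallS (B B' : nat -> nat -> set Omega) : (\forall n \near \oo, forall j, (1 <= j <= n)%N -> B n j `<=` B' n j) ->
  usmall B' -> usmall B.
Proof.
move=> BB sB L; have [C hC] := sB L; exists C; near=> n; move=> j jn.
have h : covered (B' n j) (C * n%:R `^ (- L%:R)) by move: j jn; near: n.
apply: coveredS h => //; move: j jn; near: n; exact: BB.
Unshelve. all: by end_near. Qed.

Lemma usmall_bound (B : nat -> nat -> set Omega) (p : nat -> R) :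
  (\forall n \near \oo, forall j, (1 <= j <= n)%N -> covered (B n j) (p n)) ->
  (forall L : nat, exists C : R, \forall n \near \oo, p n <= C * n%:R `^ (- L%:R)) ->
  usmall B.
Proof.
move=> hB hp L; have [C hC] := hp L; exists C; near=> n; move=> j jn.
have h : covered (B n j) (p n) by move: j jn; near: n; exact: hB.
by apply: coveredS h => //; near: n.
Unshelve. all: by end_near. Qed.

Lemma usmall_null (B : nat -> nat -> set Omega) :
  (\forall n \near \oo, forall j, (1 <= j <= n)%N -> covered (B n j) 0) -> usmall B.
Proof.
move=> h; apply: (usmall_bound h) => L; exists 0; near=> n; by rewrite mul0r.
Unshelve. all: by end_near. Qed.

(** A single term of the exponential series suffices: exp(y) >= y^K / K! with y = c0 n^e and e K >=
    L. *)
Lemma near_expN_powR (C c0 e : R) (L : nat) : 0 < c0 -> 0 < e ->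
  exists C', \forall n \near \oo, C * expR (- (c0 * n%:R `^ e)) <= C' * n%:R `^ (- L%:R).
Proof.
move=> c00 e0; pose K := (Num.truncn (L%:R / e)).+1.
have LK : L%:R <= e * K%:R.
  by rewrite -ler_pdivrMl// mulrC; apply/ltW/truncnS_gt.
exists (`|C| * (K`!%:R / c0 ^+ K)); near=> n.
have n0 : (0 < n)%N by near: n; exact: nbhs_infty_gt.
apply: (@le_trans _ _ (`|C| * expR (- (c0 * n%:R `^ e)))).
  by rewrite ler_wpM2r ?expR_ge0// ler_norm.
rewrite -mulrA ler_wpM2l//.
have y0 : 0 < c0 * n%:R `^ e by rewrite mulr_gt0// powRn_gt0.
have := expR_ge1Dxn (Num.truncn (L%:R / e)) (ltW y0); rewrite -/K => h.
have h' : (c0 * n%:R `^ e) ^+ K / K`!%:R <= expR (c0 * n%:R `^ e).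
  by apply: le_trans h; rewrite lerDr.
have p0 : 0 < (c0 * n%:R `^ e) ^+ K / K`!%:R.
  by rewrite divr_gt0 ?exprn_gt0// ltr0n fact_gt0.
rewrite expRN; apply: (@le_trans _ _ (((c0 * n%:R `^ e) ^+ K / K`!%:R)^-1)).
  by rewrite lef_pV2// posrE// expR_gt0.
rewrite (_ : (_ / _)^-1 = K`!%:R / c0 ^+ K * n%:R `^ (- (e * K%:R))); last first.
  rewrite powRN -powRn_exp exprMn; field.
  by rewrite !expf_neq0 ?gt_eqF ?powRn_gt0// pnatr_eq0 gtn_eqF// fact_gt0.
rewrite ler_wpM2l ?divr_ge0 ?exprn_ge0 ?(ltW c00)//.
by rewrite powRn_le// lerN2.
Unshelve. all: by end_near. Qed.

(** Moments of all orders give decay of all orders: Markov's inequality of order k gains n^(-e k),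
    and k is taken with e k >= L. Measurability is asked of the event [B], not of [Y]. *)
Lemma usmall_moments (Y : nat -> nat -> Omega -> R) (B : nat -> nat -> set Omega)
    (r : nat -> R) (e : R) : 0 < e ->
  (forall k : nat, (1 < k)%N -> exists K : R, \forall n \near \oo, forall j,
     (1 <= j <= n)%N -> (\int[P]_o (`|Y n j o| ^+ k)%:E <= ((K * r n) ^+ k)%:E)%E) ->
  (\forall n \near \oo, 0 < r n) ->
  (\forall n \near \oo, forall j, (1 <= j <= n)%N -> measurable (B n j)) ->
  (\forall n \near \oo, forall j, (1 <= j <= n)%N -> forall o, B n j o ->
     r n * n%:R `^ e <= `|Y n j o|) ->
  usmall B.
Proof.
move=> e0 mom r0 mB hB L; pose k := (Num.truncn (L%:R / e)).+2.
have Lk : L%:R <= e * k%:R.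
  rewrite -ler_pdivrMl// mulrC; apply/ltW; apply: (lt_trans (truncnS_gt _)).
  by rewrite ltr_nat.
have [K hK] := mom k isT; exists (`|K| ^+ k); near=> n; move=> j jn.
have n0 : (0 < n)%N by near: n; exact: nbhs_infty_gt.
have rn : 0 < r n by near: n.
exists (B n j); split => //; first by move: j jn; near: n; exact: mB.
have x0 : 0 < r n * n%:R `^ e by rewrite mulr_gt0// powRn_gt0.
have mBj : measurable (B n j) by move: j jn; near: n; exact: mB.
have hBj : forall o, B n j o -> r n * n%:R `^ e <= `|Y n j o|.
  by move: j jn {mBj}; near: n; exact: hB.
have hKj : (\int[P]_o (`|Y n j o| ^+ k)%:E <= ((K * r n) ^+ k)%:E)%E.
  by move: j jn {mBj hBj}; near: n; exact: hK.
apply: le_trans (markov_cover mBj x0 hBj hKj) _; rewrite lee_fin.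
rewrite !exprMn invfM mulrA mulfK ?expf_neq0 ?gt_eqF//.

rewrite powRn_exp -powRN; apply: (@le_trans _ _ (`|K| ^+ k * n%:R `^ (- (e * k%:R)))).
  by rewrite ler_wpM2r ?powR_ge0// -normrX ler_norm.
by rewrite ler_wpM2l ?exprn_ge0// powRn_le// lerN2.
Unshelve. all: by end_near. Qed.

End small_events.

(** * Integrals along paths over one cell *)

Section time_integrals.
Context d (Omega : measurableType d) (R : realType) (P : probability Omega R).
Local Notation mu := (@lebesgue_measure R).
Local Notation joint f := (fun z : measurableTypeR R * Omega => f z.1 z.2).
Implicit Types (f : R -> Omega -> R) (s t x K : R).

Lemma measurable_comp_fst (g : measurableTypeR R -> R) : measurable_fun setT g ->
  measurable_fun setT (fun z : measurableTypeR R * Omega => g z.1).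
Proof. by move=> mg; apply: measurableT_comp => //; exact: measurable_fst. Qed.

Lemma measurable_comp_snd (g : Omega -> R) : measurable_fun setT g ->
  measurable_fun setT (fun z : measurableTypeR R * Omega => g z.2).
Proof. by move=> mg; apply: measurableT_comp => //; exact: measurable_snd. Qed.

Lemma measurable_section f o : measurable_fun setT (joint f) ->
  measurable_fun setT (fun u : measurableTypeR R => f u o).
Proof.
by move=> mf; exact: (measurableT_comp mf (measurable_pair2 o)).
Qed.

Lemma measurable_time_integral (f : R -> Omega -> \bar R) s t :
  measurable_fun setT (joint f) -> (forall u o, (0 <= f u o)%E) ->
  measurable_fun setT (fun o => \int[mu]_(u in `[s, t]) f u o)%E.
Proof.
move=> mf f0.
pose h (z : measurableTypeR R * Omega) : \bar R := ((\1_(`[s, t]%classic) z.1)%:E * f z.1 z.2)%E.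
have mh : measurable_fun setT h.
  apply: emeasurable_funM => //; apply/measurable_EFinP.
  by apply: measurable_comp_fst; exact: measurable_indic.
have h0 z : (0 <= h z)%E by rewrite mule_ge0// lee_fin.
have := @measurable_fun_fubini_tonelli_G _ _ _ _ _ mu h mh h0.
apply: eq_measurable_fun => o _; rewrite /fubini_G [RHS]integral_mkcond.
apply: eq_integral => u _; rewrite patchE /h indicE /=.
by case: ifP => _; rewrite ?mul1e ?mul0e.
Qed.

(** An elementary replacement for Hoelder's inequality: |f| is at most x where it does not exceed x,
    and at most |f|^(k+1) / x^k elsewhere. *)
Lemma integral_itv_le_moment (f : measurableTypeR R -> R) s t (k : nat) x :
  measurable_fun setT f -> s < t -> 0 < x ->
  (\int[mu]_(u in `[s, t]) (`|f u|)%:E <= x%:E * (t - s)%:E +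
    (x ^- k)%:E * \int[mu]_(u in `[s, t]) (`|f u| ^+ k.+1)%:E)%E.
Proof.
move=> mf st x0.
have msk : measurable_fun (`[s, t]%classic : set (measurableTypeR R)) (fun u => (`|f u| ^+ k.+1)%:E).
  by apply/measurable_EFinP/measurable_funX/measurable_funTS/measurableT_comp.
apply: (@le_trans _ _ (\int[mu]_(u in `[s, t]) (x%:E + (x ^- k)%:E * (`|f u| ^+ k.+1)%:E))%E).
  apply: ge0_le_integral_in => u _; first by rewrite lee_fin.
  rewrite -EFinM -EFinD lee_fin.
  have [fx|fx] := lerP `|f u| x.
    by rewrite (le_trans fx)// lerDl mulr_ge0 ?invr_ge0 ?exprn_ge0// ltW.
  apply: ler_wpDl; first exact: ltW.
  rewrite exprS mulrCA ler_peMr// mulrC ler_pdivlMr ?exprn_gt0// mul1r.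
  by apply: lerXn2r; rewrite ?nnegrE ?(ltW x0)// ltW.
rewrite ge0_integralD//=; last 3 first.
- by move=> u _; rewrite lee_fin ltW.
- by move=> u _; rewrite -EFinM lee_fin mulr_ge0 ?invr_ge0 ?exprn_ge0// ltW.
- exact: measurable_funeM.
rewrite integral_cst//= ge0_integralZl//; last first.
- by rewrite lee_fin invr_ge0 exprn_ge0// ltW.
by rewrite lebesgue_measure_itv/= lte_fin st -EFinB.
Qed.

Lemma expectation_time_integral_le (f : R -> Omega -> \bar R) s t K :
  measurable_fun setT (joint f) -> (forall u o, (0 <= f u o)%E) -> s < t ->
  (forall u, s <= u <= t -> (\int[P]_o f u o <= K%:E)%E) ->
  (\int[P]_o \int[mu]_(u in `[s, t]) f u o <= ((t - s) * K)%:E)%E.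
Proof.
move=> mf f0 st fK.
have -> : ((t - s) * K)%:E = (\int[mu]_(u in `[s, t]) K%:E)%E.
  by rewrite integral_cst//= lebesgue_measure_itv/= lte_fin st -EFinB -EFinM mulrC.
pose h (z : measurableTypeR R * Omega) : \bar R :=
  ((\1_(`[s, t]%classic) z.1)%:E * f z.1 z.2)%E.
have mh : measurable_fun setT h.
  apply: emeasurable_funM => //; apply/measurable_EFinP.
  by apply: measurable_comp_fst; exact: measurable_indic.
have h0 z : (0 <= h z)%E by rewrite mule_ge0// lee_fin.
have fub := @fubini_tonelli _ _ _ _ _ mu P h mh h0.
have e1 : (\int[mu]_u \int[P]_o h (u, o) <= \int[mu]_(u in `[s, t]) K%:E)%E.
  rewrite [leRHS]integral_mkcond; apply: ge0_le_integral_in => u _.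
    exact: integral_ge0.
  rewrite patchE /h/= indicE; case: ifPn => us.
    under eq_integral do rewrite mul1e.
    by apply: fK; move: us; rewrite inE/= in_itv.
  by under eq_integral do rewrite mul0e; rewrite integral0.
apply: le_trans e1; rewrite fub le_eqVlt; apply/orP; left; apply/eqP.
apply: eq_integral => o _; rewrite [LHS]integral_mkcond; apply: eq_integral => u _.
by rewrite patchE /h/= indicE; case: ifP => _; rewrite ?mul1e ?mul0e.
Qed.

(** Markov's inequality is applied to the integral of |f|^(k+1), whose expectation Tonelli's theorem
    computes. [B] is carried along because increments of sigma have controlled moments only on
    jump-free cells. *)
Lemma time_integral_covered f (B : set Omega) s t (k : nat) K x :
  measurable_fun setT (joint f) -> measurable B -> s < t -> 0 < x ->
  (forall u, s <= u <= t -> (\int[P]_o (\1_B o * `|f u o| ^+ k.+1)%:E <= K%:E)%E) ->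
  covered P [set o | B o /\
    ~ (\int[mu]_(u in `[s, t]) (`|f u o|)%:E <= ((t - s) * x * 2)%:E)%E]
    (K / x ^+ k.+1).
Proof.
move=> mf mB st x0 fK.
have ts0 : 0 < t - s by rewrite subr_gt0.
have mfk : measurable_fun setT (joint (fun u o => (`|f u o| ^+ k.+1)%:E)).
  apply/measurable_EFinP/measurable_funX.
  exact: measurableT_comp.
pose I o := (\int[mu]_(u in `[s, t]) (`|f u o| ^+ k.+1)%:E)%E.
have mI : measurable_fun setT I.
  apply: (@measurable_time_integral (fun u o => (`|f u o| ^+ k.+1)%:E)) => //.
(* At this threshold both terms of [integral_itv_le_moment] equal (t - s) x, which explains the
   factor 2 in the event. *)
pose a := (t - s) * x ^+ k.+1; have a0 : 0 < a by rewrite mulr_gt0// exprn_gt0.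
exists (B `&` [set o | a%:E < I o]%E).
have mA : measurable (B `&` [set o | a%:E < I o]%E).
  by apply: measurableI => //; rewrite -[X in measurable X]setTI; apply: emeasurable_fun_o_infty.
split => //.
- move=> o /= [Bo nI]; split => //=; rewrite ltNge; apply/negP => Ia; apply: nI.
  have mfo : measurable_fun setT (fun u : measurableTypeR R => f u o) by exact: measurable_section.
  apply: le_trans (integral_itv_le_moment k mfo st x0) _.
  apply: (@le_trans _ _ (x%:E * (t - s)%:E + (x ^- k)%:E * a%:E)%E).
    by rewrite leeD2l// lee_wpmul2l// lee_fin invr_ge0 exprn_ge0// ltW.
  rewrite -!EFinM -EFinD lee_fin /a exprS.
  by rewrite le_eqVlt; apply/orP; left; apply/eqP; field; rewrite expf_neq0// gt_eqF.
have -> : K / x ^+ k.+1 = ((t - s) * K) / a.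
  by rewrite /a; field; rewrite !expf_neq0 ?gt_eqF.
rewrite [leRHS]EFinM lee_pdivlMr//.
have -> : (P (B `&` [set o | a%:E < I o]%E) * a%:E =
    \int[P]_o (a%:E * (\1_(B `&` [set o | (a%:E < I o)%E]) o)%:E))%E.
  rewrite ge0_integralZl_EFin ?(ltW a0)//.
    by rewrite integral_indic// setIT muleC.
  by apply/measurable_EFinP/measurable_indic.
have mB' : measurable_fun setT (joint (fun (u : R) o => (\1_B o * `|f u o| ^+ k.+1)%:E)).
  apply/measurable_EFinP; apply: measurable_funM; last exact/measurable_EFinP.
  by apply: measurable_comp_snd; exact: measurable_indic.
have p0 u o : (0 <= (\1_B o * `|f u o| ^+ k.+1)%:E)%E.
  by rewrite lee_fin mulr_ge0// exprn_ge0.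
apply: le_trans (expectation_time_integral_le mB' p0 st fK).
apply: ge0_le_integral_pointwise => o.
  by rewrite -EFinM lee_fin mulr_ge0// ltW.
have Ge : (\int[mu]_(u in `[s, t]) (\1_B o * `|f u o| ^+ k.+1)%:E = (\1_B o)%:E * I o)%E.
  rewrite /I -ge0_integralZl//=.
    apply/measurable_EFinP/measurable_funX/measurable_funTS/measurableT_comp => //.
    exact: measurable_section.
rewrite Ge !indicE; have [/set_mem [Bo ao]|_] := boolP (o \in B `&` _).
  by rewrite mule1 (mem_set Bo) mul1e ltW.
by rewrite mule0 mule_ge0// ?lee_fin// integral_ge0// => u _; rewrite lee_fin exprn_ge0.
Qed.

End time_integrals.

Section grid.
Context {R : realType}.
Variables (T : R) (T_gt0 : 0 < T).

Lemma tgrid_itv n j : (j <= n)%N -> 0 <= tgrid T n j <= T.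
Proof.
case: n => [|n] jn; first by rewrite /tgrid invr0 mulr0 lexx ltW.
rewrite /tgrid divr_ge0 ?mulr_ge0 ?(ltW T_gt0)//= ler_pdivrMr ?ltr0n//.
by rewrite mulrC ler_wpM2l ?(ltW T_gt0)// ler_nat.
Qed.

Lemma tgrid_lt n i j : (0 < n)%N -> (i < j)%N -> tgrid T n i < tgrid T n j.
Proof.
by move=> n0 ij; rewrite /tgrid ltr_pM2r ?invr_gt0 ?ltr0n// ltr_pM2r// ltr_nat.
Qed.

Lemma tgrid_pred n j : (1 <= j)%N -> tgrid T n j - tgrid T n j.-1 = T / n%:R.
Proof.
case: j => // j _; rewrite /tgrid /= -mulrBl -mulrBl -[in X in (X - _) * _]natr1.
by rewrite addrAC subrr add0r mul1r.
Qed.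

Lemma tgrid_cell n j : (1 <= j <= n)%N ->
  [/\ 0 <= tgrid T n j.-1, tgrid T n j.-1 < tgrid T n j & tgrid T n j <= T].
Proof.
move=> /andP[j1 jn]; have n0 : (0 < n)%N by exact: leq_trans jn.
have /andP[? _] := @tgrid_itv n j.-1 (leq_trans (leq_pred _) jn).
have /andP[_ ?] := tgrid_itv jn.
by split => //; apply: tgrid_lt => //; rewrite prednK.
Qed.

End grid.

Section usmall_time.
Context d (Omega : measurableType d) (R : realType) (P : probability Omega R).
Variables (T : R) (T_gt0 : 0 < T).
Local Notation mu := (@lebesgue_measure R).

Lemma usmall_time_integral (f : nat -> nat -> R -> Omega -> R)
    (B : nat -> nat -> set Omega) (r : nat -> R) (e : R) : 0 < e ->
  (forall n j, (1 <= j <= n)%N ->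
    measurable_fun setT (fun z : measurableTypeR R * Omega => f n j z.1 z.2)) ->
  (forall n j, (1 <= j <= n)%N -> measurable (B n j)) ->
  (forall n, (0 < n)%N -> 0 < r n) ->
  (forall k : nat, (1 < k)%N -> exists K : R, forall n j u, (1 <= j <= n)%N ->
     tgrid T n j.-1 <= u <= tgrid T n j ->
     (\int[P]_o (\1_(B n j) o * `|f n j u o| ^+ k)%:E <= ((K * r n) ^+ k)%:E)%E) ->
  usmall P (fun n j => [set o | B n j o /\
    ~ (\int[mu]_(u in `[tgrid T n j.-1, tgrid T n j]) (`|f n j u o|)%:E <=
       (r n * n%:R `^ (e - 1))%:E)%E]).
Proof.
move=> e0 mf mB r0 mom L; pose k := (Num.truncn (L%:R / e)).+1.
have Lk : L%:R <= e * k.+1%:R.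
  rewrite -ler_pdivrMl// mulrC; apply/ltW; apply: (lt_trans (truncnS_gt _)).
  by rewrite ltr_nat.
have [K hK] := mom k.+1 isT; exists (`|2 * T * K| ^+ k.+1); near=> n; move=> j jn.
have n0 : (0 < n)%N by near: n; exact: nbhs_infty_gt.
have [s0 st tT] := tgrid_cell T_gt0 jn.
have ne0 : 0 < n%:R `^ e by exact: powRn_gt0.
(* This level makes twice the level times the cell length T / n equal to r n^(e-1). *)
have x0 : 0 < r n * n%:R `^ e / (2 * T).
  by rewrite divr_gt0 ?mulr_gt0// r0.
have := @time_integral_covered _ Omega R P (f n j) (B n j) _ _ k ((K * r n) ^+ k.+1) _
  (mf n j jn) (mB n j jn) st x0 (fun u uI => hK n j u jn uI).
rewrite tgrid_pred; last by case/andP: jn.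
apply: coveredS.
  move=> o /= [Bo h]; split => // h'; apply: h; apply: le_trans h' _.
  rewrite lee_fin le_eqVlt; apply/orP; left; apply/eqP.
  rewrite powRnD// powRN powRr1//; field.
  by rewrite pnatr_eq0 -lt0n n0 gt_eqF.
rewrite (_ : _ / _ = (2 * T * K) ^+ k.+1 * n%:R `^ (- (e * k.+1%:R))); last first.
  rewrite powRN -powRn_exp -exprVn -exprVn -!exprMn; congr (_ ^+ _); field.
  by rewrite !gt_eqF// r0.
apply: (@le_trans _ _ (`|2 * T * K| ^+ k.+1 * n%:R `^ (- (e * k.+1%:R)))).
  by rewrite ler_wpM2r ?powR_ge0// -normrX ler_norm.
by rewrite ler_wpM2l ?exprn_ge0// powRn_le// lerN2.
Unshelve. all: by end_near. Qed.

End usmall_time.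

(** * Moments on the grid *)

Section model.
Context (R : realType) (d : measure_display) (Omega : measurableType d)
  (P : probability Omega R).
Variables (T : R) (T_gt0 : 0 < T) (F : R -> set (set Omega)).
Hypothesis filtF : is_filtration F T.
Variable w : R -> Omega -> R.
Hypothesis wienerw : wiener P F T w.
Variable b : R -> Omega -> R.
Hypothesis b_cadlag : cadlag_adapted F T b.
Variables (J sigma : nat -> R -> Omega -> R).
Hypothesis J_cadlag : forall n, (0 < n)%N -> cadlag_adapted F T (J n).
Hypothesis sigma_cadlag : forall n, (0 < n)%N -> cadlag_adapted F T (sigma n).
Variable sigmat : R -> Omega -> R.
Hypothesis sigmat_adapted : adapted F T sigmat.
Hypothesis sigmatE : forall n, (0 < n)%N -> {ae P, forall omega,
    forall t, 0 <= t <= T ->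
      sigmat t omega = sigma n t omega - jump_part (sigma n ^~ omega) t}.
Hypothesis sigma_bounded : forall p : R, 1 < p -> exists C : R,
    forall n t, (0 < n)%N -> 0 <= t <= T ->
      (Lpnorm P p (sigma n t) <= C%:E)%E.
Hypothesis sigmat_holder : forall p : R, 1 < p -> exists C : R,
    forall s t, 0 <= s <= T -> 0 <= t <= T ->
      (Lpnorm P p (fun omega => sigmat t omega - sigmat s omega)%R
        <= (C * `|t - s| `^ 2^-1)%:E)%E.
Hypothesis b_bounded : forall p : R, 1 < p -> exists C : R,
    forall t, 0 <= t <= T -> (Lpnorm P p (b t) <= C%:E)%E.

Local Notation mu := (@lebesgue_measure R).
Local Notation tl n j := (tgrid T n j.-1).
Local Notation tr n j := (tgrid T n j).

Definition cell_nojump n j := nojump_event (J n) (sigma n) (tl n j) (tr n j).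

Lemma adapted_measurable (U : R -> Omega -> R) t : adapted F T U ->
  0 <= t <= T -> measurable_fun setT (U t).
Proof.
move=> aU t0T; apply: (Fmeas_measurable filtF t0T).
by apply/(FmeasP filtF) => //; exact: aU.
Qed.

Lemma measurable_sigma n t : (0 < n)%N -> 0 <= t <= T -> measurable_fun setT (sigma n t).
Proof. by move=> n0; apply: adapted_measurable; case: (sigma_cadlag n0). Qed.

Lemma measurable_clamped (U : R -> Omega -> R) : cadlag_adapted F T U ->
  measurable_fun setT (fun z : measurableTypeR R * Omega => U (clamp T z.1) z.2).
Proof.
move=> [aU cU]; apply: (@right_continuous_measurable_fun _ _ _ (fun u => U (clamp T u))).
  by move=> t; apply: adapted_measurable => //; exact: clamp_in (ltW T_gt0).
by move=> o t; exact: (@clamp_right_continuous _ (U ^~ o)).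
Qed.

Lemma measurable_cell_nojump n j : (1 <= j <= n)%N -> measurable (cell_nojump n j).
Proof.
move=> jn; have n0 : (0 < n)%N by case/andP: jn => /leq_trans; exact.
have [s0 st tT] := tgrid_cell T_gt0 jn.
have [aJ cJ] := J_cadlag n0; have [as_ cs] := sigma_cadlag n0.
by apply: (measurable_nojump_event (T := T)) => // t t0T; exact: adapted_measurable.
Qed.

Lemma sigma_moments (k : nat) : (1 < k)%N -> exists K : R, forall n t, (0 < n)%N ->
  0 <= t <= T -> (\int[P]_o (`|sigma n t o| ^+ k)%:E <= (K ^+ k)%:E)%E.
Proof.
move=> k1; have := @sigma_bounded k%:R; rewrite ltr1n => /(_ k1)[C hC].
by exists C => n t n0 t0T; apply: Lpnorm_exprn_le; [exact: ltnW|exact: hC].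
Qed.

Lemma b_moments (k : nat) : (1 < k)%N -> exists K : R, forall t,
  0 <= t <= T -> (\int[P]_o (`|b t o| ^+ k)%:E <= (K ^+ k)%:E)%E.
Proof.
move=> k1; have := @b_bounded k%:R; rewrite ltr1n => /(_ k1)[C hC].
by exists C => t t0T; apply: Lpnorm_exprn_le; [exact: ltnW|exact: hC].
Qed.

Lemma cell_in n j u : (1 <= j <= n)%N -> tl n j <= u <= tr n j -> 0 <= u <= T.
Proof.
move=> jn /andP[su ut]; have [s0 st tT] := tgrid_cell T_gt0 jn.
by rewrite (le_trans s0 su) (le_trans ut tT).
Qed.

Lemma indic_moment_le (A : set Omega) (Y : Omega -> R) k :
  (\int[P]_o (\1_A o * `|Y o| ^+ k)%:E <= \int[P]_o (`|Y o| ^+ k)%:E)%E.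
Proof.
apply: ge0_le_integral_pointwise => o.
  by rewrite lee_fin mulr_ge0// exprn_ge0.
by rewrite lee_fin ler_piMl ?exprn_ge0// indicE lern1 leq_b1.
Qed.

(** The jump part of sigma is constant on a jump-free cell, so sigma inherits there the regularity
    of [sigmat]. *)
Lemma sigma_cell_increment n j u o : (0 < n)%N -> (1 <= j <= n)%N -> tl n j <= u <= tr n j ->
  (forall t, 0 <= t <= T -> sigmat t o = sigma n t o - jump_part (sigma n ^~ o) t) ->
  cell_nojump n j o -> sigma n u o - sigma n (tl n j) o = sigmat u o - sigmat (tl n j) o.
Proof.
move=> n0 jn uI sE nj; have [s0 st tT] := tgrid_cell T_gt0 jn.
have /andP[su ut] := uI.
rewrite !sE ?(cell_in jn uI)//; last by rewrite s0 (le_trans (ltW st) tT).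
rewrite (@jump_part_no_jump _ _ (tl n j) u) //; first by ring.
move=> x /andP[sx xu]; have /nj[//] : tl n j < x <= tr n j.
by rewrite sx (le_trans xu ut).
Qed.

(** The 1/2-Hoelder bound on [sigmat] over a cell of length T / n gives the factor n^(-1/2). The
    decomposition of sigma is only almost sure, hence an almost everywhere comparison of
    integrands. *)
Lemma sigma_increment_moments (k : nat) : (1 < k)%N -> exists K : R, forall n j u,
  (1 <= j <= n)%N -> tl n j <= u <= tr n j ->
  (\int[P]_o (\1_(cell_nojump n j) o * `|sigma n u o - sigma n (tl n j) o| ^+ k)%:E <=
    ((K * n%:R `^ (- 2^-1)) ^+ k)%:E)%E.
Proof.
move=> k1; have := @sigmat_holder k%:R; rewrite ltr1n => /(_ k1)[C hC].
exists (`|C| * T `^ 2^-1) => n j u jn uI.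
have n0 : (0 < n)%N by case/andP: jn => /leq_trans; exact.
have [s0 st tT] := tgrid_cell T_gt0 jn; have /andP[su ut] := uI.
have uT := cell_in jn uI.
have sT : 0 <= tl n j <= T by rewrite s0 (le_trans (ltW st) tT).
apply: (@le_trans _ _ (\int[P]_o (`|sigmat u o - sigmat (tl n j) o| ^+ k)%:E)%E).
  apply: ae_ge0_le_integral => //.
  - apply/measurable_EFinP; apply: measurable_funM.
      by apply: measurable_indic; exact: measurable_cell_nojump.
    apply/measurable_funX/measurableT_comp => //.
    by apply: measurable_funB; exact: measurable_sigma.
  - apply/measurable_EFinP/measurable_funX/measurableT_comp => //.
    by apply: measurable_funB; exact: adapted_measurable.
  apply: filterS (sigmatE n0) => o sE _; rewrite lee_fin indicE.
  have [/set_mem nj|_] := boolP (o \in _); last by rewrite mul0r exprn_ge0.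
  by rewrite mul1r (sigma_cell_increment n0 jn uI).
have h := hC (tl n j) u sT uT.
apply: le_trans (Lpnorm_exprn_le (ltnW k1) h) _.
rewrite lee_fin lerXn2r ?nnegrE//.
- by rewrite -lee_fin (le_trans _ h)// Lnorm_ge0.
- by rewrite !mulr_ge0// powR_ge0.
rewrite -mulrA.
apply: (@le_trans _ _ (`|C| * `|u - tl n j| `^ 2^-1)).
  by rewrite ler_wpM2r ?powR_ge0// ler_norm.
rewrite ler_wpM2l//.
have -> : T `^ 2^-1 * n%:R `^ (- 2^-1) = (T / n%:R) `^ 2^-1.
  rewrite powRM ?(ltW T_gt0) ?invr_ge0//; congr (_ * _).
  by rewrite -(powR_inv1 (ler0n R n)) -powRrM mulN1r.
apply: ge0_ler_powR; rewrite ?nnegrE ?divr_ge0// ?(ltW T_gt0)//.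
rewrite ger0_norm ?subr_ge0// -(@tgrid_pred _ T n j) ?lerD2r//.
by case/andP: jn.
Qed.

Section with_epsilon.
Variables (e : R) (e_gt0 : 0 < e).

Lemma usmall_sigma : usmall P (fun n j => [set o | n%:R `^ e <= `|sigma n (tl n j) o|]).
Proof.
apply: (@usmall_moments _ _ _ _ (fun n j => sigma n (tl n j)) _ (fun=> 1) e) => //.
- move=> k /sigma_moments[K hK]; exists K; near=> n; move=> j jn.
  have n0 : (0 < n)%N by near: n; exact: nbhs_infty_gt.
  rewrite mulr1; apply: hK => //.
  by have [s0 st tT] := tgrid_cell T_gt0 jn; rewrite s0 (le_trans (ltW st)).
- by apply: nearW => n; exact: ltr01.
- near=> n; move=> j jn.
  have n0 : (0 < n)%N by near: n; exact: nbhs_infty_gt.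
  apply: (@measurable_set_le _ _ _ (fun=> n%:R `^ e) (fun o => `|sigma n (tl n j) o|)) => //.
  apply: measurableT_comp => //; apply: measurable_sigma => //.
  by have [s0 st tT] := tgrid_cell T_gt0 jn; rewrite s0 (le_trans (ltW st)).
- by near=> n; move=> j jn o /=; rewrite mul1r.
Unshelve. all: by end_near. Qed.

Lemma usmall_winc : usmall P (fun n j => [set o | n%:R `^ e <= `|winc w (tl n j) (tr n j) o|]).
Proof.
apply: (@usmall_bound _ _ _ _ _ (fun n => 2 * expR (- (2^-1 * n%:R `^ (e *+ 2))))).
  near=> n; move=> j jn.
  have n0 : (0 < n)%N by near: n; exact: nbhs_infty_gt.
  have [s0 st tT] := tgrid_cell T_gt0 jn.
  have ts0 : 0 < tr n j - tl n j by rewrite subr_gt0.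
  pose A := [set o | n%:R `^ e <= `|winc w (tl n j) (tr n j) o|].
  have mA : measurable A.
    apply: (@measurable_set_le _ _ _ (fun=> n%:R `^ e)) => //.
    by apply: measurableT_comp => //; exact: (measurable_winc filtF wienerw).
  exists A; split => //.
  (* The standardized increment is a stochastic sum with one step and constant coefficient (t -
     s)^(-1/2), whose quadratic variation is 1. *)
  pose u i := if i is 0%N then tl n j else tr n j.
  pose eta (i : nat) (o : Omega) : R := (Num.sqrt (tr n j - tl n j))^-1.
  have := @stochastic_sum_tail _ Omega R P F T w filtF wienerw 1 u eta _ _ _ (n%:R `^ e) 1 A mA.
  rewrite mulr1 powRn_exp mulr_natr [2^-1 * _]mulrC; apply => //.
  - move=> [|[|//]] _; first by rewrite s0 (le_trans (ltW st)).
    by rewrite (le_trans s0 (ltW st)).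
  - by move=> [|//] _; exact: ltW.
  - by move=> [|//] _ _; exact: measurable_cst.
  - exact: powRn_gt0.
  move=> o /= Ao; rewrite !big_ord1 /=; split.
    by move: Ao; rewrite /winc mulrC.
  by rewrite exprVn sqr_sqrtr ?(ltW ts0)// mulVf ?gt_eqF.
move=> L; apply: near_expN_powR => //.
by rewrite mulrn_wgt0.
Unshelve. all: by end_near. Qed.

Lemma usmall_int_sigma2 : usmall P (fun n j => [set o |
  ~ (\int[mu]_(u in `[tl n j, tr n j]) (`|sigma n (clamp T u) o ^+ 2|)%:E <=
       (n%:R `^ (e - 1))%:E)%E]).
Proof.
have mf n j : (1 <= j <= n)%N -> measurable_fun setT
    (fun z : measurableTypeR R * Omega => sigma n (clamp T z.1) z.2 ^+ 2).
  move=> jn; have n0 : (0 < n)%N by case/andP: jn => /leq_trans; exact.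
  by apply: measurable_funX; apply: measurable_clamped; exact: sigma_cadlag.
have := @usmall_time_integral _ _ _ P T T_gt0
  (fun n _ u o => sigma n (clamp T u) o ^+ 2) (fun _ _ => setT) (fun=> 1) e e_gt0 mf.
move=> /(_ (fun _ _ _ => measurableT) (fun _ _ => ltr01)) h.
apply: usmallS (h _); last first.
  move=> k k1; have k2 : (1 < 2 * k)%N by rewrite (leq_trans k1)// leq_pmull.
  have [K hK] := sigma_moments k2.
  exists (K ^+ 2) => n j u jn uI.
  apply: le_trans (indic_moment_le _ _ _) _.
  have n0 : (0 < n)%N by case/andP: jn => /leq_trans; exact.
  rewrite mulr1 clamp_id ?(cell_in jn uI)// -exprM.
  under eq_integral do rewrite normrX -exprM.
  by apply: hK => //; exact: (cell_in jn uI).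
by near=> n; move=> j jn o /= h'; split => //; rewrite mul1r.
Unshelve. all: by end_near. Qed.

Lemma usmall_int_b : usmall P (fun n j => [set o |
  ~ (\int[mu]_(u in `[tl n j, tr n j]) (`|b (clamp T u) o|)%:E <=
       (n%:R `^ (e - 1))%:E)%E]).
Proof.
have mf n j : (1 <= j <= n)%N -> measurable_fun setT
    (fun z : measurableTypeR R * Omega => b (clamp T z.1) z.2).
  by move=> jn; apply: measurable_clamped.
have := @usmall_time_integral _ _ _ P T T_gt0
  (fun n _ u o => b (clamp T u) o) (fun _ _ => setT) (fun=> 1) e e_gt0 mf.
move=> /(_ (fun _ _ _ => measurableT) (fun _ _ => ltr01)) h.
apply: usmallS (h _); last first.
  move=> k k1; have [K hK] := @b_moments k k1.
  exists K => n j u jn uI.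
  apply: le_trans (indic_moment_le _ _ _) _.
  rewrite mulr1 clamp_id ?(cell_in jn uI)//.
  by apply: hK => //; exact: (cell_in jn uI).
by near=> n; move=> j jn o /= h'; split => //; rewrite mul1r.
Unshelve. all: by end_near. Qed.

Let mincr n j : (1 <= j <= n)%N -> measurable_fun setT
    (fun z : measurableTypeR R * Omega => sigma n (clamp T z.1) z.2 - sigma n (tl n j) z.2).
Proof.
move=> jn; have n0 : (0 < n)%N by case/andP: jn => /leq_trans; exact.
apply: measurable_funB; first by apply: measurable_clamped; exact: sigma_cadlag.
apply: measurable_comp_snd; apply: measurable_sigma => //.
by have [s0 st tT] := tgrid_cell T_gt0 jn; rewrite s0 (le_trans (ltW st)).
Qed.

Lemma usmall_int_sigma_incr : usmall P (fun n j => [set o | cell_nojump n j o /\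
  ~ (\int[mu]_(u in `[tl n j, tr n j]) (`|sigma n (clamp T u) o - sigma n (tl n j) o|)%:E <=
       (n%:R `^ (e - 1 - 2^-1))%:E)%E]).
Proof.
have := @usmall_time_integral _ _ _ P T T_gt0
  (fun n j u o => sigma n (clamp T u) o - sigma n (tl n j) o) cell_nojump
  (fun n => n%:R `^ (- 2^-1)) e e_gt0 mincr measurable_cell_nojump
  (fun n => @powRn_gt0 R n _) => h.
apply: usmallS (h _); last first.
  move=> k k1; have [K hK] := @sigma_increment_moments k k1.
  exists K => n j u jn uI.
  by rewrite clamp_id ?(cell_in jn uI)//; exact: hK.
near=> n; move=> j jn o /= [nj h']; split => //; rewrite -powRnD; last first.
  by near: n; exact: nbhs_infty_gt.
by rewrite addrC.
Unshelve. all: by end_near. Qed.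

(** Serves twice: as the quadratic variation of the error in linearizing the stochastic integral,
    and as the square term when the integral of sigma^2 is compared with a Riemann sum. *)
Lemma usmall_int_sigma_incr2 : usmall P (fun n j => [set o | cell_nojump n j o /\
  ~ (\int[mu]_(u in `[tl n j, tr n j]) (`|(sigma n (clamp T u) o - sigma n (tl n j) o) ^+ 2|)%:E <=
       (n%:R `^ (e - 2))%:E)%E]).
Proof.
have mf n j : (1 <= j <= n)%N -> measurable_fun setT
    (fun z : measurableTypeR R * Omega => (sigma n (clamp T z.1) z.2 - sigma n (tl n j) z.2) ^+ 2).
  by move=> jn; apply: measurable_funX; exact: mincr.
have := @usmall_time_integral _ _ _ P T T_gt0
  (fun n j u o => (sigma n (clamp T u) o - sigma n (tl n j) o) ^+ 2) cell_nojump
  (fun n => n%:R `^ (- 1)) e e_gt0 mf measurable_cell_nojump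
  (fun n => @powRn_gt0 R n _) => h.
apply: usmallS (h _); last first.
  move=> k k1; have k2 : (1 < 2 * k)%N by rewrite (leq_trans k1)// leq_pmull.
  have [K hK] := sigma_increment_moments k2.
  exists (K ^+ 2) => n j u jn uI.
  rewrite clamp_id ?(cell_in jn uI)//.
  under eq_integral do rewrite normrX -exprM.
  apply: le_trans (hK n j u jn uI) _.
  rewrite exprM [(_ * _) ^+ 2]exprMn powRn_exp (_ : - 2^-1 * 2%:R = - 1)//.
  by rewrite mulNr mulVf.
near=> n; move=> j jn o /= [nj h']; split => //; rewrite -powRnD; last first.
  by near: n; exact: nbhs_infty_gt.
by rewrite (_ : -1 + (e - 1) = e - 2)//; ring.
Unshelve. all: by end_near. Qed.

End with_epsilon.
End model.

(** * Linearization of the stochastic integral *)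

Section simple_increment.
Context d (Omega : measurableType d) (R : realType) (P : probability Omega R).
Variables (F : R -> set (set Omega)) (T : R) (w : R -> Omega -> R).
Hypotheses (filtF : is_filtration F T) (wienerw : wiener P F T w).
Local Notation mu := (@lebesgue_measure R).
Local Notation Fmeas := (Fmeas F).

Variable H : simple_process Omega R.
Hypothesis predH : simple_predictable F T H.
Variables (s t : R) (a : Omega -> R).
Hypotheses (s_ge0 : 0 <= s) (st : s < t) (tT : t <= T) (ma : Fmeas s a).

Local Notation m := (sp_size H).
Local Notation tau := (sp_time H).

Let tau_nd i j : (i <= j)%N -> (j <= m)%N -> tau i <= tau j.
Proof.
case: predH => _ nd _ _; elim: j => [|j IH].
  by rewrite leqn0 => /eqP ->.
rewrite leq_eqVlt => /predU1P[-> //|]; rewrite ltnS => ij jm.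
exact: (le_trans (IH ij (ltnW jm)) (nd j jm)).
Qed.

Let cl (x : R) := Num.max s (Num.min x t).

Let cl_itv x : s <= cl x <= t.
Proof. by rewrite /cl le_max lexx/= ge_max (ltW st) ge_min lexx orbT. Qed.

Let cl_le x y : x <= y -> cl x <= cl y.
Proof.
move=> xy; rewrite /cl ge_max le_max lexx/= le_max.
by apply/orP; right; rewrite le_min !ge_min xy lexx orbT.
Qed.

Let lt_cl u x : u <= t -> cl x < u -> x < u.
Proof.
move=> ut; rewrite /cl gt_max => /andP[_]; rewrite gt_min => /orP[//|tu].
by have := lt_le_trans tu ut; rewrite ltxx.
Qed.

Let le_cl u x : s < u -> u <= cl x -> u <= x.
Proof.
move=> su; rewrite /cl le_max => /orP[us|].
  by have := lt_le_trans su us; rewrite ltxx.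
by rewrite le_min => /andP[].
Qed.

(* The partition of [s, t] on whose pieces H - a is constant in time. *)
Definition cut_time (i : nat) : R :=
  if i is i'.+1 then (if (i' <= m)%N then cl (tau i') else t) else s.

(** The first and last pieces of the partition lie outside the time range of [H], where [H] vanishes
    and only -a remains; hence the index shift and the m + 2 pieces. *)
Definition cut_coef (i : nat) (o : Omega) : R :=
  (if i is i'.+1 then (if (i' < m)%N then sp_coef H i' o else 0) else 0) - a o.

Lemma cut_time_itv i : s <= cut_time i <= t.
Proof.
case: i => [|i] /=; first by rewrite lexx ltW.
by case: ifP => _; rewrite ?cl_itv// lexx ltW.
Qed.

Lemma cut_time_0T i : 0 <= cut_time i <= T.
Proof.
have /andP[h1 h2] := cut_time_itv i.
by rewrite (le_trans s_ge0 h1) (le_trans h2 tT).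
Qed.

Lemma cut_time_nd i : cut_time i <= cut_time i.+1.
Proof.
case: i => [|i] /=; first by have /andP[] := cl_itv (tau 0).
have [im|im] := ltnP i m.
  by rewrite (ltnW im); apply/cl_le/tau_nd.
by case: ifP => _ //; have /andP[] := cl_itv (tau i).
Qed.

Lemma cut_time_end : cut_time m.+2 = t.
Proof. by rewrite /= ltnn. Qed.

(** On a nondegenerate piece tau i < t, so clamping can only move tau i forward in time and its
    coefficient is known there. A time beyond t would be moved back, and its coefficient would
    anticipate. *)
Lemma cut_coef_meas i : cut_time i < cut_time i.+1 -> Fmeas (cut_time i) (cut_coef i).
Proof.
have mcst (c : Omega -> R) x : Fmeas x c -> s <= x -> x <= T -> Fmeas x (fun o => c o - a o).
  by move=> mc sx xT; apply: FmeasB => //; apply: (Fmeas_mono filtF _ sx xT).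
have /andP[si _] := cut_time_itv i; have /andP[_ iT] := cut_time_0T i.
case: i si iT => [|i] si iT lti; apply: (mcst _ _ _ si iT); first exact: Fmeas_cst.
case im: (i < m)%N; last exact: Fmeas_cst.
have /andP[t0 tauT] : 0 <= tau i <= T by case: predH => + _ _ _; apply; exact: ltnW.
have mc : Fmeas (tau i) (sp_coef H i).
  by apply/(FmeasP filtF); [rewrite t0|case: predH => _ _ + _; exact].
move: lti; rewrite /= im (ltnW im) => lti.
have taut : tau i < t.
  rewrite ltNge; apply/negP => ti; move: lti; rewrite ltNge.
  have -> : cl (tau i) = t by rewrite /cl (min_idPr ti) (max_idPr (ltW st)).
  by have /andP[_ ->] := cl_itv (tau i.+1).
have h : tau i <= cl (tau i) by rewrite /cl (min_idPl (ltW taut)) le_max lexx orbT.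
apply: (Fmeas_mono filtF t0 h _ mc).
by have /andP[_ h'] := cl_itv (tau i); exact: le_trans tT.
Qed.

Lemma cut_sum o :
  \sum_(i < m.+2) cut_coef i o * (w (cut_time i.+1) o - w (cut_time i) o) =
  sp_integral w H t o - sp_integral w H s o - a o * (w t o - w s o).
Proof.
(* Writes clamping on both sides through the one-sided minima of [sp_integral] at t and at s; for x
   <= s the first two terms cancel. *)
have wcl x : w (cl x) o = w (Num.min x t) o - w (Num.min x s) o + w s o.
  rewrite /cl; have [xs|] := boolP (x <= s); last rewrite -ltNge => sx.
    rewrite (min_idPl (le_trans xs (ltW st))) (min_idPl xs) (max_idPl xs).
    by rewrite subrr add0r.
  rewrite (min_idPr (ltW sx)) subrK; congr w; apply/max_idPr.
  by rewrite le_min (ltW sx) ltW.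
have -> : \sum_(i < m.+2) cut_coef i o * (w (cut_time i.+1) o - w (cut_time i) o) =
   \sum_(i < m.+2) (cut_coef i o + a o) * (w (cut_time i.+1) o - w (cut_time i) o)
   - a o * \sum_(i < m.+2) (w (cut_time i.+1) o - w (cut_time i) o).
  by rewrite mulr_sumr -sumrB; apply: eq_bigr => i _; ring.
congr (_ - _); last first.
  have := @telescope_sumr _ 0 m.+2 (fun i => w (cut_time i) o) isT.
  by rewrite big_mkord cut_time_end => ->.
have c0 : cut_coef 0 o + a o = 0 by rewrite /cut_coef subrK.
have cm : cut_coef m.+1 o + a o = 0 by rewrite /cut_coef ltnn subrK.
rewrite big_ord_recr big_ord_recl /= c0 cm !mul0r add0r addr0.
rewrite /sp_integral -sumrB; apply: eq_bigr => i _.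
rewrite /cut_coef /= /bump /= subrK (ltn_ord i) add0n.
rewrite (ltnW (ltn_ord i)) !wcl.
by ring.
Qed.

Let sp_value_before u o : u <= tau 0 -> sp_value H u o = 0.
Proof.
move=> u0; rewrite /sp_value big1// => i _.
by rewrite ltNge (le_trans u0 (tau_nd (leq0n i) (ltnW (ltn_ord i)))) mulr0.
Qed.

Let sp_value_after u o : tau m < u -> sp_value H u o = 0.
Proof.
move=> mu_; rewrite /sp_value big1// => i _.
by rewrite [u <= _]leNgt (le_lt_trans (tau_nd (ltn_ord i) (leqnn m)) mu_) andbF mulr0.
Qed.

Let sp_value_in u o (i : 'I_m) : tau i < u <= tau i.+1 -> sp_value H u o = sp_coef H i o.
Proof.
move=> /andP[iu ui]; rewrite /sp_value (bigD1 i)//= iu ui mulr1 big1 ?addr0// => j ji.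
have [ij|ij|/val_inj ij] := ltngtP j i; last by rewrite ij eqxx in ji.
  by rewrite [u <= _]leNgt (le_lt_trans (tau_nd ij (ltnW (ltn_ord i))) iu) andbF mulr0.
by rewrite ltNge (le_trans ui (tau_nd ij (ltnW (ltn_ord j)))) mulr0.
Qed.

Lemma cut_coefE i u o : (i < m.+2)%N -> cut_time i < u <= cut_time i.+1 ->
  cut_coef i o = sp_value H u o - a o.
Proof.
move=> im /andP[iu ui]; congr (_ - _).
have /andP[si _] := cut_time_itv i; have /andP[_ it] := cut_time_itv i.+1.
have su := le_lt_trans si iu; have ut := le_trans ui it.
case: i im iu ui {si it} => [|i] im iu ui.
  by rewrite sp_value_before//; apply: (le_cl su); move: ui; rewrite /=.
move: im; rewrite !ltnS => im; move: iu ui; rewrite /= im => /(lt_cl ut) iu.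
case: ifP => [im' /(le_cl su) ui|/negbT im' _].
  by rewrite (@sp_value_in _ _ (Ordinal im')) ?iu.
rewrite sp_value_after//; have -> // : m = i.
by apply/eqP; rewrite eqn_leq im andbT leqNgt.
Qed.

Arguments cut_time : simpl never.

(** As H - a is constant on each piece, equality holds over ]s, t]; the passage to [s, t] is
    monotonicity. *)
Lemma cut_sum_sq o :
  ((\sum_(i < m.+2) (cut_coef i o) ^+ 2 * (cut_time i.+1 - cut_time i))%:E <=
   \int[mu]_(u in `[s, t]) ((sp_value H u o - a o) ^+ 2)%:E)%E.
Proof.
pose q u := ((sp_value H u o - a o) ^+ 2)%:E.
have q0 u : (0 <= q u)%E by rewrite lee_fin sqr_ge0.
have mq : measurable_fun setT (q : measurableTypeR R -> _).
  apply/measurable_EFinP/measurable_funX; apply: measurable_funB => //.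
  apply: measurable_sum => i; apply: measurable_funM => //.
  rewrite (_ : (fun _ => _) = \1_(`]tau i, tau i.+1]%classic : set (measurableTypeR R))).
    exact: measurable_indic.
  by apply/funext => u; rewrite indicE mem_setE in_itv.
have key k : (k <= m.+2)%N ->
  ((\sum_(i < k) (cut_coef i o) ^+ 2 * (cut_time i.+1 - cut_time i))%:E =
   \int[mu]_(u in `]s, cut_time k]) q u)%E.
  elim: k => [|k IH] km; first by rewrite big_ord0 set_itv_ge ?integral_set0//= bnd_simp ltxx.
  have /andP[sk _] := cut_time_itv k.
  have -> : (`]s, cut_time k.+1]%classic = `]s, cut_time k] `|` `]cut_time k, cut_time k.+1])%classic.
    by rewrite -itv_bndbnd_setU// bnd_simp// cut_time_nd.
  rewrite ge0_integral_setU//=; last 2 first.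
  - exact: measurable_funTS.
  - apply/disj_setPRL => u /=; rewrite !in_itv/= => /andP[ku _] /andP[_ uk].
    by have := le_lt_trans uk ku; rewrite ltxx.
  rewrite -IH ?(ltnW km)// big_ord_recr/= EFinD; congr (_ + _)%E.
  transitivity (\int[mu]_(u in `]cut_time k, cut_time k.+1]) ((cut_coef k o) ^+ 2)%:E)%E.
    move: (cut_time_nd k); move: (cut_time k) (cut_time k.+1) => x y xy.
    rewrite integral_cst//= lebesgue_measure_itv/= lte_fin.
    case: ifPn => [_|]; first exact: EFinM.
    rewrite -leNgt => ck.
    have -> : y = x by apply/le_anti; rewrite ck xy.
    by rewrite subrr mulr0 mule0.
  apply: eq_integral => u; rewrite inE/= in_itv/= => uk.
  by rewrite (cut_coefE o km uk).
rewrite key// cut_time_end; apply: ge0_subset_integral => //.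
- exact: measurable_funTS.
- by apply: subset_itvr; rewrite bnd_simp.
Qed.

End simple_increment.

Section ito.
Context d (Omega : measurableType d) (R : realType) (P : probability Omega R).
Local Notation mu := (@lebesgue_measure R).

Lemma covered_all_negligible (B : set Omega) :
  (forall e : R, 0 < e -> covered P B e) -> P.-negligible B.
Proof.
move=> h; have hn (n : nat) : 0 < n.+1%:R^-1 :> R by rewrite invr_gt0 ltr0n.
have /choice[A hA] : forall n : nat, exists A, [/\ measurable A, B `<=` A & (P A <= n.+1%:R^-1%:E)%E].
  by move=> n; exact: h (hn n).
exists (\bigcap_n A n); split.
- by apply: bigcapT_measurable => n; case: (hA n).
- apply/eqP; rewrite -measure_le0; apply/lee_addgt0Pr => e e0; rewrite add0e.
  have /cvgrPdist_lt/(_ e e0)[m _ /(_ m (leqnn m))] := @cvg_harmonic R.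
  rewrite /= sub0r normrN gtr0_norm ?invr_gt0 ?ltr0n// => me.
  have [mA BA PA] := hA m.
  apply: (@le_trans _ _ (P (A m))).
    apply: le_measure; rewrite ?inE//; last exact: bigcap_inf.
    by apply: bigcapT_measurable => n; case: (hA n).
  by rewrite (le_trans PA)// lee_fin ltW.
- by move=> o Bo n _; case: (hA n) => _ + _; exact.
Qed.

(** An infinite integral exceeds every level, so first moments bound the outer probability of this
    event by every e > 0; the level (|K| + 1) / e makes K divided by the level at most e. *)
Lemma ae_time_integral_fin (f : R -> Omega -> R) s t K :
  measurable_fun setT (fun z : measurableTypeR R * Omega => f z.1 z.2) -> s < t ->
  (forall u, s <= u <= t -> (\int[P]_o (`|f u o|)%:E <= K%:E)%E) ->
  {ae P, forall o, (\int[mu]_(u in `[s, t]) (`|f u o|)%:E < +oo)%E}.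
Proof.
move=> mf st fK; apply: covered_all_negligible => e e0.
have x0 : 0 < (`|K| + 1) / e by rewrite divr_gt0// ltr_wpDl.
have fK' u : s <= u <= t -> (\int[P]_o (\1_(setT : set Omega) o * `|f u o| ^+ 1)%:E <= K%:E)%E.
  move=> ust; under eq_integral do rewrite indicT mul1r expr1.
  exact: fK.
have := @time_integral_covered _ _ _ P f setT s t 0%N K _ mf measurableT st x0 fK'.
apply: coveredS.
  by move=> o /= h; split => // h'; apply: h; apply: le_lt_trans h' _; exact: ltry.
rewrite expr1 invf_div mulrA ler_pdivrMr ?ltr_wpDl// mulrC ler_wpM2l ?(ltW e0)//.
by rewrite (le_trans (ler_norm K))// lerDl.
Qed.

Lemma measurable_sp_value (H : simple_process Omega R) :
  (forall i, (i < sp_size H)%N -> measurable_fun setT (sp_coef H i)) ->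
  measurable_fun setT (fun z : measurableTypeR R * Omega => sp_value H z.1 z.2).
Proof.
move=> mH; apply: measurable_sum => i; apply: measurable_funM.
  by apply: measurable_comp_snd; exact: mH.
have mi : measurable_fun setT (\1_(`]sp_time H i, sp_time H i.+1]%classic) : measurableTypeR R -> R).
  exact: measurable_indic.
have := measurable_comp_fst (Omega := Omega) mi.
by apply: eq_measurable_fun => z _; rewrite indicE mem_setE in_itv.
Qed.

Variables (F : R -> set (set Omega)) (T : R) (w : R -> Omega -> R).
Hypotheses (T_gt0 : 0 < T) (filtF : is_filtration F T) (wienerw : wiener P F T w).
Variables (sig M : R -> Omega -> R) (K : R).
Hypotheses (sig_cadlag : cadlag_adapted F T sig)
  (sig_bounded : forall u, 0 <= u <= T -> (\int[P]_o (`|sig u o| ^+ 2)%:E <= K%:E)%E)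
  (itoM : ito_integral P F T w sig M).

Let mjoint : measurable_fun setT (fun z : measurableTypeR R * Omega => sig (clamp T z.1) z.2).
Proof. exact: (measurable_clamped T_gt0 filtF). Qed.

Let sp_value_bounded (H : simple_process Omega R) : simple_predictable F T H ->
  exists C : R, forall u o, `|sp_value H u o| <= C.
Proof.
move=> [_ _ _ [C hC]]; exists (\sum_(i < sp_size H) `|C|) => u o.
apply: (le_trans (ler_norm_sum _ _ _)); apply: ler_sum => i _.
rewrite normrM; apply: (@le_trans _ _ (`|sp_coef H i o|)).
  by rewrite ler_piMr// normr_nat lern1 leq_b1.
by rewrite (le_trans (hC i o (ltn_ord i)))// ler_norm.
Qed.

(** One simple process is chosen for which three approximation errors, of the integral at t, at s,
    and of the integrand, each have probability at most the target p. The simple integral minus its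
    linear part is a stochastic sum of quadratic variation at most 2 y + 2 y, with tail 2 p; in
    total 5 p. The threshold 3 x is shared by the two integral errors and this sum. *)
Lemma ito_increment_covered s t x y : 0 <= s -> s < t -> t <= T -> 0 < x -> 0 < y ->
  covered P [set o | 3 * x < `|M t o - M s o - sig s o * (w t o - w s o)| /\
    (\int[mu]_(u in `[s, t]) (`|(sig (clamp T u) o - sig s o) ^+ 2|)%:E <= y%:E)%E]
    (5 * expR (- (x ^+ 2 / (2 * (4 * y))))).
Proof.
move=> s0 st tT x0 y0; set p := expR _; have p0 : 0 < p by exact: expR_gt0.
have sT : 0 <= s <= T by rewrite s0 (le_trans (ltW st)).
have tT' : 0 <= t <= T by rewrite (le_trans s0 (ltW st)).
have [aM _ [H [pH cH cI]]] := itoM.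
have near_le (Y : nat -> Omega -> R) (e : R) : cvg_in_probability_to0 P Y -> 0 < e ->
    \forall k \near \oo, (P [set o | (e <= `|Y k o|)%R] <= p%:E)%E.
  move=> cY e0; have h := cY e e0.
  have nb : nbhs (0%E : \bar R) [set z | (z < p%:E)%E].
    by apply: (@open_ereal_lt' _ 0%E p%:E); rewrite lte_fin.
  by have [N _ hN] := h _ nb; exists N => // k Nk; apply: ltW; exact: (hN k Nk).
have n1 := near_le _ x (cI t tT') x0.
have n2 := near_le _ x (cI s sT) x0.
have n3 := near_le _ y cH y0.
have [k [h1 h2 h3]] : exists k,
    [/\ (P [set o | (x <= `|sp_integral w (H k) t o - M t o|)%R] <= p%:E)%E,
        (P [set o | (x <= `|sp_integral w (H k) s o - M s o|)%R] <= p%:E)%E &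
        (P [set o | (y <= `|\int[mu]_(u in `[0, T]) (sp_value (H k) u o - sig u o) ^+ 2|)%R] <= p%:E)%E].
  have : \forall k \near \oo, 
    [/\ (P [set o | (x <= `|sp_integral w (H k) t o - M t o|)%R] <= p%:E)%E,
        (P [set o | (x <= `|sp_integral w (H k) s o - M s o|)%R] <= p%:E)%E &
        (P [set o | (y <= `|\int[mu]_(u in `[0, T]) (sp_value (H k) u o - sig u o) ^+ 2|)%R] <= p%:E)%E].
    by near=> k; split; near: k.
  by move=> [k _ hk]; exists k; apply: (hk k (leqnn k)).
have {n1 n2 n3 near_le cH cI} := pH k; move: (H k) h1 h2 h3 => {H pH} {}H h1 h2 h3 pH.
have mcoef i : (i < sp_size H)%N -> measurable_fun setT (sp_coef H i).
  move=> im; have [tau0T _ mc _] := pH.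
  apply: (Fmeas_measurable filtF (tau0T i (ltnW im))).
  by apply/(FmeasP filtF); [exact: tau0T (ltnW im)|exact: mc].
have mM u : 0 <= u <= T -> measurable_fun setT (M u) by exact: (adapted_measurable filtF).
have mw u : 0 <= u <= T -> measurable_fun setT (w u) by exact: (measurable_wiener filtF wienerw).
have msig u : 0 <= u <= T -> measurable_fun setT (sig u).
  by apply: (adapted_measurable filtF); case: sig_cadlag.
have mspI u : 0 <= u <= T -> measurable_fun setT (sp_integral w H u).
  move=> /andP[u0 uT]; have [tau0T _ _ _] := pH; apply: measurable_sum => i.
  have mi l : (l <= sp_size H)%N -> 0 <= Num.min (sp_time H l) u <= T.
    by move=> /tau0T/andP[l0 lT]; rewrite le_min l0 u0/= ge_min lT.
  apply: measurable_funM; first exact: mcoef.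
  by apply: measurable_funB; apply: mw; apply: mi => //; exact: ltnW.
have mA1 u : 0 <= u <= T -> measurable [set o | x <= `|sp_integral w H u o - M u o|].
  move=> u0T; apply: (@measurable_set_le _ _ _ (fun=> x)) => //.
  by apply: measurableT_comp => //; apply: measurable_funB; [exact: mspI|exact: mM].
have mspv := measurable_sp_value mcoef.
pose D u o := sp_value H u o - sig (clamp T u) o.
have mD : measurable_fun setT (fun z : measurableTypeR R * Omega => D z.1 z.2).
  exact: measurable_funB.
pose ID o := (\int[mu]_(u in `[0%R, T]) (D u o ^+ 2)%:E)%E.
have mID : measurable_fun setT ID.
  apply: (@measurable_time_integral _ _ _ (fun u o => (D u o ^+ 2)%:E)).
    by apply/measurable_EFinP/measurable_funX.
  by move=> u o; rewrite lee_fin sqr_ge0.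
have IDE o : \int[mu]_(u in `[0, T]) (sp_value H u o - sig u o) ^+ 2 = fine (ID o).
  congr fine; apply: eq_integral => u; rewrite inE/= in_itv/= => u0T.
  by rewrite /D clamp_id.
have mA3 : measurable [set o | y <= `|\int[mu]_(u in `[0, T]) (sp_value H u o - sig u o) ^+ 2|].
  apply: (@measurable_set_le _ _ _ (fun=> y)) => //.
  apply: measurableT_comp => //; under eq_fun do rewrite IDE.
  by apply: measurableT_comp => //.
pose cs o := \sum_(i < (sp_size H).+2) cut_coef H (sig s) i o *
   (w (cut_time H s t i.+1) o - w (cut_time H s t i) o).
pose cq o := \sum_(i < (sp_size H).+2) (cut_coef H (sig s) i o) ^+ 2 *
   (cut_time H s t i.+1 - cut_time H s t i).
have msigs : Fmeas F s (sig s).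
  by apply/(FmeasP filtF) => //; case: sig_cadlag => + _; exact.
have ct0T i : 0 <= cut_time H s t i <= T by exact: cut_time_0T.
have ctnd i : cut_time H s t i <= cut_time H s t i.+1 by exact: (cut_time_nd pH).
have mct i : cut_time H s t i < cut_time H s t i.+1 ->
   Fmeas F (cut_time H s t i) (cut_coef H (sig s) i) by exact: (cut_coef_meas filtF pH s0 st tT msigs).
have mcs : measurable_fun setT cs.
  exact: (measurable_stochastic_sum filtF wienerw (fun i _ => ct0T i) (fun i _ => ctnd i)
    (fun i _ => @mct i)).
have mcq : measurable_fun setT cq.
  apply: measurable_sum => i.
  have [ui|ui] := ltP (cut_time H s t i) (cut_time H s t i.+1); last first.
    have -> : cut_time H s t i.+1 = cut_time H s t i by apply/le_anti; rewrite ui ctnd.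
    by under eq_fun do rewrite subrr mulr0; exact: measurable_cst.
  apply: measurable_funM => //; apply: measurable_funX.
  exact: (Fmeas_measurable filtF (ct0T i) (mct i ui)).
pose A4 := [set o | x <= `|cs o|] `&` [set o | cq o <= 4 * y].
have mA4 : measurable A4.
  apply: measurableI.
    by apply: (@measurable_set_le _ _ _ (fun=> x)) => //; exact: measurableT_comp.
  exact: (@measurable_set_le _ _ _ cq (fun=> 4 * y)).
have PA4 : covered P A4 (2 * p).
  exists A4; split => //.
  have y4 : 0 < 4 * y by rewrite mulr_gt0.
  apply: (@stochastic_sum_tail _ Omega R P F T w filtF wienerw (sp_size H).+2
    (cut_time H s t) (cut_coef H (sig s)) (fun i _ => ct0T i) (fun i _ => ctnd i)
    (fun i _ => @mct i) x (4 * y) A4 mA4 x0 y4).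
  by move=> o [].
have c1 : covered P [set o | x <= `|sp_integral w H t o - M t o|] p.
  by exists [set o | x <= `|sp_integral w H t o - M t o|]; split => //; exact: mA1.
have c2 : covered P [set o | x <= `|sp_integral w H s o - M s o|] p.
  by exists [set o | x <= `|sp_integral w H s o - M s o|]; split => //; exact: mA1.
have c3 : covered P [set o | y <= `|\int[mu]_(u in `[0, T]) (sp_value H u o - sig u o) ^+ 2|] p.
  exists [set o | y <= `|\int[mu]_(u in `[0, T]) (sp_value H u o - sig u o) ^+ 2|].
  by split; [exact: mA3| |exact: h3].
have msig2 : measurable_fun setT (fun z : measurableTypeR R * Omega => sig (clamp T z.1) z.2 ^+ 2).
  exact: measurable_funX.
(* A real-valued integral takes the value 0 when the integral is infinite, so a small value says
   nothing by itself. Almost sure finiteness of the integral of sig^2 removes this case. *)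
have c5 : covered P [set o | ~ (\int[mu]_(u in `[0%R, T]) (`|sig (clamp T u) o ^+ 2|)%:E < +oo)%E] 0.
  apply: covered_negligible.
  apply: (@ae_time_integral_fin (fun u o => sig (clamp T u) o ^+ 2) 0 T K msig2 T_gt0) => u u0T.
  by under eq_integral do rewrite normrX; rewrite clamp_id//; exact: sig_bounded.
have := coveredU (coveredU (coveredU (coveredU c1 c2) c3) PA4) c5.
apply: coveredS; last first.
  by rewrite (_ : p + p + p + 2 * p + 0 = 5 * p)//; ring.
move=> o [/= hM hI].
have [g1|g1] := leP x `|sp_integral w H t o - M t o|; first by do 4 left.
have [g2|g2] := leP x `|sp_integral w H s o - M s o|; first by do 3 left; right.
have [g3|g3] := leP y `|\int[mu]_(u in `[0, T]) (sp_value H u o - sig u o) ^+ 2|; first by do 2 left; right.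
have [g5|g5] := pselect (\int[mu]_(u in `[0%R, T]) (`|sig (clamp T u) o ^+ 2|)%:E < +oo)%E; last by right.
left; right; split => /=.
  have e : M t o - M s o - sig s o * (w t o - w s o) =
     cs o - (sp_integral w H t o - M t o) + (sp_integral w H s o - M s o).
    by rewrite /cs (cut_sum w H (sig s) st o); ring.
  move: hM; rewrite e => hM.
  have := ler_normD (cs o - (sp_integral w H t o - M t o)) (sp_integral w H s o - M s o).
  have := ler_normB (cs o) (sp_integral w H t o - M t o).
  by lra.
rewrite -lee_fin; apply: (le_trans (cut_sum_sq pH (sig s) st o)).
have [C hC] := sp_value_bounded pH.
have msec (g : R -> Omega -> R) : measurable_fun setT (fun z : measurableTypeR R * Omega => g z.1 z.2) ->
   measurable_fun setT (fun u : measurableTypeR R => (g u o ^+ 2)%:E).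
  by move=> mg; apply/measurable_EFinP/measurable_funX; exact: measurable_section.
have IDfin : (ID o < +oo)%E.
  apply: (@le_lt_trans _ _ (\int[mu]_(u in `[0%R, T]) ((2 * C ^+ 2)%:E + 2%:E * (`|sig (clamp T u) o ^+ 2|)%:E))%E).
    apply: ge0_le_integral_in; first by move=> u _; rewrite lee_fin sqr_ge0.
    move=> u _; rewrite -EFinM -EFinD lee_fin /D ger0_norm ?sqr_ge0//.
    have h : (sp_value H u o) ^+ 2 <= C ^+ 2.
      rewrite -real_normK ?num_real// lerXn2r ?nnegrE//.
      exact: le_trans (normr_ge0 _) (hC u o).
    have := sqr_ge0 (sp_value H u o + sig (clamp T u) o).
    by rewrite sqrrD sqrrB => ?; lra.
  rewrite ge0_integralD//=; last 2 first.
  - by move=> u _; rewrite lee_fin mulr_ge0// sqr_ge0.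
  - apply: measurable_funTS; apply: measurable_funeM.
    apply/measurable_EFinP/measurableT_comp => //.
    exact: (@measurable_section _ _ _ (fun u o => sig (clamp T u) o ^+ 2)).
  rewrite integral_cst//= lebesgue_measure_itv/= lte_fin T_gt0 ge0_integralZl//; last first.
    apply: measurable_funTS; apply/measurable_EFinP/measurableT_comp => //.
    exact: (@measurable_section _ _ _ (fun u o => sig (clamp T u) o ^+ 2)).
  apply: lte_add_pinfty; first by rewrite -EFinD -EFinM ltry.
  by apply: lte_mul_pinfty.
have IDy : (ID o <= y%:E)%E.
  have ID0 : (0 <= ID o)%E by apply: integral_ge0 => u _; rewrite lee_fin sqr_ge0.
  rewrite -[ID o]fineK ?ge0_fin_numE// lee_fin -IDE.
  by apply: ltW; apply: le_lt_trans g3; exact: ler_norm.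
have mtr : measurable_fun setT (fun u : measurableTypeR R => (`|(sig (clamp T u) o - sig s o) ^+ 2|)%:E).
  apply/measurable_EFinP/measurableT_comp => //; apply: measurable_funX.
  by apply: measurable_funB => //; exact: (@measurable_section _ _ _ (fun u o => sig (clamp T u) o)).
apply: (@le_trans _ _ (\int[mu]_(u in `[s, t]) (2%:E * (D u o ^+ 2)%:E + 2%:E * (`|(sig (clamp T u) o - sig s o) ^+ 2|)%:E))%E).
  apply: ge0_le_integral_in; first by move=> u _; rewrite lee_fin sqr_ge0.
  move=> u _; rewrite -!EFinM -EFinD lee_fin /D ger0_norm ?sqr_ge0//.
  have := sqr_ge0 (sp_value H u o - sig (clamp T u) o - (sig (clamp T u) o - sig s o)).
  rewrite (_ : sp_value H u o - sig s o = (sp_value H u o - sig (clamp T u) o) + (sig (clamp T u) o - sig s o)); last by ring.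
  by rewrite (sqrrB (_ - _)) (sqrrD (_ - _)) => ?; lra.
rewrite ge0_integralD//=; last 3 first.
- by move=> u _; rewrite -EFinM lee_fin mulr_ge0// sqr_ge0.
- by apply: measurable_funTS; apply: measurable_funeM; exact: msec.
- by apply: measurable_funTS; exact: measurable_funeM.
rewrite !ge0_integralZl//; last 3 first.
- by apply: measurable_funTS.
- by apply: measurable_funTS; exact: msec.
- by move=> u _; rewrite lee_fin sqr_ge0.
apply: (@le_trans _ _ (2%:E * y%:E + 2%:E * y%:E)%E); last by rewrite -!EFinM -EFinD lee_fin; lra.
apply: leeD; apply: lee_wpmul2l => //.
apply: le_trans IDy; apply: ge0_subset_integral => //.
- by apply: measurable_funTS; exact: msec.
- by move=> u _; rewrite lee_fin sqr_ge0.
- move=> u /=; rewrite !in_itv/= => /andP[su ut].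
  by rewrite (le_trans s0 su) (le_trans ut tT).
Unshelve. all: by end_near. Qed.

End ito.

(** * Drift, jumps and stochastic integral over one cell *)

Section remainder.
Context (R : realType) (d : measure_display) (Omega : measurableType d)
  (P : probability Omega R).
Local Notation mu := (@lebesgue_measure R).

Lemma Rintegral_increment_le (f : R -> R) (s t T x : R) :
  measurable_fun setT (f : measurableTypeR R -> R) -> 0 <= s -> s < t -> t <= T ->
  (\int[mu]_(u in `[0%R, T]) (`|f u|)%:E < +oo)%E ->
  (\int[mu]_(u in `[s, t]) (`|f u|)%:E <= x%:E)%E ->
  `|\int[mu]_(u in `[0, t]) f u - \int[mu]_(u in `[0, s]) f u| <= x.
Proof.
move=> mf s0 st tT fin le_x.
have intf (A : set (measurableTypeR R)) : measurable A -> A `<=` `[0, T]%classic ->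
    mu.-integrable A (EFin \o f).
  move=> mA AT; apply/integrableP; split.
    by apply/measurable_EFinP; exact: measurable_funTS.
  apply: le_lt_trans fin; apply: ge0_subset_integral => //.
  by apply/measurable_EFinP/measurableT_comp => //; exact: measurable_funTS.
have i0t : mu.-integrable `[0, t]%classic (EFin \o f).
  apply: intf; first exact: measurable_itv.
  move=> u /=; rewrite !in_itv/= => /andP[-> ut].
  exact: le_trans tT.
rewrite (Rintegral_itvB i0t) ?bnd_simp ?(ltW st)//.
rewrite Rintegral_itv_obnd_cbnd; last first.
  apply: intf; first exact: measurable_itv.
  move=> u /=; rewrite !in_itv/= => /andP[su ut].
  by rewrite (le_trans s0 (ltW su)) (le_trans ut tT).
have sub : `[s, t]%classic `<=` `[0, T]%classic.
  move=> u /=; rewrite !in_itv/= => /andP[su ut].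
  by rewrite (le_trans s0 su) (le_trans ut tT).
apply: (le_trans (le_normr_Rintegral _ _)) => //.
  exact: intf.
rewrite -lee_fin; apply: le_trans le_x; rewrite /Rintegral fineK//.
apply: integrable_fin_num => //; apply/integrableP; split.
  by apply/measurable_EFinP/measurableT_comp => //; exact: measurable_funTS.
have /integrableP[_] := intf _ (measurable_itv _) sub.
by under eq_integral do rewrite /= normr_id.
Qed.

Variables (T : R) (T_gt0 : 0 < T) (F : R -> set (set Omega)).
Hypothesis filtF : is_filtration F T.
Variable w : R -> Omega -> R.
Hypothesis wienerw : wiener P F T w.
Variables (X0 : Omega -> R) (b : R -> Omega -> R).
Hypothesis b_cadlag : cadlag_adapted F T b.
Variables (J sigma X : nat -> R -> Omega -> R).
Hypothesis J_active : forall n, (0 < n)%N -> finitely_active_jump_process P F T (J n).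
Hypothesis sigma_cadlag : forall n, (0 < n)%N -> cadlag_adapted F T (sigma n).
Hypothesis X_semimart : forall n, (0 < n)%N ->
    ito_semimartingale P F T w X0 b (sigma n) (J n) (X n).
Variables (Ks Kb : R).
Hypothesis sigma_moment2 : forall n u, (0 < n)%N -> 0 <= u <= T ->
  (\int[P]_o (`|sigma n u o| ^+ 2)%:E <= Ks%:E)%E.
Hypothesis b_moment2 : forall u, 0 <= u <= T -> (\int[P]_o (`|b u o| ^+ 2)%:E <= Kb%:E)%E.

Local Notation tl n j := (tgrid T n j.-1).
Local Notation tr n j := (tgrid T n j).

Hypothesis small_incr2 : forall e, 0 < e ->
  usmall P (fun n j => [set o | cell_nojump T J sigma n j o /\
  ~ (\int[mu]_(u in `[tl n j, tr n j]) (`|(sigma n (clamp T u) o - sigma n (tl n j) o) ^+ 2|)%:E <=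
       (n%:R `^ (e - 2))%:E)%E]).
Hypothesis small_b : forall e, 0 < e -> usmall P (fun n j => [set o |
  ~ (\int[mu]_(u in `[tl n j, tr n j]) (`|b (clamp T u) o|)%:E <=
       (n%:R `^ (e - 1))%:E)%E]).

Let ae_b_fin : {ae P, forall o, (\int[mu]_(u in `[0%R, T]) (`|b (clamp T u) o|)%:E < +oo)%E}.
Proof.
apply: (@ae_time_integral_fin _ _ _ _ (fun u o => b (clamp T u) o) 0 T (1 + Kb)) => //.
  exact: (measurable_clamped T_gt0 filtF).
move=> u u0T; rewrite clamp_id//.
have mb : measurable_fun setT (b u) by apply: (adapted_measurable filtF) => //; case: b_cadlag.
apply: (@le_trans _ _ (\int[P]_o (1%:E + (`|b u o| ^+ 2)%:E))%E).
  apply: ge0_le_integral_in => o _; first by rewrite lee_fin.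
  rewrite -EFinD lee_fin.
  have := sqr_ge0 (`|b u o| - 1); rewrite sqrrB expr1n mulr1 => ?.
  have := normr_ge0 (b u o); lra.
rewrite ge0_integralD//=; last first.
  by apply/measurable_EFinP/measurable_funX/measurableT_comp.
rewrite integral_cst//= probability_setT mule1 EFinD leeD2l//.
exact: b_moment2.
Qed.

(** On a jump-free cell [J] is constant. The drift contributes n^(e/2 - 1), eventually at most a
    third of n^(e-1), and the linearized stochastic integral at most half of it, so together they
    stay below the threshold. *)
Lemma usmall_remainder (e : R) : 0 < e ->
  usmall P (fun n j => [set o | cell_nojump T J sigma n j o /\
    n%:R `^ (e - 1) <= `|incr T n (X n) j o - sigma n (tl n j) o * (w (tr n j) o - w (tl n j) o)|]).
Proof.
move=> e0; have e20 : 0 < e / 2 by rewrite divr_gt0.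
have /choice[M hM] : forall n, exists M : R -> Omega -> R, (0 < n)%N ->
   ito_integral P F T w (sigma n) M /\
    {ae P, forall omega, forall t, 0 <= t <= T ->
      X n t omega = X0 omega + (\int[lebesgue_measure]_(s in `[0, t]) b s omega)
                  + M t omega + J n t omega}.
  move=> n; have [n0|] := boolP (0 < n)%N; last by exists (fun _ _ => 0).
  by have [_ [M hM]] := X_semimart n0; exists M.
have u1 : usmall P (fun n j => [set o |
   3 * (n%:R `^ (e - 1) / 6) < `|M n (tr n j) o - M n (tl n j) o - sigma n (tl n j) o * (w (tr n j) o - w (tl n j) o)| /\
    (\int[mu]_(u in `[tl n j, tr n j]) (`|(sigma n (clamp T u) o - sigma n (tl n j) o) ^+ 2|)%:E <= (n%:R `^ (e - 2))%:E)%E]).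
  (* The exponent is x^2 / (8 y) with x = n^(e-1) / 6 and y = n^(e-2), and 288 = 8 times 36. *)
  apply: (@usmall_bound _ _ _ _ _ (fun n => 5 * expR (- (288^-1 * n%:R `^ e)))); last first.
    by move=> L; apply: near_expN_powR.
  near=> n; move=> j jn.
  have n0 : (0 < n)%N by near: n; exact: nbhs_infty_gt.
  have [s0 st tT] := tgrid_cell T_gt0 jn.
  have x0 : 0 < n%:R `^ (e - 1) / 6 :> R by rewrite divr_gt0// powRn_gt0.
  have := @ito_increment_covered _ _ _ P F T w T_gt0 filtF wienerw (sigma n) (M n) Ks
    (sigma_cadlag n0) (fun u uT => sigma_moment2 n0 uT) (hM n n0).1 _ _ _ _ s0 st tT x0
    (@powRn_gt0 R n (e - 2) n0).
  apply: coveredS => //; rewrite ler_wpM2l// ler_expR lerN2.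
  rewrite le_eqVlt; apply/orP; left; apply/eqP.
  have -> : n%:R `^ (e - 2) = n%:R `^ (e - 1) * n%:R `^ (e - 1) * n%:R `^ (- e) :> R.
    by rewrite -!powRnD//; congr (_ `^ _); ring.
  by rewrite powRN; field; rewrite !gt_eqF ?powRn_gt0.
have u2 := small_incr2 e0.
have u3 := small_b e20.
apply: usmallS (usmallU (usmallU u1 u2) (usmallU u3 (_ : usmall P (fun n j => [set o |
  ~ [/\ (\int[mu]_(u in `[0%R, T]) (`|b (clamp T u) o|)%:E < +oo)%E,
    forall t, 0 <= t <= T ->
      X n t o = X0 o + (\int[lebesgue_measure]_(s in `[0, t]) b s o) + M n t o + J n t o &
    forall t, 0 <= t <= T -> J n t o = jump_part (J n ^~ o) t]])))); last first.
  apply: usmall_null; near=> n; move=> j _.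
  have n0 : (0 < n)%N by near: n; exact: nbhs_infty_gt.
  have [_ _ aeJ] := J_active n0.
  apply: covered_ae (filterI (filterI ae_b_fin (hM n n0).2) aeJ) _.
  by move=> o /= nh [[h1 h2] h3]; apply: nh.
near=> n; move=> j jn o /= [nj hX].
have n0 : (0 < n)%N by near: n; exact: nbhs_infty_gt.
have [s0 st tT] := tgrid_cell T_gt0 jn.
have [g3|g3] := pselect (\int[mu]_(u in `[tl n j, tr n j]) (`|b (clamp T u) o|)%:E <=
       (n%:R `^ (e / 2 - 1))%:E)%E; last by right; left.
have [g2|g2] := pselect (\int[mu]_(u in `[tl n j, tr n j]) (`|(sigma n (clamp T u) o - sigma n (tl n j) o) ^+ 2|)%:E <= (n%:R `^ (e - 2))%:E)%E; last by left; right.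
have [[bf XE JE]|g4] := pselect [/\ (\int[mu]_(u in `[0%R, T]) (`|b (clamp T u) o|)%:E < +oo)%E,
    forall t, 0 <= t <= T ->
      X n t o = X0 o + (\int[lebesgue_measure]_(s in `[0, t]) b s o) + M n t o + J n t o &
    forall t, 0 <= t <= T -> J n t o = jump_part (J n ^~ o) t]; last by right; right.
left; left; split => //.
have sT : 0 <= tl n j <= T by rewrite s0 (le_trans (ltW st)).
have tT' : 0 <= tr n j <= T by rewrite tT (le_trans s0 (ltW st)).
have bE t : 0 <= t <= T -> \int[mu]_(s in `[0, t]) b s o = \int[mu]_(s in `[0, t]) b (clamp T s) o.
  move=> /andP[_ tT0]; apply: eq_Rintegral => u; rewrite inE/= in_itv/= => /andP[u0 ut].
  by rewrite clamp_id// u0 (le_trans ut tT0).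
have jj : J n (tr n j) o = J n (tl n j) o.
  rewrite !JE//; apply/esym/jump_part_no_jump => //; first exact: ltW.
  by move=> u ust; have [] := nj u ust.
have hb : `|\int[mu]_(u in `[0, tr n j]) b (clamp T u) o - \int[mu]_(u in `[0, tl n j]) b (clamp T u) o| <= n%:R `^ (e / 2 - 1).
  apply: (Rintegral_increment_le _ s0 st tT bf g3).
  have mb := measurable_clamped T_gt0 filtF b_cadlag.
  exact: (@measurable_section _ _ _ (fun u o => b (clamp T u) o)).
have Xinc : incr T n (X n) j o - sigma n (tl n j) o * (w (tr n j) o - w (tl n j) o) =
  (\int[mu]_(u in `[0, tr n j]) b (clamp T u) o - \int[mu]_(u in `[0, tl n j]) b (clamp T u) o) +
  (M n (tr n j) o - M n (tl n j) o - sigma n (tl n j) o * (w (tr n j) o - w (tl n j) o)).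
  rewrite /incr !XE// !bE// jj; ring.
have h3 : 3 <= n%:R `^ (e / 2) :> R by near: n; exact: near_powRn_ge.
have h4 : 3 * n%:R `^ (e / 2 - 1) <= n%:R `^ (e - 1) :> R.
  have -> : n%:R `^ (e - 1) = n%:R `^ (e / 2) * n%:R `^ (e / 2 - 1) :> R.
    by rewrite -powRnD//; congr (_ `^ _); field.
  by rewrite ler_wpM2r ?powR_ge0.
have p0 : 0 < n%:R `^ (e / 2 - 1) :> R by exact: powRn_gt0.
move: hX; rewrite Xinc => hX.
have := ler_normD (\int[mu]_(u in `[0, tr n j]) b (clamp T u) o - \int[mu]_(u in `[0, tl n j]) b (clamp T u) o)
  (M n (tr n j) o - M n (tl n j) o - sigma n (tl n j) o * (w (tr n j) o - w (tl n j) o)).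
by lra.
Unshelve. all: by end_near. Qed.

End remainder.

(** * Cells and windows with jumps *)

Section windows.
Variables (kappa n : nat).
Hypothesis kappa_le : (kappa.*2.+1 <= n)%N.

Lemma window_start_bounds j : (1 <= j <= n)%N ->
  [/\ (1 <= window_start kappa n j)%N, (window_start kappa n j + kappa.*2 <= n)%N,
      (window_start kappa n j <= j)%N & (j <= window_start kappa n j + kappa.*2)%N].
Proof.
move=> jn; rewrite /window_start -addnn; move: kappa_le; rewrite -addnn.
by case: ifP => h1; last case: ifP => h2; split; lia.
Qed.

End windows.

Section jump_cells.
Context (R : realType) (d : measure_display) (Omega : measurableType d)
  (P : probability Omega R).
Variables (T : R) (T_gt0 : 0 < T) (F : R -> set (set Omega)).
Hypothesis filtF : is_filtration F T.
Variables (J sigma : nat -> R -> Omega -> R) (kappa : nat -> nat).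
Hypothesis J_active : forall n, (0 < n)%N -> finitely_active_jump_process P F T (J n).
Hypothesis sigma_cadlag : forall n, (0 < n)%N -> cadlag_adapted F T (sigma n).
Hypothesis sigma_active : forall n, (0 < n)%N ->
    {ae P, forall omega, (jump_count (sigma n ^~ omega) `]0%R, T] < +oo)%E}.
Hypothesis kappa_le : forall n, (0 < n)%N -> ((kappa n).*2.+1 <= n)%N.

Local Notation tl n j := (tgrid T n j.-1).
Local Notation tr n j := (tgrid T n j).
Local Notation cell n j := (cell_nojump T J sigma n j).

Definition window_nojump n j : set Omega :=
  nojump_event (J n) (sigma n) (tgrid T n (window_start (kappa n) n j).-1)
    (tgrid T n (window_start (kappa n) n j + (kappa n).*2)).

Lemma tgrid_mono n i j : (i <= j)%N -> tgrid T n i <= tgrid T n j.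
Proof.
by move=> ij; rewrite /tgrid ler_wpM2r ?invr_ge0// ler_wpM2r ?(ltW T_gt0)// ler_nat.
Qed.

Lemma window_nojump_cell n j k o : (1 <= j <= n)%N ->
  (window_start (kappa n) n j <= k <= window_start (kappa n) n j + (kappa n).*2)%N ->
  window_nojump n j o -> cell n k o.
Proof.
move=> jn /andP[k1 k2] nj t /andP[tk1 tk2]; apply: nj; apply/andP; split.
  by apply: le_lt_trans tk1; apply: tgrid_mono; lia.
by apply: (le_trans tk2); exact: tgrid_mono.
Qed.

Lemma window_nojump_own_cell n j o : (1 <= j <= n)%N ->
  window_nojump n j o -> cell n j o.
Proof.
move=> jn; have n0 : (0 < n)%N by lia.
have [_ _ h1 h2] := window_start_bounds (kappa_le n0) jn.
by apply: window_nojump_cell; rewrite ?h1.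
Qed.

(** For a jump time t in the window, the first grid index k with t <= t_k marks the cell containing
    it. Both j and k lie among the 2 kappa + 1 cells of the window, hence differ by at most 2
    kappa. *)
Lemma window_jump_cell n j o : (1 <= j <= n)%N -> ~ window_nojump n j o ->
  exists k, [/\ (1 <= k <= n)%N, (k <= j + (kappa n).*2)%N, (j <= k + (kappa n).*2)%N &
    ~ cell n k o].
Proof.
move=> jn nw; have n0 : (0 < n)%N by lia.
have [w1 w2 w3 w4] := window_start_bounds (kappa_le n0) jn.
set ws := window_start (kappa n) n j in w1 w2 w3 w4.
apply: contrapT => nk; apply: nw => t; rewrite -/ws => /andP[t1 t2].
have hex : exists k, t <= tgrid T n k by exists (ws + (kappa n).*2)%N.
have [k tk kmin] := ex_minnP hex.
have wk : (ws <= k)%N.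
  rewrite leqNgt; apply/negP => kw.
  have h : tgrid T n k <= tgrid T n ws.-1 by apply: tgrid_mono; lia.
  by have := lt_le_trans t1 (le_trans tk h); rewrite ltxx.
have kw : (k <= ws + (kappa n).*2)%N by exact: kmin.
have tk' : tl n k < t.
  rewrite ltNge; apply/negP => /kmin; lia.
apply: contrapT => nj; apply: nk; exists k; split; [lia|lia|lia|].
by move=> /(_ t); rewrite tk' tk => /(_ isT).
Qed.

(** A measurable version of the size of [frakL], with which it agrees almost surely by
    [jump_cells_frakL]. *)
Definition jump_cells n (o : Omega) : R :=
  \sum_(1 <= j < n.+1) (~~ `[<cell n j o>])%:R.

Definition jump_windows n (o : Omega) : R :=
  \sum_(1 <= j < n.+1) (~~ `[<window_nojump n j o>])%:R.

(** Double counting: a cell with a jump can spoil the windows of at most 4 kappa + 1 indices, those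
    within distance 2 kappa. *)
Lemma jump_windows_le n o : (0 < n)%N ->
  jump_windows n o <= ((kappa n).*2.*2.+1)%:R * jump_cells n o.
Proof.
move=> n0; rewrite /jump_windows /jump_cells.
apply: (@le_trans _ _ (\sum_(1 <= j < n.+1) \sum_(1 <= k < n.+1)
   (~~ `[<cell n k o>])%:R * ((k <= j + (kappa n).*2) && (j <= k + (kappa n).*2))%N%:R)).
  rewrite big_seq [leRHS]big_seq; apply: ler_sum => j; rewrite mem_index_iota ltnS => jn.
  have [w|nw] := asboolP (window_nojump n j o).
    by apply: sumr_ge0 => k _; rewrite mulr_ge0.
  have [k [kn k1 k2 nc]] := window_jump_cell jn nw.
  rewrite (bigD1_seq k) ?mem_index_iota ?iota_uniq//=.
  rewrite (asboolF nc) k1 k2 mulr1 lerDl; apply: sumr_ge0 => i _; rewrite mulr_ge0//.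
rewrite exchange_big/= mulr_sumr; apply: ler_sum => k _.
rewrite -mulr_sumr mulrC ler_wpM2r// -natr_sum ler_nat.
apply: (@leq_trans (\sum_(k - (kappa n).*2 <= j < (k + (kappa n).*2).+1) 1)%N); last first.
  by rewrite sum_nat_const_nat muln1; lia.
rewrite -big_mkcond /= !sum1_count -!size_filter.
apply: uniq_leq_size; first by rewrite filter_uniq// iota_uniq.
by move=> i; rewrite !mem_filter !mem_index_iota /= => /andP[/andP[h1 h2] /andP[h3 h4]]; lia.
Qed.

Lemma measurable_cell n j : (1 <= j <= n)%N -> measurable (cell n j).
Proof.
move=> jn; apply: (measurable_cell_nojump T_gt0 filtF) => //.
by move=> m m0; case: (J_active m0).
Qed.

Lemma measurable_window n j : (1 <= j <= n)%N -> measurable (window_nojump n j).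
Proof.
move=> jn; have n0 : (0 < n)%N by lia.
have [w1 w2 w3 w4] := window_start_bounds (kappa_le n0) jn.
have [[aJ cJ] _ _] := J_active n0; have [as_ cs] := sigma_cadlag n0.
apply: (measurable_nojump_event (T := T)) => //.
- by move=> t t0T; exact: (adapted_measurable filtF).
- by move=> t t0T; exact: (adapted_measurable filtF).
- have wn : ((window_start (kappa n) n j).-1 <= n)%N by lia.
  by have /andP[] := tgrid_itv T_gt0 wn.
- by apply: tgrid_lt => //; lia.
- by have /andP[] := tgrid_itv T_gt0 w2.
Qed.

Lemma window_nojump_calL n j o : window_nojump n j o ->
  j \notin calL T (kappa n) n (J n) (sigma n) o.
Proof.
move=> nw; rewrite mem_filter negb_and negbK; apply/orP; left; apply/eqP.
by apply/Nbar_eq0 => t; rewrite /window /= in_itv/= => /nw.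
Qed.

Lemma measurable_jump_cells n : measurable_fun setT (jump_cells n).
Proof.
rewrite /jump_cells; under eq_fun do rewrite big_add1 big_mkord.
apply: measurable_sum => i.
rewrite (_ : (fun _ => _) = \1_(~` (cell n i.+1))).
  by apply: measurable_indic; apply: measurableC; apply: measurable_cell; rewrite ltn_ord.
by apply/funext => o; rewrite indicE in_setC.
Qed.

Lemma jump_cells_frakL n : (0 < n)%N -> {ae P, forall o,
  jump_cells n o = (size (frakL T n (J n) (sigma n) o))%:R}.
Proof.
move=> n0; have [_ aeJ _] := J_active n0.
apply: filterS (filterI aeJ (sigma_active n0)) => o [Jfin sfin].
rewrite /frakL size_filter -sum1_count natr_sum /jump_cells /index_iota subSS subn0.
rewrite [RHS]big_mkcond big_seq [RHS]big_seq; apply: eq_bigr => j; rewrite mem_iota add1n ltnS => jn.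
have [s0 st tT] := tgrid_cell T_gt0 jn.
have fin : (Nbar (J n ^~ o) (sigma n ^~ o) `]0%R, tl n j] < +oo)%E.
  have sub A : A `<=` `]0, T]%classic -> forall h, (jump_count h `]0%R, T] < +oo -> jump_count h A < +oo)%E.
    move=> AT h; apply: le_lt_trans.
    rewrite /jump_count esum_mkcond [leRHS]esum_mkcond; apply: le_esum => i _.
    case: ifPn => [/set_mem/AT iT|_]; first by rewrite mem_set.
    by case: ifP => _; rewrite lee_fin.
  have subT : `]0, tl n j]%classic `<=` `]0, T]%classic.
    by move=> u /=; rewrite !in_itv/= => /andP[-> us]; rewrite (le_trans us)// (le_trans (ltW st)).
  by rewrite /Nbar lte_add_pinfty// sub.
rewrite Nbar_itv_sub ?(ltW st)//.
have [c|nc] := asboolP (cell n j o).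
  case: ifP => // /eqP h; case: h; apply/Nbar_eq0 => t /=; rewrite in_itv/= => tst.
  exact: c.
case: ifPn => // /negPn/eqP/Nbar_eq0 h; case: nc => t tst.
by apply: h; rewrite /= in_itv.
Qed.

(** Measurability of the smaller function suffices: the null set is removed from its integral, after
    which the comparison is pointwise. The larger function will be a power of the size of
    [frakL]. *)
Lemma ae_ge0_le_integral_pointwise (f g : Omega -> \bar R) :
  measurable_fun setT f -> (forall o, 0 <= f o)%E -> (forall o, 0 <= g o)%E ->
  {ae P, forall o, (f o <= g o)%E} -> (\int[P]_o f o <= \int[P]_o g o)%E.
Proof.
move=> mf f0 g0 [N [mN PN sub]].
rewrite (ge0_negligible_integral mN _ mf _ PN)//.
apply: (@le_trans _ _ (\int[P]_(o in [set: Omega] `\` N) g o)%E).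
  apply: ge0_le_integral_in => // o [_ No]; rewrite leNgt; apply/negP => fg.
  by apply: No; apply: sub => /=; apply/negP; rewrite -ltNge.
rewrite integral_mkcond; apply: ge0_le_integral_pointwise => o.
  by rewrite erestrict_ge0.
by rewrite patchE; case: ifP.
Qed.

Variable xi : R.
Hypothesis frakL_bigO : forall p : R, 1 < p ->
    bigO_pow (fun n => Lpnorm P p (fun omega =>
      (size (frakL T n (J n) (sigma n) omega))%:R%R)) xi.

Lemma small_jump_cells (e : R) : 0 < e ->
  small P (fun n => [set o | n%:R `^ (xi + e) <= jump_cells n o]).
Proof.
move=> e0.
(* The cell index is a dummy, introduced so that [usmall_moments] applies. *)
have u : usmall P (fun n (_ : nat) => [set o | n%:R `^ (xi + e) <= jump_cells n o]).
  apply: (@usmall_moments _ _ _ _ (fun n _ => jump_cells n) _ (fun n => n%:R `^ xi) e) => //.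
  - move=> k k1; have := @frakL_bigO k%:R; rewrite ltr1n => /(_ k1)[C hC].
    exists C; near=> n; move=> j _.
    have n0 : (0 < n)%N by near: n; exact: nbhs_infty_gt.
    have hn : (Lpnorm P k%:R (fun omega =>
      (size (frakL T n (J n) (sigma n) omega))%:R%R) <= (C * n%:R `^ xi)%:E)%E by near: n.
    apply: le_trans (Lpnorm_exprn_le (ltnW k1) hn).
    apply: ae_ge0_le_integral_pointwise.
    + apply/measurable_EFinP/measurable_funX/measurableT_comp => //.
      exact: measurable_jump_cells.
    + by move=> o; rewrite lee_fin exprn_ge0.
    + by move=> o; rewrite lee_fin exprn_ge0.
    + by apply: filterS (jump_cells_frakL n0) => o ->.
  - near=> n; apply: powRn_gt0.
    by near: n; exact: nbhs_infty_gt.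
  - near=> n; move=> j _; apply: (@measurable_set_le _ _ _ (fun=> n%:R `^ (xi + e)) (jump_cells n)) => //.
    exact: measurable_jump_cells.
  - near=> n; move=> j _ o /= h; rewrite -powRnD; last by near: n; exact: nbhs_infty_gt.
    by rewrite (le_trans h)// ler_norm.
have := usmall_small u; apply: smallS; near=> n; move=> o /= h.
by exists 1%N => //=; near: n; exact: nbhs_infty_gt.
Unshelve. all: by end_near. Qed.

End jump_cells.

(** * The volatility proxy *)

Section volatility_proxy.
Context (R : realType) (d : measure_display) (Omega : measurableType d)
  (P : probability Omega R).
Variables (T : R) (T_gt0 : 0 < T) (F : R -> set (set Omega)).
Hypothesis filtF : is_filtration F T.
Variables (J sigma : nat -> R -> Omega -> R) (kappa : nat -> nat).
Hypothesis J_active : forall n, (0 < n)%N -> finitely_active_jump_process P F T (J n).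
Hypothesis sigma_cadlag : forall n, (0 < n)%N -> cadlag_adapted F T (sigma n).
Hypothesis kappa_le : forall n, (0 < n)%N -> ((kappa n).*2.+1 <= n)%N.
Variable S : nat -> nat -> Omega -> R.
Hypothesis mS : forall n j, (1 <= j <= n)%N -> measurable_fun setT (S n j.-1).
Hypothesis S_gt0 : forall n j, (1 <= j <= n)%N ->
    {ae P, forall omega, 0 < S n j.-1 omega}.
Hypothesis SV_bounded : forall p : R, 1 < p -> exists C : R,
    forall n j, (1 <= j <= n)%N ->
      (Lpnorm P p (fun omega => (S n j.-1 omega)^-1)%R <= C%:E)%E.
Variables (gamma0 c : R).
Hypothesis S_approx : forall p : R, 1 < p -> exists C : R,
    forall n j, (1 <= j <= n)%N ->
      ((n%:R `^ gamma0)%:E *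
       Lpnorm P p (fun omega =>
         (j \notin calL T (kappa n) n (J n) (sigma n) omega)%:R *
         (sigma n (tgrid T n j.-1) omega ^+ 2 - c * S n j.-1 omega))%R
       <= C%:E)%E.

Lemma usmall_S_lower (e : R) : 0 < e ->
  usmall P (fun n j => [set o | S n j.-1 o <= n%:R `^ (- e)]).
Proof.
move=> e0.
have u1 : usmall P (fun n j => [set o | ~ 0 < S n j.-1 o]).
  apply: usmall_null; near=> n; move=> j jn.
  exact: covered_ae (S_gt0 jn) _.
have u2 : usmall P (fun n j => [set o | 0 < S n j.-1 o] `&` [set o | S n j.-1 o <= n%:R `^ (- e)]).
  apply: (@usmall_moments _ _ _ _ (fun n j o => (S n j.-1 o)^-1) _ (fun=> 1) e) => //.
  - move=> k k1; have := @SV_bounded k%:R; rewrite ltr1n => /(_ k1)[C hC].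
    exists C; near=> n; move=> j jn; rewrite mulr1.
    exact: Lpnorm_exprn_le (ltnW k1) (hC n j jn).
  - by apply: nearW => n; exact: ltr01.
  - near=> n; move=> j jn; apply: measurableI.
      exact: (@measurable_set_lt _ _ _ (fun=> 0) (S n j.-1) _ (mS jn)).
    exact: (@measurable_set_le _ _ _ (S n j.-1) (fun=> n%:R `^ (- e)) (mS jn)).
  - near=> n; move=> j jn o /= [S0 h]; rewrite mul1r gtr0_norm ?invr_gt0//.
    have n0 : (0 < n)%N by near: n; exact: nbhs_infty_gt.
    by rewrite -lef_pV2 ?posrE ?invr_gt0 ?powRn_gt0// invrK -powRN.
apply: usmallS (usmallU u1 u2); near=> n; move=> j jn o /= h.
by have [S0|S0] := pselect (0 < S n j.-1 o); [right|left].
Unshelve. all: by end_near. Qed.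

(** The indicator in [S_approx] is 1 on a jump-free window, and [window_nojump] is a measurable
    event on which Markov's inequality can be used. *)
Lemma usmall_S_approx (e : R) : 0 < e ->
  usmall P (fun n j => [set o | window_nojump T J sigma kappa n j o /\
    n%:R `^ (- gamma0 + e) <= `|sigma n (tgrid T n j.-1) o ^+ 2 - c * S n j.-1 o|]).
Proof.
move=> e0.
apply: (@usmall_moments _ _ _ _ (fun n j o =>
  (j \notin calL T (kappa n) n (J n) (sigma n) o)%:R *
         (sigma n (tgrid T n j.-1) o ^+ 2 - c * S n j.-1 o)) _ (fun n => n%:R `^ (- gamma0)) e) => //.
- move=> k k1; have := @S_approx k%:R; rewrite ltr1n => /(_ k1)[C hC].
  exists C; near=> n; move=> j jn.
  have n0 : (0 < n)%N by near: n; exact: nbhs_infty_gt.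
  apply: Lpnorm_exprn_le; first exact: ltnW.
  rewrite powRN EFinM lee_pdivlMr ?powRn_gt0// muleC; exact: hC.
- near=> n; apply: powRn_gt0.
  by near: n; exact: nbhs_infty_gt.
- near=> n; move=> j jn.
  have n0 : (0 < n)%N by near: n; exact: nbhs_infty_gt.
  apply: measurableI; first exact: (measurable_window T_gt0 filtF J_active sigma_cadlag kappa_le).
  apply: (@measurable_set_le _ _ _ (fun=> n%:R `^ (- gamma0 + e))) => //.
  apply: measurableT_comp => //; apply: measurable_funB.
    apply: measurable_funX; apply: (adapted_measurable filtF); first by case: (sigma_cadlag n0).
    by have [s0 st tT] := tgrid_cell T_gt0 jn; rewrite s0 (le_trans (ltW st)).
  by apply: measurable_funM => //; exact: mS.
- near=> n; move=> j jn o /= [nw h]; rewrite -powRnD; last by near: n; exact: nbhs_infty_gt.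
  by rewrite (window_nojump_calL nw) mul1r.
Unshelve. all: by end_near. Qed.

End volatility_proxy.

(** * Fluctuations of weighted sums over the Wiener increments *)

Section azuma_small.
Context (R : realType) (d : measure_display) (Omega : measurableType d)
  (P : probability Omega R).
Variables (T : R) (T_gt0 : 0 < T) (F : R -> set (set Omega)).
Hypothesis filtF : is_filtration F T.
Variable w : R -> Omega -> R.
Hypothesis wienerw : wiener P F T w.

Lemma small_azuma (a : nat -> nat -> Omega -> R) (g : nat -> R -> R) (A : nat -> R) (B e : R) :
  0 < e -> 0 < B -> (forall n, (0 < n)%N -> 0 < A n) ->
  (forall n i o, (i < n)%N -> `|a n i o| <= A n) ->
  (forall n i, (i < n)%N -> Fmeas F (tgrid T n i) (a n i)) ->
  (forall n, measurable_fun setT (g n)) -> (forall n z, `|g n z| <= B) ->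
  (forall n, \int[normal_prob 0 1]_z (g n z)%:E = 0)%E ->
  small P (fun n => [set o | A n * n%:R `^ (2^-1 + e) <=
    `|\sum_(i < n) a n i o * g n (winc w (tgrid T n i) (tgrid T n i.+1) o)|]).
Proof.
move=> e0 B0 A0 aA ma mg gB g0 L.
have B4 : 0 < (4 * B)^-1 by rewrite invr_gt0 mulr_gt0.
have [C hC] := @near_expN_powR R (2 * expR 16^-1) (4 * B)^-1 e L B4 e0.
exists C; near=> n.
have n0 : (0 < n)%N by near: n; exact: nbhs_infty_gt.
have u0T i : (i <= n)%N -> 0 <= tgrid T n i <= T by exact: tgrid_itv.
have uinc i : (i < n)%N -> tgrid T n i < tgrid T n i.+1 by move=> _; exact: tgrid_lt.
set E := [set o | _ <= _].
have mE : measurable E.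
  apply: (@measurable_set_le _ _ _ (fun=> A n * n%:R `^ (2^-1 + e))) => //.
  apply: measurableT_comp => //; apply: measurable_sum => i.
  apply: measurable_funM.
    by apply: (Fmeas_measurable filtF (u0T i (ltnW (ltn_ord i)))); exact: ma.
  apply: measurableT_comp => //; apply: (measurable_winc filtF wienerw).
  - by have /andP[] := u0T i (ltnW (ltn_ord i)).
  - exact: uinc.
  - by have /andP[] := u0T _ (ltn_ord i).
have sn : 0 < n%:R `^ (- 2^-1) :> R by exact: powRn_gt0.
(* With this parameter n (l A B)^2 = 1/16 stays bounded, while l times the threshold is n^e / (4
   B). *)
pose l := n%:R `^ (- 2^-1) / (4 * A n * B).
have An : 0 < A n by exact: A0.
have l0 : 0 < l by rewrite divr_gt0// !mulr_gt0.
have lAB : l * A n * B = n%:R `^ (- 2^-1) / 4.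
  by rewrite /l; field; rewrite !gt_eqF.
have sn1 : n%:R `^ (- 2^-1) <= 1 :> R.
  by apply: (le_trans (@powRn_le R n _ 0 n0 _)); rewrite ?powRr0// lerNl oppr0.
have h4 : l * A n * B <= 4^-1 by rewrite lAB ler_pdivrMr// mulVf.
have := azuma_tail filtF wienerw u0T uinc (fun i => @ma n i) (mg n) (fun i o => @aA n i o) (gB n) (g0 n) mE l0 h4 (fun o Eo => Eo).
move=> PE; exists E; split => //; apply: le_trans PE _; rewrite lee_fin.
apply: (@le_trans _ _ (2 * expR 16^-1 * expR (- ((4 * B)^-1 * n%:R `^ e)))); last by near: n.
rewrite -(mulrA 2 (expR 16^-1)) -expRD ler_wpM2l// ler_expR lAB.
rewrite le_eqVlt; apply/orP; left; apply/eqP; congr (_ - _).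
  rewrite expr_div_n powRn_exp (_ : - 2^-1 * 2%:R = - 1); last by rewrite mulNr mulVf.
  by rewrite powRN powRr1//; field; rewrite pnatr_eq0 -lt0n.
rewrite /l powRnD// powRN; field.
by rewrite !gt_eqF//; exact: powRn_gt0.
Unshelve. all: by end_near. Qed.

End azuma_small.

(** * Integrated volatility as a sum over cells *)

Section theta.
Context {R : realType}.
Local Notation mu := (@lebesgue_measure R).
Variables (T : R) (T_gt0 : 0 < T) (n : nat) (n_gt0 : (0 < n)%N).
Variable f : R -> R.
Hypothesis mf : measurable_fun setT (f : measurableTypeR R -> R).
Hypothesis f_ge0 : forall u, 0 <= f u.
Local Notation tl j := (tgrid T n j.-1).
Local Notation tr j := (tgrid T n j).

Lemma integral_cells :
  (\int[mu]_(u in `[0%R, T]) (f u)%:E =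
   \sum_(1 <= j < n.+1) \int[mu]_(u in `[tl j, tr j]) (f u)%:E)%E.
Proof.
have mEf D : measurable_fun D (fun u : measurableTypeR R => (f u)%:E).
  by apply/measurable_EFinP; exact: measurable_funTS.
have key k : (k <= n)%N -> (\int[mu]_(u in `[0%R, tr k]) (f u)%:E =
   \sum_(1 <= j < k.+1) \int[mu]_(u in `[tl j, tr j]) (f u)%:E)%E.
  elim: k => [|k IH] kn.
    by rewrite big_geq// /tgrid !mul0r set_itv1 integral_set1.
  rewrite big_nat_recr//= -IH ?(ltnW kn)//.
  have st : tr k < tr k.+1 by exact: tgrid_lt.
  have /andP[s0 _] := tgrid_itv T_gt0 (ltnW kn).
  have -> : (`[0, tr k.+1]%classic = `[0, tr k] `|` `]tr k, tr k.+1])%classic.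
    by rewrite -itv_bndbnd_setU// bnd_simp// ltW.
  rewrite ge0_integral_setU//=; last 2 first.
  - by move=> u _; rewrite lee_fin.
  - apply/disj_setPRL => u /=; rewrite !in_itv/= => /andP[ku _] /andP[_ uk].
    by have := le_lt_trans uk ku; rewrite ltxx.
  by rewrite integral_itv_obnd_cbnd//; exact: mEf.
by rewrite -(key n (leqnn n)) /tgrid mulrAC divff ?mul1r// pnatr_eq0 -lt0n.
Qed.

Lemma Rintegral_cells :
  (forall j, (1 <= j <= n)%N -> (\int[mu]_(u in `[tl j, tr j]) (f u)%:E < +oo)%E) ->
  \int[mu]_(u in `[0, T]) f u =
   \sum_(1 <= j < n.+1) \int[mu]_(u in `[tl j, tr j]) f u.
Proof.
move=> fin; rewrite /Rintegral integral_cells big_seq [RHS]big_seq -sum_fine//.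
move=> j; rewrite mem_index_iota ltnS => jn; rewrite ge0_fin_numE ?fin//.
by apply: integral_ge0 => u _; rewrite lee_fin.
Qed.

Lemma Rintegral_cell_diff (j : nat) (v x : R) : (1 <= j <= n)%N ->
  (\int[mu]_(u in `[tl j, tr j]) (f u)%:E < +oo)%E ->
  (\int[mu]_(u in `[tl j, tr j]) (`|f u - v|)%:E <= x%:E)%E ->
  `|\int[mu]_(u in `[tl j, tr j]) f u - T / n%:R * v| <= x.
Proof.
move=> jn fin le_x; have [s0 st tT] := tgrid_cell T_gt0 jn.
have intf : mu.-integrable `[tl j, tr j]%classic (EFin \o f).
  apply/integrableP; split; first by apply/measurable_EFinP; exact: measurable_funTS.
  by under eq_integral do rewrite /= ger0_norm ?f_ge0//.
have intv : mu.-integrable `[tl j, tr j]%classic (EFin \o (fun=> v)).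
  apply/integrableP; split; first by apply/measurable_EFinP; exact: measurable_cst.
  rewrite (_ : (fun=> _) = cst (`|v|)%:E)// integral_cst//=.
  by rewrite lebesgue_measure_itv/= lte_fin st -EFinB -EFinM ltry.
have -> : T / n%:R * v = \int[mu]_(u in `[tl j, tr j]) v.
  rewrite Rintegral_cst// /= lebesgue_measure_itv/= lte_fin st -EFinB/=.
  by rewrite tgrid_pred 1?mulrC//; case/andP: jn.
have intd : mu.-integrable `[tl j, tr j]%classic (EFin \o (fun u => f u - v)).
  apply/integrableP; split; last exact: le_lt_trans le_x (ltry _).
  by apply/measurable_EFinP; apply: measurable_funTS; exact: measurable_funB.
rewrite -RintegralB//; apply: (le_trans (le_normr_Rintegral _ _)) => //.
rewrite -lee_fin; apply: le_trans le_x; rewrite /Rintegral fineK//.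
apply: integrable_fin_num => //; exact: (integrable_abse intd).
Qed.

Lemma Rintegral_cell_le (j : nat) (x : R) : 0 <= x ->
  (\int[mu]_(u in `[tl j, tr j]) (f u)%:E <= x%:E)%E ->
  0 <= \int[mu]_(u in `[tl j, tr j]) f u <= x.
Proof.
move=> x0 le_x; apply/andP; split; first by apply: Rintegral_ge0.
rewrite /Rintegral -lee_fin fineK// ge0_fin_numE; first exact: le_lt_trans le_x (ltry _).
by apply: integral_ge0 => u _; rewrite lee_fin.
Qed.

End theta.

(** * The pathwise estimate *)

Section order_statistics.
Context {R : realType}.
Implicit Types (s : seq R) (k : nat) (y : R).

(** Were the k-th value above y, sortedness would leave at most k - 1 values below or equal to y.
    The prefixed 0 realizes V_(0) = 0, whence the condition 0 <= y. *)
Lemma order_stat_le s k y : 0 <= y -> (k <= count (fun x => (x <= y)%R) s)%N ->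
  nth 0 (0 :: sort <=%O s) k <= y.
Proof.
move=> y0; rewrite -(count_sort <=%O); set s' := sort _ s => kc.
have ss : sorted <=%O s' by exact: sort_le_sorted.
case: k kc => [//|k] kc /=; rewrite leNgt; apply/negP => yk.
have ks : (k < size s')%N by apply: (leq_trans kc); exact: count_size.
move: kc; rewrite -[s' in count _ s'](cat_take_drop k) count_cat.
rewrite (_ : count _ (drop k s') = 0%N); last first.
  apply/eqP; rewrite -leqn0 leqNgt -has_count; apply/negP => /hasP[x /(nthP 0)[i]].
  rewrite size_drop => ik <-; rewrite nth_drop leNgt => /negP; apply.
  apply: (lt_le_trans yk); apply: (sorted_leq_nth le_trans le_refl 0 ss) => //.
  - by rewrite inE -ltn_subRL.
  - exact: leq_addr.
rewrite addn0 => h; have := leq_trans h (count_size _ _).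
by rewrite size_takel ?ltnn// ltnW.
Qed.

Lemma order_stat_ge s k y : (k <= size s)%N -> (count (fun x => (x < y)%R) s < k)%N ->
  y <= nth 0 (0 :: sort <=%O s) k.
Proof.
rewrite -(count_sort <=%O) -(size_sort <=%O s); set s' := sort _ s => ks kc.
have ss : sorted <=%O s' by exact: sort_le_sorted.
case: k kc ks => [//|k] kc ks /=; rewrite leNgt; apply/negP => yk.
move: kc; rewrite -[s' in count _ s'](cat_take_drop k.+1) count_cat.
rewrite (_ : count _ (take k.+1 s') = k.+1).
  by rewrite ltnNge leq_addr.
have sz : size (take k.+1 s') = k.+1 by rewrite size_takel.
rewrite -[RHS]sz; apply/eqP; rewrite -all_count; apply/(all_nthP 0) => i.
rewrite sz => ik; rewrite nth_take//; apply: le_lt_trans yk.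
apply: (sorted_leq_nth le_trans le_refl 0 ss) => //.
by rewrite inE (leq_trans ik).
Qed.

Lemma order_stat_ge0 s k : (forall x, x \in s -> 0 <= x) ->
  0 <= nth 0 (0 :: sort <=%O s) k.
Proof.
case: k => [//|k] s0 /=; have [ks|sk] := ltnP k (size (sort <=%O s)).
  by apply: s0; rewrite -(mem_sort <=%O) mem_nth.
by rewrite nth_default.
Qed.

End order_statistics.

(** * Deterministic error analysis along one path *)

Section pathwise.
Context {R : realType}.

Lemma min_dist_le (a b a' b' z : R) : `|a - a'| <= z -> `|b - b'| <= z ->
  `|Num.min a b - Num.min a' b'| <= z.
Proof.
rewrite !ler_norml => /andP[h1 h2] /andP[h3 h4]; apply/andP.
by split; case: (leP a b) => ?; case: (leP a' b') => ?; lra.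
Qed.

Lemma dist_sqr_le (a b z y : R) : 0 <= a -> 0 <= b -> `|a - b| <= z -> a + b <= y ->
  `|a ^+ 2 - b ^+ 2| <= z * y.
Proof.
move=> a0 b0 abz aby; rewrite subr_sqr normrM ler_pM//.
by rewrite ger0_norm// addr_ge0.
Qed.

(** [K_] retains only |x| <= n^(-1/4), whose square is n^(-1/2) = r. This is the sole control on
    cells with jumps. *)
Lemma winsorized_le (n : nat) (r x v : R) : (0 < n)%N -> 0 < r -> n%:R * r ^+ 2 = 1 -> 0 <= v ->
  Num.min `|x| v ^+ 2 * (`|x| <= n%:R `^ (- 4^-1))%R%:R <= r.
Proof.
move=> n0 r0 nr v0; case: (boolP (`|x| <= _)) => [h|_]; last by rewrite mulr0 ltW.
apply: (@le_trans _ _ (`|x| ^+ 2)).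
  by rewrite mulr1 lerXn2r ?nnegrE// ?ge_min ?lexx// le_min normr_ge0.
have -> : r = (n%:R `^ (- 4^-1)) ^+ 2.
  apply/eqP; rewrite -(@eqrXn2 _ 2 r _ isT (ltW r0) (sqr_ge0 _)).
  rewrite -exprM powRn_exp (_ : - 4^-1 * (2 * 2)%:R = - 1); last by field.
  rewrite powRN powRr1 ?ler0n//; apply/eqP.
  by rewrite -[LHS](@mulKf _ (n%:R : R)) ?nr ?mulr1// pnatr_eq0 -lt0n.
by rewrite lerXn2r ?nnegrE ?powR_ge0.
Qed.

Variables (n : nat) (n_gt0 : (0 < n)%N).
Variables (T alpha c c0 dens : R).
(** The values at a fixed outcome: [sg] is sigma at the left ends of the cells, [I] the integrals of
    sigma^2 over them. In the application r = n^(-1/2), u = n^e, del = n^(-beta), and the local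
    notation [s] is the square root of T / n. *)
Variables (dX Z sg S I : nat -> R) (cellb winb : nat -> bool).
Local Notation N := (n%:R : R).
Variables (r u del Kw : R).
Hypotheses (T_gt0 : 0 < T) (alpha01 : 0 < alpha < 1) (cP : is_chi2_quantile alpha c)
  (c0_gt0 : 0 < c0) (dens_gt0 : 0 < dens) (Kw_ge0 : 0 <= Kw).
Local Notation q := (Num.sqrt c).
Hypothesis densP : forall x y, 0 <= x -> x <= y -> y <= q + 1 ->
    pabs x + dens * (y - x) <= pabs y.
Hypotheses (r_gt0 : 0 < r) (r_le1 : r <= 1) (Nr : N * r ^+ 2 = 1) (u_ge1 : 1 <= u) (r_del : r <= del).
Local Notation inI j := ((1 <= j <= n)%N).
Local Notation s := (Num.sqrt T * r).
Hypotheses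
  (win_cell : forall j, inI j -> winb j -> cellb j)
  (H1 : forall j, inI j -> `|sg j| <= u)
  (H2 : forall j, inI j -> u^-1 <= S j)
  (H3 : forall j, inI j -> winb j -> `|sg j ^+ 2 - c0 * S j| <= del * u)
  (H4 : (\sum_(1 <= j < n.+1) (~~ cellb j)%:R) * r <= del * u)
  (H4' : (\sum_(1 <= j < n.+1) (~~ winb j)%:R) * r ^+ 2 <= Kw * (del * u))
  (H5 : forall j, inI j -> `|Z j| <= u)
  (H6 : forall j, inI j -> cellb j -> `|dX j - sg j * (s * Z j)| <= u * r ^+ 2)
  (H7 : `|\sum_(1 <= j < n.+1) T * r ^+ 2 * sg j ^+ 2 * (gmin c (Z j) - wfactor c)| <= T * r * u ^+ 3)
  (H9 : forall j, inI j -> cellb j -> `|I j - T * r ^+ 2 * sg j ^+ 2| <= 3 * (u ^+ 2 * r ^+ 3))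
  (H9' : forall j, inI j -> 0 <= I j <= u * r ^+ 2).

(** Chosen so that moving the quantile by tau changes the expected count by enough to outweigh all
    counting errors, see [budget]. *)
Definition tau_const := (2 + Kw) / dens.
(** The linearization error and the proxy error, both divided by the lower bound sqrt(c0) / u of
    [rho]. *)
Definition eta_const := ((Num.sqrt T)^-1 + (Num.sqrt c0)^-1) / Num.sqrt c0.
Local Notation tau := (tau_const * (del * u ^+ 4)).
Local Notation eta := (eta_const * (del * u ^+ 4)).

Hypotheses
  (H8 : `|\sum_(1 <= j < n.+1) (`|Z j| <= q + tau)%R%:R - N * pabs (q + tau)| * r <= u)
  (H8' : `|\sum_(1 <= j < n.+1) (`|Z j| <= q - tau)%R%:R - N * pabs (q - tau)| * r <= u)
  (tau_le1 : tau <= 1) (tau_leq : tau <= q) (eta_le1 : eta <= 1)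
  (K_small : (Num.sqrt T + 1) * (r * u ^+ 2) <= N `^ (- 4^-1)).

Let V j := `|(Num.sqrt (S j))^-1 * dX j|.
Let sn : nat := s_ alpha n.
Let Vs := nth 0 (0 :: sort <=%O [seq V j | j <- iota 1 n]) sn.

Let u_gt0 : 0 < u. Proof. exact: lt_le_trans u_ge1. Qed.
Let del_gt0 : 0 < del. Proof. exact: lt_le_trans r_del. Qed.
Let sT : 0 < Num.sqrt T. Proof. by rewrite sqrtr_gt0. Qed.
Let sc0 : 0 < Num.sqrt c0. Proof. by rewrite sqrtr_gt0. Qed.
Let s_gt0 : 0 < s. Proof. exact: mulr_gt0. Qed.
Let c_gt0 : 0 < c. Proof. exact: (quantile_gt0 alpha01 cP). Qed.
Let q_gt0 : 0 < q. Proof. by rewrite sqrtr_gt0. Qed.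
Let tau_gt0 : 0 < tau.
Proof. by rewrite !mulr_gt0 ?invr_gt0 ?exprn_gt0// ltr_wpDr. Qed.
Let eta_gt0 : 0 < eta.
Proof. by rewrite !mulr_gt0 ?invr_gt0 ?exprn_gt0// addr_gt0// invr_gt0. Qed.

Let rho j := Num.sqrt (c0 * S j).

Let S_gt0 j : inI j -> 0 < S j.
Proof. by move=> /H2; apply: lt_le_trans; rewrite invr_gt0. Qed.

Let rhoE j : rho j = Num.sqrt c0 * Num.sqrt (S j).
Proof. by rewrite /rho sqrtrM// ltW. Qed.

Let rho_lower j : inI j -> Num.sqrt c0 / u <= rho j.
Proof.
move=> jn; rewrite rhoE ler_pM2l//.
rewrite -(ler_pXn2r (n := 2)) ?nnegrE ?invr_ge0 ?(ltW u_gt0)// sqr_sqrtr ?(ltW (S_gt0 jn))//.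
apply: le_trans (H2 jn); rewrite expr2 ler_piMr ?invr_ge0 ?(ltW u_gt0)//.
by rewrite invf_le1.
Qed.

Let rho_gt0 j : inI j -> 0 < rho j.
Proof. by move=> jn; apply: lt_le_trans (rho_lower jn); rewrite divr_gt0. Qed.

(** The difference of squares is divided by [rho j] + |sg j|, which is at least sqrt(c0) / u by the
    lower bound on S; this costs one power of u. *)
Let rho_close j : inI j -> winb j -> `|rho j - `|sg j| | <= del * u ^+ 2 / Num.sqrt c0.
Proof.
move=> jn wj; have rj := rho_gt0 jn.
have h : `|rho j - `|sg j| | * rho j <= del * u.
  apply: le_trans (H3 jn wj); rewrite -[rho j in X in X <= _]gtr0_norm//.
  have -> : sg j ^+ 2 - c0 * S j = (`|sg j| - rho j) * (`|sg j| + rho j).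
    rewrite -subr_sqr real_normK ?num_real// /rho sqr_sqrtr// mulr_ge0// ?ltW//.
    exact: S_gt0.
  rewrite normrM distrC gtr0_norm// ler_wpM2l//.
  by rewrite ger0_norm ?addr_ge0 ?(ltW rj)// lerDr.
rewrite ler_pdivlMr//; apply: le_trans (_ : del * u * u <= _); last by rewrite expr2 mulrA.
have := ler_wpM2l (normr_ge0 (rho j - `|sg j|)) (rho_lower jn).
move=> h2; have h3 := le_trans h2 h.
by move: h3; rewrite mulrA ler_pdivrMr.
Qed.

Let dX_cell j : inI j -> cellb j -> `|dX j| <= (Num.sqrt T + 1) * (r * u ^+ 2).
Proof.
move=> jn cj; have -> : dX j = (dX j - sg j * (s * Z j)) + sg j * (s * Z j) by rewrite subrK.
apply: (le_trans (ler_normD _ _)).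
have h1 := H6 jn cj.
have h2 : `|sg j * (s * Z j)| <= u * (s * u).
  by rewrite normrM ler_pM// ?H1// normrM gtr0_norm// ler_pM2l// H5.
have h3 : u * r ^+ 2 <= r * u ^+ 2.
  rewrite !expr2 mulrCA ler_pM2l// ler_pM2l//.
  exact: le_trans u_ge1.
rewrite mulrDl mul1r addrC lerD ?(le_trans h1)//.
by apply: (le_trans h2); rewrite le_eqVlt; apply/orP; left; apply/eqP; ring.
Qed.

Let dX_close j : inI j -> winb j -> `| `|dX j| - `|sg j| * (s * `|Z j|) | <= u * r ^+ 2.
Proof.
move=> jn wj; apply: le_trans (H6 jn (win_cell jn wj)).
have <- : `|sg j * (s * Z j)| = `|sg j| * (s * `|Z j|) by rewrite !normrM (gtr0_norm r_gt0) (gtr0_norm sT).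
exact: ler_dist_dist.
Qed.

Let r2_le : r ^+ 2 <= s * del / Num.sqrt T.
Proof.
have -> : s * del / Num.sqrt T = r * del by field; rewrite gt_eqF.
by rewrite expr2 ler_pM2l.
Qed.

(** The numerator splits into the linearization error of [dX] and (rho - |sg|) s |Z|. Of the powers
    of u in the second part, two come from [rho_close], one from Z and one from dividing by
    [rho]. *)
Let v_close j : inI j -> winb j -> `| `|dX j| / (rho j * s) - `|Z j| | <= eta.
Proof.
move=> jn wj; have rj := rho_gt0 jn.
have rs : 0 < rho j * s by rewrite mulr_gt0.
have -> : `|dX j| / (rho j * s) - `|Z j| = (`|dX j| - rho j * s * `|Z j|) / (rho j * s).
  by field; rewrite !gt_eqF.
rewrite normrM normfV (gtr0_norm rs) ler_pdivrMr//.
have -> : `|dX j| - rho j * s * `|Z j| = (`|dX j| - `|sg j| * (s * `|Z j|)) - (rho j - `|sg j|) * (s * `|Z j|) by ring.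
apply: (le_trans (ler_normB _ _)).
have h1 : `|(rho j - `|sg j|) * (s * `|Z j|)| <= del * u ^+ 2 / Num.sqrt c0 * (s * u).
  rewrite normrM ler_pM// ?rho_close// normrM gtr0_norm// normr_id ler_pM2l//.
  exact: H5.
have h2 : u * r ^+ 2 <= u ^+ 3 * (s * del / Num.sqrt T).
  apply: ler_pM; rewrite ?(ltW u_gt0) ?sqr_ge0//.
  by rewrite ler_eXnr.
have h3 : u ^+ 3 * (s * del) * ((Num.sqrt T)^-1 + (Num.sqrt c0)^-1) <= eta * (rho j * s).
  have := ler_wpM2l (ltW (mulr_gt0 eta_gt0 s_gt0)) (rho_lower jn).
  have -> : eta * s * (Num.sqrt c0 / u) = u ^+ 3 * (s * del) * ((Num.sqrt T)^-1 + (Num.sqrt c0)^-1).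
    by rewrite /eta_const; field; rewrite !gt_eqF.
  by rewrite -(mulrA eta s) (mulrC s (rho j)).
apply: le_trans h3; rewrite mulrDr; apply: lerD.
  by apply: (le_trans (dX_close jn wj)); apply: (le_trans h2); rewrite mulrA.
by apply: (le_trans h1); rewrite le_eqVlt; apply/orP; left; apply/eqP; ring.
Qed.

Let cnt (Q : pred nat) : R := \sum_(1 <= j < n.+1) (Q j)%:R.

Let cntE (Q : pred nat) : (count Q (iota 1 n))%:R = cnt Q.
Proof.
by rewrite /cnt /index_iota subSS subn0 -sum1_count natr_sum [LHS]big_mkcond; apply: eq_bigr => j _; case: (Q j).
Qed.

Let cnt_le (Q Q' : pred nat) : (forall j, inI j -> Q j -> Q' j || ~~ winb j) ->
  cnt Q <= cnt Q' + cnt (fun j => ~~ winb j).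
Proof.
move=> QQ; rewrite /cnt -big_split/= big_seq [leRHS]big_seq; apply: ler_sum => j.
rewrite mem_index_iota ltnS => jn; rewrite -natrD ler_nat.
by have := QQ j jn; case: (Q j); case: (Q' j); case: (winb j) => //= /(_ isT).
Qed.

Let VE j : inI j -> V j = Num.sqrt c0 * s * (`|dX j| / (rho j * s)).
Proof.
move=> jn; rewrite /V normrM normfV (ger0_norm (sqrtr_ge0 _)) rhoE; field.
by rewrite !gt_eqF// sqrtr_gt0 S_gt0.
Qed.

Let c0s : 0 < Num.sqrt c0 * s. Proof. exact: mulr_gt0. Qed.

Let cntw : cnt (fun j => ~~ winb j) * r ^+ 2 <= Kw * (del * u). Proof. exact: H4'. Qed.

Let ndel : dens * tau = (2 + Kw) * (del * u ^+ 4).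
Proof. by rewrite /tau_const; field; rewrite gt_eqF. Qed.

Let u4 : u <= u ^+ 4. Proof. by rewrite ler_eXnr. Qed.

Let sn_le : (sn%:R <= N * (1 - alpha)) /\ (N * (1 - alpha) - 1 < sn%:R).
Proof.
have h : 0 <= N * (1 - alpha) by rewrite mulr_ge0// subr_ge0 ltW//; case/andP: alpha01.
have /andP[h1 h2] := truncn_itv h; split => //.
by rewrite ltrBlDr -natr1 in h2 *.
Qed.

Let N_gt0 : 0 < N. Proof. by rewrite ltr0n. Qed.

(** The gain n dens tau pays for Azuma's error u / r, for the spoilt windows, and for a unit that
    covers the rounding in [s_]. *)
Let budget : N * (dens * tau) >= u / r + cnt (fun j => ~~ winb j) + 1.
Proof.
have r2 : 0 < r ^+ 2 by rewrite exprn_gt0.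
rewrite -(ler_pM2r r2) mulrAC Nr mul1r ndel !mulrDl mul1r.
have -> : u / r * r ^+ 2 = r * u by field; rewrite gt_eqF.
have h1 : r * u <= del * u ^+ 4 by apply: ler_pM => //; exact: ltW.
have h2 : r ^+ 2 <= del * u ^+ 4.
  by rewrite expr2; apply: ler_pM => //; rewrite ?(ltW r_gt0)// (le_trans r_le1)// (le_trans u_ge1).
have h3 : Kw * (del * u) <= Kw * (del * u ^+ 4) by rewrite ler_wpM2l// ler_wpM2l// ltW.
have := cntw; lra.
Qed.

(** The number of |Z_j| <= q + tau is at least n (1 - alpha) + n dens tau - u / r. Discarding the
    spoilt windows leaves at least s_n of them, and [v_close] turns these into V_j below the
    threshold. *)
Let Vs_upper : Vs <= Num.sqrt c0 * s * (q + tau + eta).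
Proof.
apply: order_stat_le; first by rewrite mulr_ge0 ?(ltW c0s)// !addr_ge0// ltW.
rewrite count_map -(ler_nat R) cntE; have [h _] := sn_le; apply: (le_trans h).
have hp : pabs (q + tau) >= (1 - alpha) + dens * tau.
  rewrite -(pabs_quantile alpha01 cP).
  have := densP (ltW q_gt0) (_ : q <= q + tau) (_ : q + tau <= q + 1).
  by rewrite addrAC subrr add0r lerDl lerD2l; apply => //; exact: ltW.
have hz : N * pabs (q + tau) - u / r <= cnt (fun j => `|Z j| <= q + tau).
  move: H8; rewrite -ler_pdivlMr// ler_norml -/(cnt (fun j => `|Z j| <= q + tau)) => /andP[h1 _].
  by lra.
have hc : cnt (fun j => `|Z j| <= q + tau) <=
    cnt (preim V (fun x => x <= Num.sqrt c0 * s * (q + tau + eta))) + cnt (fun j => ~~ winb j).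
  apply: cnt_le => j jn hZ; have [wj|_] := boolP (winb j); last by rewrite orbT.
  rewrite /= orbF.
  rewrite (VE jn) ler_pM2l//; have := v_close jn wj; rewrite ler_norml => /andP[_ h2].
  by lra.
have hN := ler_wpM2l (ltW N_gt0) hp; rewrite mulrDr in hN.
have := budget; lra.
Qed.

(** A V_j below the threshold with a clean window forces |Z_j| <= q - tau. Hence at most n (1 -
    alpha) - 1 of them exist, which is less than s_n. *)
Let Vs_lower : Num.sqrt c0 * s * (q - tau - eta) <= Vs.
Proof.
have [h1 h2] := sn_le.
have hsz : (sn <= size [seq V j | j <- iota 1 n])%N.
  rewrite size_map size_iota -(ler_nat R); apply: (le_trans h1).
  by rewrite ler_piMr// ?ler0n// lerBlDr lerDl ltW//; case/andP: alpha01.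
apply: order_stat_ge => //; rewrite count_map -(ltr_nat R) cntE; apply: le_lt_trans h2.
have hp : pabs (q - tau) <= (1 - alpha) - dens * tau.
  rewrite -(pabs_quantile alpha01 cP) lerBrDr.
  have e : q - (q - tau) = tau by ring.
  have := densP (_ : 0 <= q - tau) (_ : q - tau <= q) (_ : q <= q + 1).
  rewrite e subr_ge0 lerBlDr lerDl lerDl; apply => //; exact: ltW.
have hz : cnt (fun j => `|Z j| <= q - tau) <= N * pabs (q - tau) + u / r.
  move: H8'; rewrite -ler_pdivlMr// ler_norml -/(cnt (fun j => `|Z j| <= q - tau)) => /andP[_ h3].
  by lra.
have hc : cnt (preim V (fun x => x < Num.sqrt c0 * s * (q - tau - eta))) <=
    cnt (fun j => `|Z j| <= q - tau) + cnt (fun j => ~~ winb j).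
  apply: cnt_le => j jn /= hV; have [wj|_] := boolP (winb j); last by rewrite orbT.
  rewrite /= orbF.
  move: hV; rewrite (VE jn) ltr_pM2l// => hV; have := v_close jn wj; rewrite ler_norml => /andP[h3 _].
  by lra.
have hN := ler_wpM2l (ltW N_gt0) hp; rewrite mulrBr in hN.
have := budget; lra.
Qed.

Definition quant_const := tau_const + eta_const.
Definition term_const := (Num.sqrt T)^-1 + (q + 2) / Num.sqrt c0 + quant_const.
(** [win_const], [cell_const] and [jump_const] belong to the three kinds of cells: jump-free window,
    jump-free cell in a spoilt window, and cell with a jump. *)
Definition win_const := Num.sqrt T * term_const * (2 * Num.sqrt T + 1).
Definition cell_const := (Num.sqrt T + 1) ^+ 2 + T * c.
Definition jump_const := 1 + T * c.

Let Kj j : R := (`|dX j| <= N `^ (- 4^-1))%R%:R.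
Let term j := Num.min `|dX j| (Num.sqrt (S j) * Vs) ^+ 2 * Kj j.
Let ideal j := T * r ^+ 2 * sg j ^+ 2 * gmin c (Z j).

Let Vs_ge0 : 0 <= Vs.
Proof. by apply: order_stat_ge0 => x /mapP[j _ ->]; exact: normr_ge0. Qed.

Let T_ge0 : 0 <= T. Proof. exact: ltW. Qed.

Let ideal_ge0 j : 0 <= ideal j.
Proof.
by rewrite /ideal mulr_ge0// ?(gmin_ge0 alpha01 cP)// mulr_ge0 ?sqr_ge0// mulr_ge0 ?sqr_ge0.
Qed.

Let ideal_le j : inI j -> ideal j <= T * c * (r ^+ 2 * u ^+ 2).
Proof.
move=> jn; have -> : T * c * (r ^+ 2 * u ^+ 2) = T * r ^+ 2 * u ^+ 2 * c by ring.
apply: ler_pM; rewrite ?(gmin_ge0 alpha01 cP) ?gmin_le//.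
  by rewrite mulr_ge0 ?sqr_ge0// mulr_ge0 ?sqr_ge0.
rewrite ler_pM2l ?mulr_gt0 ?exprn_gt0//.
by rewrite -real_normK ?num_real// lerXn2r ?nnegrE ?(ltW u_gt0)// H1.
Qed.

Let term_ge0 j : 0 <= term j. Proof. by rewrite /term mulr_ge0// sqr_ge0. Qed.

Let term_le_dX j : term j <= `|dX j| ^+ 2.
Proof.
rewrite /term /Kj; case: (_ <= N `^ _); last by rewrite mulr0 sqr_ge0.
rewrite mulr1 lerXn2r ?nnegrE// ?ge_min ?lexx// le_min normr_ge0 mulr_ge0//.
Qed.

Let term_le_r j : term j <= r.
Proof. by rewrite /term /Kj; apply: (winsorized_le (dX j) n_gt0 r_gt0 Nr); rewrite mulr_ge0// sqrtr_ge0. Qed.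

Let du_le k : (k <= 7)%N -> del * u ^+ k <= del * u ^+ 7.
Proof. by move=> k7; rewrite ler_pM2l// ler_weXn2l. Qed.

(** On such a cell |dX| <= n^(-1/4), so the truncation is inactive. Both quantities are then squares
    of minima; the minimum is Lipschitz in its arguments, and a difference of squares is the
    difference times the sum, the latter of order r u^2. *)
Let term_win j : inI j -> winb j -> `|term j - ideal j| <= win_const * (r ^+ 2 * (del * u ^+ 7)).
Proof.
move=> jn wj; have cj := win_cell jn wj; have rj := rho_gt0 jn.
have -> : term j = Num.min `|dX j| (Num.sqrt (S j) * Vs) ^+ 2.
  by rewrite /term /Kj (le_trans (dX_cell jn cj) K_small) mulr1.
have -> : ideal j = Num.min (`|sg j| * (s * `|Z j|)) (`|sg j| * s * q) ^+ 2.
  rewrite mulrA -minr_pMr ?mulr_ge0// ?(ltW r_gt0)//.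
  rewrite exprMn.
  rewrite /ideal /gmin; congr (_ * _).
    by rewrite !exprMn sqr_sqrtr// real_normK ?num_real//; ring.
  have [Zq|qZ] := leP `|Z j| q.
    rewrite real_normK ?num_real//; apply/min_idPl.
    by rewrite -[leRHS](sqr_sqrtr (ltW c_gt0)) -real_normK ?num_real// lerXn2r// nnegrE ltW.
  rewrite sqr_sqrtr ?(ltW c_gt0)//; apply/min_idPr.
  by rewrite -[leLHS](sqr_sqrtr (ltW c_gt0)) -[leRHS]real_normK ?num_real// lerXn2r ?nnegrE// ltW.
(* The order statistic in its natural unit, close to q. The threshold becomes s rho Q, which no
   longer shows c0 apart from [rho]. *)
pose Q := Vs / (Num.sqrt c0 * s).
have Q1 : Q <= q + tau + eta by rewrite ler_pdivrMr// mulrC.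
have Q2 : q - tau - eta <= Q by rewrite ler_pdivlMr// mulrC.
have Q0 : 0 <= Q by rewrite divr_ge0// ltW.
have SVE : Num.sqrt (S j) * Vs = s * (rho j * Q).
  by rewrite rhoE /Q; field; rewrite !gt_eqF.
clearbody Q.
have -> : win_const * (r ^+ 2 * (del * u ^+ 7)) =
  (s * (del * u ^+ 5) * term_const) * ((2 * Num.sqrt T + 1) * (r * u ^+ 2)).
  by rewrite /win_const; ring.
have p5 : 0 < del * u ^+ 5 by rewrite mulr_gt0// exprn_gt0.
have h1 : u * r ^+ 2 <= s * (del * u ^+ 5) * term_const.
  apply: (@le_trans _ _ (s * (del * u ^+ 5) * (Num.sqrt T)^-1)).
    have -> : s * (del * u ^+ 5) * (Num.sqrt T)^-1 = u ^+ 5 * (s * del / Num.sqrt T) by ring.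
    by apply: ler_pM; rewrite ?(ltW u_gt0) ?sqr_ge0// ler_eXnr.
  have p6 : 0 <= s * (del * u ^+ 5) by rewrite ltW// mulr_gt0.
  rewrite ler_wpM2l// /term_const -addrA lerDl addr_ge0//.
  by rewrite /quant_const addr_ge0// divr_ge0 ?addr_ge0 ?invr_ge0//; exact: ltW.
have h2 : `|Num.sqrt (S j) * Vs - `|sg j| * s * q| <= s * (del * u ^+ 5) * term_const.
  have -> : Num.sqrt (S j) * Vs - `|sg j| * s * q =
    s * ((rho j - `|sg j|) * Q + `|sg j| * (Q - q)) by rewrite SVE; ring.
  rewrite normrM (gtr0_norm s_gt0) -mulrA ler_pM2l//.
  apply: (le_trans (ler_normD _ _)).
  have g1 : `|(rho j - `|sg j|) * Q| <= del * u ^+ 5 * ((q + 2) / Num.sqrt c0).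
    rewrite normrM (ger0_norm Q0).
    apply: (@le_trans _ _ (del * u ^+ 2 / Num.sqrt c0 * (q + 2))).
      apply: ler_pM => //; first exact: rho_close.
      by apply: (le_trans Q1); rewrite -addrA lerD2l (le_trans (lerD tau_le1 eta_le1)).
    have -> : del * u ^+ 2 / Num.sqrt c0 * (q + 2) = del * u ^+ 2 * ((q + 2) / Num.sqrt c0) by ring.
    rewrite ler_wpM2r ?divr_ge0 ?addr_ge0 ?(ltW q_gt0) ?(ltW sc0)//.
    by rewrite ler_pM2l// ler_weXn2l.
  have g2 : `| `|sg j| * (Q - q)| <= del * u ^+ 5 * quant_const.
    rewrite normrM normr_id; apply: (@le_trans _ _ (u * (tau + eta))).
      apply: ler_pM => //; first exact: H1.
      rewrite ler_norml lerBrDr lerBlDr opprD; apply/andP; split.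
        by rewrite addrC addrA.
      by rewrite [leRHS]addrC addrA.
    by rewrite /quant_const le_eqVlt; apply/orP; left; apply/eqP; ring.
  have g3 : 0 <= del * u ^+ 5 * (Num.sqrt T)^-1 by rewrite mulr_ge0 ?invr_ge0 ?(ltW p5) ?(ltW sT).
  apply: (le_trans (lerD g1 g2)).
  by rewrite /term_const -addrA [leRHS]mulrDr (mulrDr _ _ quant_const) lerDr.
apply: dist_sqr_le.
- by rewrite le_min normr_ge0 mulr_ge0// sqrtr_ge0.
- by rewrite le_min !mulr_ge0// ?sqrtr_ge0// ltW.
- apply: min_dist_le => //; apply: le_trans h1; exact: dX_close.
have g1 := dX_cell jn cj.
have g2 : `|sg j| * (s * `|Z j|) <= Num.sqrt T * (r * u ^+ 2).
  have -> : Num.sqrt T * (r * u ^+ 2) = u * (s * u) by ring.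
  by apply: ler_pM (H1 jn) _; rewrite ?ler_pM2l ?H5// mulr_ge0// ltW.
have g3 : Num.min `|dX j| (Num.sqrt (S j) * Vs) <= `|dX j| by rewrite ge_min lexx.
have g4 : Num.min (`|sg j| * (s * `|Z j|)) (`|sg j| * s * q) <= `|sg j| * (s * `|Z j|) by rewrite ge_min lexx.
by rewrite !mulrDl in g1 *; lra.
Qed.

(** Only the common size r^2 of both quantities is used: there are few enough spoilt windows for
    this crude bound. *)
Let term_cell j : inI j -> cellb j -> `|term j - ideal j| <= cell_const * (r ^+ 2 * u ^+ 4).
Proof.
move=> jn cj; have h1 := term_le_dX j; have h2 := ideal_le jn.
have h3 : `|dX j| ^+ 2 <= (Num.sqrt T + 1) ^+ 2 * (r ^+ 2 * u ^+ 4).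
  have -> : (Num.sqrt T + 1) ^+ 2 * (r ^+ 2 * u ^+ 4) = ((Num.sqrt T + 1) * (r * u ^+ 2)) ^+ 2 by ring.
  rewrite lerXn2r ?nnegrE ?dX_cell//.
  by rewrite !mulr_ge0 ?exprn_ge0 ?addr_ge0 ?(ltW sT) ?(ltW r_gt0) ?(ltW u_gt0).
have h4 : T * c * (r ^+ 2 * u ^+ 2) <= T * c * (r ^+ 2 * u ^+ 4).
  by rewrite ler_wpM2l ?mulr_ge0 ?(ltW c_gt0)// ler_wpM2l ?sqr_ge0// ler_weXn2l.
have := term_ge0 j; have := ideal_ge0 j.
by rewrite /cell_const mulrDl ler_norml => ? ?; apply/andP; split; lra.
Qed.

Let term_jump j : inI j -> `|term j - ideal j| <= jump_const * (r * u ^+ 2).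
Proof.
move=> jn; have h1 := term_le_r j; have h2 := ideal_le jn.
have h3 : r <= r * u ^+ 2 by rewrite ler_peMr ?(ltW r_gt0)// exprn_ege1.
have h4 : T * c * (r ^+ 2 * u ^+ 2) <= T * c * (r * u ^+ 2).
  rewrite ler_wpM2l ?mulr_ge0 ?(ltW c_gt0)// ler_wpM2r ?sqr_ge0//.
  by rewrite expr2 ler_piMr// ltW.
have := term_ge0 j; have := ideal_ge0 j.
by rewrite /jump_const mulrDl mul1r ler_norml => ? ?; apply/andP; split; lra.
Qed.

Definition pathwise_const :=
  (wfactor c)^-1 * (win_const + Kw * cell_const + jump_const + T) + (4 + T).

Let wf_gt0 : 0 < wfactor c. Proof. exact: (wfactor_gt0 alpha01 cP). Qed.

Let win_const_ge0 : 0 <= win_const.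
Proof.
rewrite /win_const !mulr_ge0 ?addr_ge0 ?invr_ge0 ?(ltW sT) ?(ltW sc0) ?(ltW q_gt0) ?(ltW dens_gt0)//.
  by rewrite divr_ge0 ?addr_ge0// ltW.
by rewrite divr_ge0 ?addr_ge0 ?invr_ge0// ltW.
Qed.

Let cell_const_ge0 : 0 <= cell_const.
Proof. by rewrite /cell_const addr_ge0 ?sqr_ge0// mulr_ge0// (ltW c_gt0). Qed.

Let jump_const_ge0 : 0 <= jump_const.
Proof. by rewrite /jump_const addr_ge0// mulr_ge0// (ltW c_gt0). Qed.

Let sum_cst (a : R) : \sum_(1 <= j < n.+1) a = N * a.
Proof. by rewrite sumr_const_nat subSS subn0 mulr_natl. Qed.

Let r_ge0 k : 0 <= r ^+ k. Proof. by rewrite exprn_ge0// ltW. Qed.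
Let u_ge0 k : 0 <= u ^+ k. Proof. by rewrite exprn_ge0// ltW. Qed.
Let del_ge0 : 0 <= del. Proof. exact: ltW. Qed.

(** The three kinds of cells number n, at most Kw del u / r^2 and at most del u / r, which offsets
    errors of order r^2 del, r^2 and r respectively, since n r^2 = 1. *)
Let term_sum : `|\sum_(1 <= j < n.+1) (term j - ideal j)| <=
  (win_const + Kw * cell_const + jump_const) * (del * u ^+ 7).
Proof.
apply: (le_trans (ler_norm_sum _ _ _)).
apply: (@le_trans _ _ (\sum_(1 <= j < n.+1) (win_const * (r ^+ 2 * (del * u ^+ 7)) +
   cell_const * (r ^+ 2 * u ^+ 4) * (~~ winb j)%:R + jump_const * (r * u ^+ 2) * (~~ cellb j)%:R))).
  rewrite big_seq [leRHS]big_seq; apply: ler_sum => j; rewrite mem_index_iota ltnS => jn.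
  have p1 : 0 <= win_const * (r ^+ 2 * (del * u ^+ 7)).
    by rewrite mulr_ge0// mulr_ge0// mulr_ge0.
  have p2 : 0 <= cell_const * (r ^+ 2 * u ^+ 4).
    by rewrite mulr_ge0// mulr_ge0.
  have [cj|ncj] := boolP (cellb j).
    rewrite mulr0 addr0; have [wj|nwj] := boolP (winb j).
      by rewrite mulr0 addr0 term_win.
    by rewrite mulr1 (le_trans (term_cell jn cj))// lerDr.
  have -> : winb j = false by apply/negbTE/negP => /(win_cell jn); exact/negP.
  by rewrite !mulr1 (le_trans (term_jump jn))// lerDr addr_ge0.
rewrite !big_split/= sum_cst -!mulr_sumr.
have e1 : N * (win_const * (r ^+ 2 * (del * u ^+ 7))) = win_const * (del * u ^+ 7).
  by rewrite mulrCA (mulrA N) Nr mul1r.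
have e2 : cell_const * (r ^+ 2 * u ^+ 4) * (\sum_(1 <= j < n.+1) (~~ winb j)%:R) <= Kw * cell_const * (del * u ^+ 7).
  have h := ler_wpM2l (mulr_ge0 cell_const_ge0 (exprn_ge0 4 (ltW u_gt0))) H4'.
  have -> : cell_const * (r ^+ 2 * u ^+ 4) * (\sum_(1 <= j < n.+1) (~~ winb j)%:R) =
    cell_const * u ^+ 4 * ((\sum_(1 <= j < n.+1) (~~ winb j)%:R) * r ^+ 2) by ring.
  apply: (le_trans h).
  have -> : cell_const * u ^+ 4 * (Kw * (del * u)) = Kw * cell_const * (del * u ^+ 5) by ring.
  by rewrite ler_wpM2l ?mulr_ge0// du_le.
have e3 : jump_const * (r * u ^+ 2) * (\sum_(1 <= j < n.+1) (~~ cellb j)%:R) <= jump_const * (del * u ^+ 7).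
  have h := ler_wpM2l (mulr_ge0 jump_const_ge0 (exprn_ge0 2 (ltW u_gt0))) H4.
  have -> : jump_const * (r * u ^+ 2) * (\sum_(1 <= j < n.+1) (~~ cellb j)%:R) =
    jump_const * u ^+ 2 * ((\sum_(1 <= j < n.+1) (~~ cellb j)%:R) * r) by ring.
  apply: (le_trans h).
  have -> : jump_const * u ^+ 2 * (del * u) = jump_const * (del * u ^+ 3) by ring.
  by rewrite ler_wpM2l// du_le.
rewrite e1 [leRHS]mulrDl (mulrDl win_const).
by rewrite lerD// lerD.
Qed.

Let rdu k : (k <= 7)%N -> r * u ^+ k <= del * u ^+ 7.
Proof.
move=> k7; apply: le_trans (du_le k7).
by rewrite ler_wpM2r// exprn_ge0// ltW.
Qed.

(** Jump-free cells lose order r^3 each, hence r in total. Cells with a jump lose r^2 each, and the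
    extra factor r more than compensates their number. *)
Let cell_sum : `|\sum_(1 <= j < n.+1) (T * r ^+ 2 * sg j ^+ 2 - I j)| <= (4 + T) * (del * u ^+ 7).
Proof.
apply: (le_trans (ler_norm_sum _ _ _)).
apply: (@le_trans _ _ (\sum_(1 <= j < n.+1) (3 * (u ^+ 2 * r ^+ 3) +
   (1 + T) * (u ^+ 2 * r ^+ 2) * (~~ cellb j)%:R))).
  rewrite big_seq [leRHS]big_seq; apply: ler_sum => j; rewrite mem_index_iota ltnS => jn.
  have [cj|ncj] := boolP (cellb j).
    by rewrite mulr0 addr0 distrC H9.
  have /andP[i0 i1] := H9' jn.
  have s2 : sg j ^+ 2 <= u ^+ 2 by rewrite -real_normK ?num_real// lerXn2r ?nnegrE ?(ltW u_gt0)// H1.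
  have g1 : T * r ^+ 2 * sg j ^+ 2 <= T * (u ^+ 2 * r ^+ 2).
    have -> : T * (u ^+ 2 * r ^+ 2) = T * r ^+ 2 * u ^+ 2 by ring.
    by rewrite ler_wpM2l// mulr_ge0// sqr_ge0.
  have g2 : u * r ^+ 2 <= u ^+ 2 * r ^+ 2 by rewrite ler_wpM2r ?sqr_ge0// ler_eXnr.
  have g3 : 0 <= T * r ^+ 2 * sg j ^+ 2 by rewrite mulr_ge0 ?sqr_ge0// mulr_ge0.
  have g4 : 0 <= 3 * (u ^+ 2 * r ^+ 3) by rewrite mulr_ge0// mulr_ge0.
  by rewrite mulr1 mulrDl mul1r ler_norml; apply/andP; split; lra.
rewrite big_split/= sum_cst -mulr_sumr.
have e1 : N * (3 * (u ^+ 2 * r ^+ 3)) = 3 * (r * u ^+ 2).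
  have -> : N * (3 * (u ^+ 2 * r ^+ 3)) = N * r ^+ 2 * (3 * (r * u ^+ 2)) by ring.
  by rewrite Nr mul1r.
have e2 : (1 + T) * (u ^+ 2 * r ^+ 2) * (\sum_(1 <= j < n.+1) (~~ cellb j)%:R) <= (1 + T) * (del * u ^+ 7).
  have T1 : 0 <= 1 + T by rewrite addr_ge0.
  have h := ler_wpM2l (mulr_ge0 T1 (mulr_ge0 (exprn_ge0 2 (ltW u_gt0)) (ltW r_gt0))) H4.
  have -> : (1 + T) * (u ^+ 2 * r ^+ 2) * (\sum_(1 <= j < n.+1) (~~ cellb j)%:R) =
    (1 + T) * (u ^+ 2 * r) * ((\sum_(1 <= j < n.+1) (~~ cellb j)%:R) * r) by ring.
  apply: (le_trans h).
  have -> : (1 + T) * (u ^+ 2 * r) * (del * u) = (1 + T) * (del * u ^+ 3 * r) by ring.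
  rewrite ler_wpM2l//; apply: le_trans (du_le (_ : (3 <= 7)%N)) => //.
  by rewrite ler_piMr// mulr_ge0 ?exprn_ge0 ?(ltW u_gt0) ?(ltW del_gt0).
have := @rdu 2 isT; rewrite e1 !mulrDl mul1r; lra.
Qed.

Lemma pathwise_bound :
  `|\sum_(1 <= j < n.+1) (wfactor c)^-1 * Num.min `|dX j|
      (Num.sqrt (S j) * nth 0 (0 :: sort <=%O [seq `|(Num.sqrt (S i))^-1 * dX i| | i <- iota 1 n]) (s_ alpha n)) ^+ 2 *
     (`|dX j| <= N `^ (- 4^-1))%R%:R - \sum_(1 <= j < n.+1) I j| <=
  pathwise_const * (del * u ^+ 7).
Proof.
have -> : \sum_(1 <= j < n.+1) (wfactor c)^-1 * Num.min `|dX j|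
      (Num.sqrt (S j) * nth 0 (0 :: sort <=%O [seq `|(Num.sqrt (S i))^-1 * dX i| | i <- iota 1 n]) (s_ alpha n)) ^+ 2 *
     (`|dX j| <= N `^ (- 4^-1))%R%:R = (wfactor c)^-1 * \sum_(1 <= j < n.+1) term j.
  by rewrite mulr_sumr; apply: eq_bigr => j _; rewrite -mulrA.
have e0 : \sum_(1 <= j < n.+1) T * r ^+ 2 * sg j ^+ 2 * (gmin c (Z j) - wfactor c) =
   \sum_(1 <= j < n.+1) ideal j - wfactor c * \sum_(1 <= j < n.+1) T * r ^+ 2 * sg j ^+ 2.
  by rewrite mulr_sumr -sumrB; apply: eq_bigr => j _; rewrite /ideal; ring.
(* Three errors: actual against ideal summands, fluctuation of the winsorized squares about their
   mean, and the Riemann sum for Theta. *)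
have e1 : (wfactor c)^-1 * (\sum_(1 <= j < n.+1) term j) - \sum_(1 <= j < n.+1) I j =
  (wfactor c)^-1 * (\sum_(1 <= j < n.+1) (term j - ideal j)) +
  (wfactor c)^-1 * (\sum_(1 <= j < n.+1) T * r ^+ 2 * sg j ^+ 2 * (gmin c (Z j) - wfactor c)) +
  \sum_(1 <= j < n.+1) (T * r ^+ 2 * sg j ^+ 2 - I j).
  by rewrite e0 !sumrB; field; rewrite gt_eqF.
rewrite e1; apply: (le_trans (ler_normD _ _)).
have h7 : T * r * u ^+ 3 <= T * (del * u ^+ 7).
  by rewrite -mulrA ler_wpM2l// rdu.
have wV : 0 <= (wfactor c)^-1 by rewrite invr_ge0 ltW.
have b1 := ler_wpM2l wV term_sum.
have b2 := ler_wpM2l wV (le_trans H7 h7).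
apply: (@le_trans _ _ ((wfactor c)^-1 * ((win_const + Kw * cell_const + jump_const) * (del * u ^+ 7)) +
   (wfactor c)^-1 * (T * (del * u ^+ 7)) + (4 + T) * (del * u ^+ 7))); last first.
  by rewrite /pathwise_const le_eqVlt; apply/orP; left; apply/eqP; ring.
apply: lerD; last exact: cell_sum.
apply: (le_trans (ler_normD _ _)); apply: lerD.
  by rewrite normrM (ger0_norm wV).
by rewrite normrM (ger0_norm wV).
Qed.

End pathwise.

(** * From probability to moments *)

Section moments.
Context (R : realType) (d : measure_display) (Omega : measurableType d)
  (P : probability Omega R).
Local Notation mu := (@lebesgue_measure R).

(** A Jensen inequality with a worse constant: [integral_itv_le_moment] at half the mean of |f|
    bounds the integral g by g / 2 plus a multiple of the higher moment, and the term g / 2 is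
    absorbed. *)
Lemma Rintegral_itv_moment (f : measurableTypeR R -> R) (T : R) (k : nat) : 0 < T ->
  measurable_fun setT f ->
  (((\int[mu]_(u in `[0, T]) `|f u|) ^+ k.+1)%:E <=
    ((2 * T) ^+ k.+1 / T)%:E * \int[mu]_(u in `[0%R, T]) (`|f u| ^+ k.+1)%:E)%E.
Proof.
move=> T_gt0 mf; have T2 : 0 < 2 * T by rewrite mulr_gt0.
have cT : 0 < (2 * T) ^+ k.+1 / T by rewrite divr_gt0// exprn_gt0.
set H := (\int[mu]_(u in _) (`|f u| ^+ _)%:E)%E.
have H0 : (0 <= H)%E by apply: integral_ge0 => u _; rewrite lee_fin exprn_ge0.
set g := \int[mu]_(u in `[0, T]) `|f u|.
have g0 : 0 <= g by apply: Rintegral_ge0.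
move: g0; rewrite le_eqVlt => /predU1P[<-|g0].
  by rewrite expr0n mule_ge0// lee_fin ltW.
have gE : (g%:E <= \int[mu]_(u in `[0%R, T]) (`|f u|)%:E)%E.
  rewrite /g /Rintegral; set G := (\int[mu]_(u in _) (`|f u|)%:E)%E.
  have : (0 <= G)%E by exact: integral_ge0.
  by case: G => //= ? _; rewrite leey.
pose m := g / (2 * T); have m0 : 0 < m by rewrite divr_gt0.
have := le_trans gE (integral_itv_le_moment k mf T_gt0 m0).
rewrite -/H; case: H H0 => [h||] // h0; last first.
  by move=> _; rewrite gt0_muley ?lte_fin// leey.
rewrite -!EFinM -EFinD !lee_fin subr0 => gh.
have mT : m * T = g / 2 by rewrite /m; field; rewrite gt_eqF.
have h1 : g / 2 <= m ^- k * h by lra.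
have -> : g ^+ k.+1 = (2 * T) ^+ k.+1 / T * (g / 2 * m ^+ k).
  have -> : g = 2 * T * m by rewrite /m; field; rewrite gt_eqF.
  rewrite (exprMn _ (2 * T)) (exprS m); move: ((2 * T) ^+ k.+1) (m ^+ k) => A B.
  by field; rewrite gt_eqF.
rewrite ler_pM2l//; apply: le_trans (ler_wpM2r (exprn_ge0 k (ltW m0)) h1) _.
by rewrite mulrAC mulVf ?mul1r// expf_neq0// gt_eqF.
Qed.

End moments.

Section bigO.
Context (R : realType) (d : measure_display) (Omega : measurableType d)
  (P : probability Omega R).

Lemma powR_le_expnD1 (x p : R) : 0 <= x -> 0 <= p -> x `^ p <= 1 + x ^+ (Num.truncn p).+1.
Proof.
move=> x0 p0; have [x1|x1] := leP x 1.
  apply: (@le_trans _ _ 1); last by rewrite lerDl exprn_ge0.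
  by have := @ge0_ler_powR R p p0 x 1; rewrite powR1; apply; rewrite ?nnegrE.
apply: ler_wpDl => //; rewrite -powR_mulrn//.
by rewrite ler_powR ?(ltW x1)// ltW// truncnS_gt.
Qed.

(* On the exceptional event [|Y|^K <= n^-M |Y|^2K + n^M], and the probability of the
   event beats n^M. *)
Lemma Lpnorm_bigO (Y : nat -> Omega -> R) (beta p C0 : R) : 1 < p ->
  small P (fun n => [set o | ~ `|Y n o| <= C0 * n%:R `^ (- beta)]) ->
  (forall k : nat, (0 < k)%N -> exists a C : R, \forall n \near \oo, exists E : Omega -> \bar R,
     [/\ measurable_fun setT E, forall o, ((`|Y n o| ^+ k)%:E <= E o)%E &
       (\int[P]_o E o <= (C * n%:R `^ a)%:E)%E]) ->
  bigO_pow (fun n => Lpnorm P p (Y n)) (- beta).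
Proof.
move=> p1 sY env; have p0 : 0 < p by exact: lt_trans p1.
pose K := (Num.truncn p).+1.
have [a [C hE]] := env (2 * K)%N isT.
(* Large enough that both n^(a - M) and n^(-M) are at most n^(-beta p). *)
pose M := (Num.truncn (`|a| + `|beta * p|)).+1.
have Mle : `|a| + `|beta * p| <= M%:R by apply/ltW/truncnS_gt.
have [C1 hA] := sY (2 * M)%N.
pose D := `|C0| `^ p + `|C| + 2 * `|C1|.
have D0 : 0 <= D by rewrite !addr_ge0 ?mulr_ge0 ?powR_ge0.
exists (D `^ p^-1); near=> n.
have n0 : (0 < n)%N by near: n; exact: nbhs_infty_gt.
have [A [mA BA PA]] : covered P [set o | ~ `|Y n o| <= C0 * n%:R `^ (- beta)] (C1 * n%:R `^ (- (2 * M)%:R)).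
  by near: n; exact: hA.
have [E [mE YE iE]] : exists E : Omega -> \bar R,
     [/\ measurable_fun setT E, forall o, ((`|Y n o| ^+ (2 * K))%:E <= E o)%E &
       (\int[P]_o E o <= (C * n%:R `^ a)%:E)%E] by near: n; exact: hE.
have E0 o : (0 <= E o)%E by apply: le_trans (YE o); rewrite lee_fin exprn_ge0.
apply: Lpnorm_le => //; first by rewrite mulr_ge0 ?powR_ge0.
have -> : (D `^ p^-1 * n%:R `^ (- beta)) `^ p = D * n%:R `^ (- (beta * p)).
  by rewrite powRM ?powR_ge0// -!powRrM mulVf ?gt_eqF// powRr1// mulNr.
pose g0 := `|C0| `^ p * n%:R `^ (- (beta * p)).
have g00 : 0 <= g0 by rewrite mulr_ge0 ?powR_ge0.
pose m := n%:R `^ (- M%:R) : R.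
have m0 : 0 < m by exact: powRn_gt0.
have m1 : 1 <= m^-1 by rewrite /m -powRN opprK (le_trans _ (powRn_le n0 (_ : 0 <= _)))// powRr0.
apply: (@le_trans _ _ (\int[P]_o (g0%:E + m%:E * E o + (2 * m^-1)%:E * (\1_A o)%:E)%E)%E).
  apply: ge0_le_integral_pointwise => o; first by rewrite lee_fin powR_ge0.
  have [Yo|nYo] := boolP (`|Y n o| <= C0 * n%:R `^ (- beta)).
    apply: (@le_trans _ _ g0%:E); last first.
      by rewrite -addeA leeDl// adde_ge0// mule_ge0// ?lee_fin ?(ltW m0)// mulr_ge0// ltW// invr_gt0.
    rewrite lee_fin /g0.
    have -> : `|C0| `^ p * n%:R `^ (- (beta * p)) = (`|C0| * n%:R `^ (- beta)) `^ p.
      by rewrite powRM ?powR_ge0// -powRrM mulNr.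
    apply: ge0_ler_powR; rewrite ?nnegrE ?(ltW p0) ?mulr_ge0 ?powR_ge0//.
    by rewrite (le_trans Yo)// ler_wpM2r ?powR_ge0// ler_norm.
  have -> : \1_A o = 1 :> R by rewrite indicE mem_set//; apply: BA; exact/negP.
  apply: (@le_trans _ _ (m%:E * (`|Y n o| ^+ (2 * K))%:E + (2 * m^-1)%:E * 1%:E)%E); last first.
    apply: leeD => //; apply: lee_paddl; first by rewrite lee_fin.
    by apply: lee_wpmul2l; rewrite ?lee_fin ?(ltW m0).
  rewrite -!EFinM -EFinD lee_fin.
  apply: (le_trans (powR_le_expnD1 _ (ltW p0))) => //; rewrite -/K.
  rewrite mulnC exprM mulr1; move: (`|Y n o| ^+ K) (exprn_ge0 K (normr_ge0 (Y n o))) => x x0.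
  have -> : m * x ^+ 2 + 2 * m^-1 = m^-1 * ((m * x) ^+ 2 + 2) by field; rewrite gt_eqF.
  have h : m * x <= (m * x) ^+ 2 + 1.
    by have := sqr_ge0 (m * x - 2^-1); rewrite sqrrB; have := sqr_ge0 (m * x); lra.
  have -> : 1 + x = 1 + m^-1 * (m * x) by rewrite mulKf ?gt_eqF.
  rewrite [leRHS](_ : _ = m^-1 + m^-1 * ((m * x) ^+ 2 + 1)); last by ring.
  by apply: lerD => //; rewrite ler_pM2l ?invr_gt0.
have m2 : 0 <= 2 * m^-1 by rewrite mulr_ge0// ltW// invr_gt0.
rewrite ge0_integralD//=; last 4 first.
- by move=> o _; rewrite adde_ge0 ?mule_ge0 ?lee_fin ?(ltW m0).
- by apply: emeasurable_funD => //; exact: measurable_funeM.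
- by move=> o _; rewrite -EFinM lee_fin mulr_ge0.
- by apply/measurable_funeM/measurable_EFinP/measurable_indic.
rewrite ge0_integralD//=; last 2 first.
- by move=> o _; rewrite mule_ge0// lee_fin ltW.
- exact: measurable_funeM.
rewrite integral_cst//= [P _]probability_setT mule1.
rewrite ge0_integralZl//; last by rewrite lee_fin ltW.
rewrite ge0_integralZl_EFin//; last exact/measurable_EFinP/measurable_indic.
rewrite integral_indic// setIT.
have nb : n%:R `^ (a - M%:R) <= n%:R `^ (- (beta * p)) :> R.
  apply: powRn_le => //; have := ler_norm a; have := ler_norm (beta * p); lra.
have nb' : n%:R `^ (- M%:R) <= n%:R `^ (- (beta * p)) :> R.
  apply: powRn_le => //; have := normr_ge0 a; have := ler_norm (beta * p); lra.
apply: (@le_trans _ _ (g0%:E + m%:E * (`|C| * n%:R `^ a)%:E + (2 * m^-1)%:E * (`|C1| * n%:R `^ (- (2 * M)%:R))%:E)%E).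
  apply: leeD; first apply: leeD => //.
    apply: lee_wpmul2l; first by rewrite lee_fin ltW.
    by apply: (le_trans iE); rewrite lee_fin ler_wpM2r ?powR_ge0// ler_norm.
  apply: lee_wpmul2l; first by rewrite lee_fin mulr_ge0// ltW// invr_gt0.
  by apply: (le_trans PA); rewrite lee_fin ler_wpM2r ?powR_ge0// ler_norm.
rewrite -!EFinM -!EFinD lee_fin /D [leRHS]mulrDl (mulrDl (`|C0| `^ p)) -/g0; apply: lerD; first apply: lerD => //.
  by rewrite mulrCA ler_wpM2l// /m -powRnD// addrC.
have -> : 2 * m^-1 * (`|C1| * n%:R `^ (- (2 * M)%:R)) = 2 * `|C1| * n%:R `^ (- M%:R).
  rewrite (_ : - (2 * M)%:R = - M%:R + - M%:R :> R); last by rewrite natrM; ring.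
  by rewrite powRnD// -/m; field; rewrite gt_eqF.
by rewrite ler_wpM2l// mulr_ge0.
Unshelve. all: by end_near. Qed.

End bigO.

Section envelope.
Context (R : realType) (d : measure_display) (Omega : measurableType d)
  (P : probability Omega R).
Local Notation mu := (@lebesgue_measure R).
Variables (T : R) (T_gt0 : 0 < T) (F : R -> set (set Omega)).
Hypothesis filtF : is_filtration F T.

(** The truncation caps each of the n winsorized squares at n^(-1/2). *)
Lemma WRV_bound (alpha c : R) (alpha01 : 0 < alpha < 1) (cP : is_chi2_quantile alpha c)
    (n : nat) (Sn : nat -> Omega -> R) (X : R -> Omega -> R) o : (0 < n)%N ->
  0 <= WRV T alpha c n Sn X o <= (wfactor c)^-1 * n%:R `^ 2^-1.
Proof.
move=> n0; have wf0 := wfactor_gt0 alpha01 cP.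
have nN : 0 < n%:R :> R by rewrite ltr0n.
have V0 : 0 <= Vord T n Sn X (s_ alpha n) o.
  by apply: order_stat_ge0 => x /mapP[j _ ->]; exact: normr_ge0.
have nr : n%:R * (n%:R `^ (- 2^-1)) ^+ 2 = 1 :> R.
  by rewrite powRn_exp (_ : - 2^-1 * 2%:R = - 1) ?mulNr ?mulVf// powRN powRr1// divff// gt_eqF.
apply/andP; split.
  by apply: sumr_ge0 => j _; rewrite mulr_ge0// mulr_ge0 ?sqr_ge0// invr_ge0 ltW.
apply: (@le_trans _ _ (\sum_(1 <= j < n.+1) (wfactor c)^-1 * n%:R `^ (- 2^-1))).
  apply: ler_sum => j _; rewrite -mulrA ler_pM2l ?invr_gt0//.
  by apply: (winsorized_le _ n0 (powRn_gt0 _ n0) nr); rewrite mulr_ge0// sqrtr_ge0.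
rewrite sumr_const_nat subSS subn0 -mulrnAr ler_pM2l ?invr_gt0// -mulr_natl.
rewrite -[X in X * _](powRr1 (ler0n R n)) -powRnD// powRn_le//.
by lra.
Qed.

Lemma exprD_le2 (k : nat) (x y : R) : 0 <= x -> 0 <= y ->
  (x + y) ^+ k <= 2 ^+ k * (x ^+ k + y ^+ k).
Proof.
move=> x0 y0; wlog xy : x y x0 y0 / x <= y.
  move=> wl; have [|/ltW yx] := leP x y; first exact: wl.
  by rewrite addrC [X in _ * X]addrC; exact: wl.
apply: (@le_trans _ _ ((2 * y) ^+ k)).
  by rewrite lerXn2r ?nnegrE ?addr_ge0 ?mulr_ge0//; lra.
by rewrite exprMn ler_pM2l ?exprn_gt0// lerDr exprn_ge0.
Qed.

Variables (sigma : nat -> R -> Omega -> R).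
Hypothesis sigma_cadlag : forall n, (0 < n)%N -> cadlag_adapted F T (sigma n).

Lemma Theta_clamp n o :
  Theta T (sigma n) o = \int[mu]_(u in `[0, T]) `|sigma n (clamp T u) o ^+ 2|.
Proof.
apply: eq_Rintegral => u; rewrite inE/= in_itv/= => u0T.
by rewrite clamp_id// ger0_norm ?sqr_ge0.
Qed.

(** The majorant combines the deterministic bound on [WRV] with the time integral of |sigma|^(2k),
    measurable by Tonelli's theorem, so the measurability of the order statistics never comes into
    question. *)
Lemma WRV_Theta_envelope (alpha c : R) (S : nat -> nat -> Omega -> R) (X : nat -> R -> Omega -> R)
    (k : nat) (K : R) : 0 < alpha < 1 -> is_chi2_quantile alpha c -> (0 < k)%N ->
  (forall n t, (0 < n)%N -> 0 <= t <= T -> (\int[P]_o (`|sigma n t o| ^+ (2 * k))%:E <= (K ^+ (2 * k))%:E)%E) ->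
  exists a C : R, \forall n \near \oo, exists E : Omega -> \bar R,
     [/\ measurable_fun setT E,
       forall o, ((`|WRV T alpha c n (S n) (X n) o - Theta T (sigma n) o| ^+ k)%:E <= E o)%E &
       (\int[P]_o E o <= (C * n%:R `^ a)%:E)%E].
Proof.
move=> alpha01 cP k0 hK; have wf0 := wfactor_gt0 alpha01 cP.
pose D := (wfactor c)^-1; have D0 : 0 < D by rewrite invr_gt0.
pose cT := (2 * T) ^+ k / T.
have cT0 : 0 < cT by rewrite divr_gt0// exprn_gt0// mulr_gt0.
pose K2 := K ^+ (2 * k).
exists (2^-1 * k%:R), (2 ^+ k * (D ^+ k + cT * (T * `|K2|))); near=> n.
have n0 : (0 < n)%N by near: n; exact: nbhs_infty_gt.
pose H o := (\int[mu]_(u in `[0%R, T]) (`|sigma n (clamp T u) o ^+ 2| ^+ k)%:E)%E.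
have H0 o : (0 <= H o)%E by apply: integral_ge0 => u _; rewrite lee_fin exprn_ge0.
have ms : measurable_fun setT (fun z : measurableTypeR R * Omega => sigma n (clamp T z.1) z.2 ^+ 2).
  by apply: measurable_funX; apply: (measurable_clamped T_gt0 filtF); exact: sigma_cadlag.
have msk : measurable_fun setT (fun z : measurableTypeR R * Omega => (`|sigma n (clamp T z.1) z.2 ^+ 2| ^+ k)%:E).
  by apply/measurable_EFinP/measurable_funX/measurableT_comp.
have mH : measurable_fun setT H.
  by apply: (@measurable_time_integral _ _ _ (fun u o => (`|sigma n (clamp T u) o ^+ 2| ^+ k)%:E)) => //.
have iH : (\int[P]_o H o <= (T * `|K2|)%:E)%E.
  have := @expectation_time_integral_le _ _ _ P (fun u o => (`|sigma n (clamp T u) o ^+ 2| ^+ k)%:E) 0 T `|K2| msk.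
  rewrite subr0; apply => //.
  move=> u u0T; rewrite clamp_id//.
  under eq_integral do rewrite normrX -exprM.
  by apply: (le_trans (hK n u n0 u0T)); rewrite lee_fin ler_norm.
exists (fun o => (2 ^+ k)%:E * ((D ^+ k * n%:R `^ (2^-1 * k%:R))%:E + cT%:E * H o))%E; split.
- by apply: measurable_funeM; apply: emeasurable_funD => //; exact: measurable_funeM.
- move=> o; have /andP[W0 W1] := @WRV_bound alpha c alpha01 cP n (S n) (X n) o n0.
  have mo : measurable_fun setT (fun u : measurableTypeR R => sigma n (clamp T u) o ^+ 2).
    exact: (@measurable_section _ _ _ (fun u o => sigma n (clamp T u) o ^+ 2)).
  have hT : ((Theta T (sigma n) o ^+ k)%:E <= cT%:E * H o)%E.
    have := Rintegral_itv_moment k.-1 T_gt0 mo; rewrite prednK//.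
    by rewrite -Theta_clamp.
  have T0 : 0 <= Theta T (sigma n) o by apply: Rintegral_ge0 => u _; exact: sqr_ge0.
  apply: (@le_trans _ _ ((2 ^+ k)%:E * ((D ^+ k * n%:R `^ (2^-1 * k%:R))%:E + (Theta T (sigma n) o ^+ k)%:E))%E); last first.
    by rewrite lee_wpmul2l ?lee_fin ?exprn_ge0// leeD2l.
  rewrite -EFinD -EFinM lee_fin -powRn_exp -exprMn.
  apply: le_trans (exprD_le2 _ _ T0); last by rewrite mulr_ge0 ?powR_ge0// ltW.
  rewrite lerXn2r ?nnegrE ?addr_ge0 ?mulr_ge0 ?powR_ge0 ?(ltW D0)//.
  by apply: (le_trans (ler_normB _ _)); rewrite !ger0_norm// lerD2r.
have q0 : (0 <= (D ^+ k * n%:R `^ (2^-1 * k%:R))%:E)%E.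
  by rewrite lee_fin mulr_ge0 ?powR_ge0// exprn_ge0// ltW.
have q1 o : (0 <= cT%:E * H o)%E by rewrite mule_ge0// lee_fin ltW.
rewrite ge0_integralZl_EFin ?exprn_ge0//; last 2 first.
- by move=> o _; exact: adde_ge0.
- by apply: emeasurable_funD => //; exact: measurable_funeM.
rewrite ge0_integralD//=; last exact: measurable_funeM.
rewrite integral_cst//= [P _]probability_setT mule1 ge0_integralZl_EFin ?(ltW cT0)//.
apply: (@le_trans _ _ ((2 ^+ k)%:E * ((D ^+ k * n%:R `^ (2^-1 * k%:R))%:E + cT%:E * (T * `|K2|)%:E))%E).
  by rewrite lee_wpmul2l ?lee_fin ?exprn_ge0// leeD2l// lee_wpmul2l// lee_fin ltW.
rewrite -(EFinM cT) -(EFinD (D ^+ k * _)) -EFinM lee_fin -(mulrA (2 ^+ k)) ler_pM2l ?exprn_gt0// mulrDl lerD2l.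
have n1 : 1 <= n%:R `^ (2^-1 * k%:R) :> R.
  by rewrite -[leLHS](powRr0 n%:R) powRn_le// mulr_ge0.
by rewrite ler_peMr// mulr_ge0 ?(ltW cT0)// mulr_ge0// ltW.
Unshelve. all: by end_near. Qed.

End envelope.

(** * Properties holding with overwhelming probability *)

Section overwhelming.
Context d (Omega : measurableType d) (R : realType) (P : probability Omega R).
Implicit Types (Q : nat -> Omega -> Prop).

Definition whp Q := small P (fun n => [set o | ~ Q n o]).

Lemma whp_and Q Q' : whp Q -> whp Q' -> whp (fun n o => Q n o /\ Q' n o).
Proof.
move=> hQ hQ'; apply: smallS (smallU hQ hQ'); apply: nearW => n o /= nQ.
by have [q|] := pselect (Q n o); [right => q'; exact: nQ|left].
Qed.

Lemma whp_all (B : nat -> nat -> set Omega) : usmall P B ->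
  whp (fun n o => forall j, (1 <= j <= n)%N -> ~ B n j o).
Proof.
move=> uB; apply: smallS (usmall_small uB); apply: nearW => n o /= nB.
apply: contrapT => h; apply: nB => j jn Bo; apply: h; by exists j.
Qed.

Lemma whp_mono Q Q' : (\forall n \near \oo, forall o, Q n o -> Q' n o) -> whp Q -> whp Q'.
Proof.
move=> QQ; apply: smallS; near=> n.
have h : forall o, Q n o -> Q' n o by near: n; exact: QQ.
by move=> o /= nq q; apply: nq; exact: h.
Unshelve. all: by end_near. Qed.

Lemma whp_small (B : nat -> set Omega) : small P B -> whp (fun n o => ~ B n o).
Proof.
by apply: smallS; apply: nearW => n o /= /contrapT.
Qed.

End overwhelming.

Section limit_theorems.
Context (R : realType) (d : measure_display) (Omega : measurableType d)
  (P : probability Omega R).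
Variables (T : R) (T_gt0 : 0 < T) (F : R -> set (set Omega)).
Hypothesis filtF : is_filtration F T.
Variable w : R -> Omega -> R.
Hypothesis wienerw : wiener P F T w.
Variables (e : R) (e_gt0 : 0 < e).
Local Notation tl n j := (tgrid T n j.-1).
Local Notation tr n j := (tgrid T n j).
Local Notation Z n j o := (winc w (tl n j) (tr n j) o).

(** Azuma's inequality with weight 1 and a centred indicator. The level may vary with n, as the
    levels q + tau and q - tau do; since only these two matter, no uniformity over levels is
    sought. *)
Lemma whp_count (x : nat -> R) : whp P (fun n o =>
  `|\sum_(1 <= j < n.+1) (`|Z n j o| <= x n)%R%:R - n%:R * pabs (x n)| * n%:R `^ (- 2^-1) <= n%:R `^ e).
Proof.
pose g n (z : R) : R := \1_(absball (x n)) z - pabs (x n).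
have h := @small_azuma _ _ _ P T T_gt0 F filtF w wienerw (fun _ _ _ => 1) g (fun=> 1) 1 e e_gt0 ltr01.
apply: whp_mono (whp_small (h _ _ _ _ _ _)); last 6 first.
- by move=> n _; exact: ltr01.
- by move=> n i o _; rewrite normr1.
- by move=> n i _; exact: measurable_cst.
- move=> n; apply: measurable_funB => //; apply: measurable_indic; exact: measurable_absball.
- move=> n z; rewrite /g indicE ler_norml; have /andP[p0 p1] := pabs_le1 (x n).
  by case: (z \in _) => /=; apply/andP; split; lra.
- by move=> n; exact: integral_absball_centered.
near=> n; move=> o /= nh; rewrite leNgt; apply/negP => hn; apply: nh.
have n0 : (0 < n)%N by near: n; exact: nbhs_infty_gt.
have r0 : 0 < n%:R `^ (- 2^-1) :> R by exact: powRn_gt0.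
rewrite mul1r -(ler_pM2r r0) -powRnD// addrAC subrr add0r; apply: le_trans (ltW hn) _.
rewrite le_eqVlt; apply/orP; left; apply/eqP; congr (`|_| * _).
have -> : n%:R * pabs (x n) = \sum_(i < n) pabs (x n) by rewrite sumr_const card_ord mulr_natl.
rewrite big_add1 big_mkord /= -sumrB.
by apply: eq_bigr => i _; rewrite /g indicE !mul1r /absball; congr (_%:R - _); rewrite mem_setE.
Unshelve. all: by end_near. Qed.

Variables (sigma : nat -> R -> Omega -> R).
Hypothesis sigma_cadlag : forall n, (0 < n)%N -> cadlag_adapted F T (sigma n).
Variables (alpha c : R).
Hypotheses (alpha01 : 0 < alpha < 1) (cP : is_chi2_quantile alpha c).

(** Azuma's inequality requires bounded weights, so sigma^2 is capped at n^(2e), which keeps it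
    known at the left end of the cell. The premise inside the event says that the cap is
    inactive. *)
Lemma whp_weighted_sum : whp P (fun n o =>
  (forall j, (1 <= j <= n)%N -> `|sigma n (tl n j) o| <= n%:R `^ e) ->
  `|\sum_(1 <= j < n.+1) T * (n%:R `^ (- 2^-1)) ^+ 2 * sigma n (tl n j) o ^+ 2 *
      (gmin c (Z n j o) - wfactor c)| <= T * n%:R `^ (- 2^-1) * n%:R `^ e ^+ 3).
Proof.
have c0 := quantile_gt0 alpha01 cP; have w0 := wfactor_gt0 alpha01 cP.
pose a n i o := Num.min (sigma n (tgrid T n i) o ^+ 2) (n%:R `^ e ^+ 2).
pose g (n : nat) (z : R) := gmin c z - wfactor c.
have B0 : 0 < c + wfactor c by exact: addr_gt0.
have h := @small_azuma _ _ _ P T T_gt0 F filtF w wienerw a g (fun n => n%:R `^ e ^+ 2) (c + wfactor c) e e_gt0 B0.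
apply: whp_mono (whp_small (h _ _ _ _ _ _)); last 6 first.
- by move=> n n0; rewrite exprn_gt0// powRn_gt0.
- by move=> n i o _; rewrite /a ger0_norm ?le_min ?sqr_ge0// ge_min lexx orbT.
- move=> n i ni; have n0 : (0 < n)%N by exact: leq_trans ni.
  have i0T := tgrid_itv T_gt0 (ltnW ni); have [as_ _] := sigma_cadlag n0.
  have ms : Fmeas F (tgrid T n i) (sigma n (tgrid T n i)) by apply/(FmeasP filtF) => //; exact: as_.
  by apply: measurable_minr; [exact: measurable_funX|exact: measurable_cst].
- by move=> n; apply: measurable_funB => //; exact: measurable_gmin.
- move=> n z; rewrite /g ler_norml; have := gmin_ge0 alpha01 cP z; have := gmin_le c z => ? ?.
  by apply/andP; split; lra.
- by move=> n; exact: (integral_gmin_centered alpha01 cP).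
near=> n; move=> o /= nh hs; rewrite leNgt; apply/negP => hn; apply: nh.
have n0 : (0 < n)%N by near: n; exact: nbhs_infty_gt.
have r0 : 0 < n%:R `^ (- 2^-1) :> R by exact: powRn_gt0.
have Tr : 0 < T * (n%:R `^ (- 2^-1)) ^+ 2 by rewrite mulr_gt0// exprn_gt0.
rewrite -(ler_pM2l Tr); apply: (@le_trans _ _ (T * n%:R `^ (- 2^-1) * n%:R `^ e ^+ 3)).
  rewrite le_eqVlt; apply/orP; left; apply/eqP.
  have -> : n%:R `^ (2^-1 + e) = n%:R `^ e / n%:R `^ (- 2^-1) :> R by rewrite powRnD// powRN invrK mulrC.
  by field; rewrite gt_eqF.
apply: (le_trans (ltW hn)); rewrite le_eqVlt; apply/orP; left; apply/eqP.
rewrite -[X in _ = X * _](gtr0_norm Tr) -normrM; congr `|_|.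
rewrite mulr_sumr big_add1 big_mkord /=; apply: eq_bigr => i _.
rewrite /a (min_idPl _) /g ?mulrA// -real_normK ?num_real// lerXn2r ?nnegrE ?powR_ge0//.
by apply: (hs i.+1); rewrite ltn_ord.
Unshelve. all: by end_near. Qed.

End limit_theorems.

(** * The error bound *)

Lemma near_powRn_small {R : realType} (e C x : R) : 0 < e -> 0 < x ->
  \forall n \near \oo, C * n%:R `^ (- e) <= x.
Proof.
move=> e0 x0; have h := near_powRn_ge (C / x) e0; near=> n.
have n0 : (0 < n)%N by near: n; exact: nbhs_infty_gt.
rewrite powRN ler_pdivrMr ?powRn_gt0// mulrC -ler_pdivrMr//.
by near: n.
Unshelve. all: by end_near. Qed.

Section error.
Context (R : realType) (d : measure_display) (Omega : measurableType d)
  (P : probability Omega R).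
Local Notation mu := (@lebesgue_measure R).
Variables (T : R) (T_gt0 : 0 < T) (F : R -> set (set Omega)).
Hypothesis filtF : is_filtration F T.
Variable w : R -> Omega -> R.
Hypothesis wienerw : wiener P F T w.
Variables (X0 : Omega -> R) (b : R -> Omega -> R).
Hypothesis b_cadlag : cadlag_adapted F T b.
Variables (J sigma X : nat -> R -> Omega -> R).
Hypothesis J_active : forall n, (0 < n)%N -> finitely_active_jump_process P F T (J n).
Hypothesis sigma_cadlag : forall n, (0 < n)%N -> cadlag_adapted F T (sigma n).
Hypothesis sigma_active : forall n, (0 < n)%N ->
    {ae P, forall omega, (jump_count (sigma n ^~ omega) `]0%R, T] < +oo)%E}.
Variable sigmat : R -> Omega -> R.
Hypothesis sigmat_adapted : adapted F T sigmat.
Hypothesis sigmatE : forall n, (0 < n)%N -> {ae P, forall omega,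
    forall t, 0 <= t <= T ->
      sigmat t omega = sigma n t omega - jump_part (sigma n ^~ omega) t}.
Hypothesis X_semimart : forall n, (0 < n)%N ->
    ito_semimartingale P F T w X0 b (sigma n) (J n) (X n).
Variable kappa : nat -> nat.
Hypothesis kappa_le : forall n, (0 < n)%N -> ((kappa n).*2.+1 <= n)%N.
Variable S : nat -> nat -> Omega -> R.
Hypothesis mS : forall n j, (1 <= j <= n)%N -> measurable_fun setT (S n j.-1).
Variables (alpha calpha : R).
Hypotheses (alpha01 : 0 < alpha < 1) (calphaP : is_chi2_quantile alpha calpha).
Hypothesis sigma_bounded : forall p : R, 1 < p -> exists C : R,
    forall n t, (0 < n)%N -> 0 <= t <= T ->
      (Lpnorm P p (sigma n t) <= C%:E)%E.
Hypothesis sigmat_holder : forall p : R, 1 < p -> exists C : R,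
    forall s t, 0 <= s <= T -> 0 <= t <= T ->
      (Lpnorm P p (fun omega => sigmat t omega - sigmat s omega)%R
        <= (C * `|t - s| `^ 2^-1)%:E)%E.
Hypothesis b_bounded : forall p : R, 1 < p -> exists C : R,
    forall t, 0 <= t <= T -> (Lpnorm P p (b t) <= C%:E)%E.
Hypothesis S_gt0 : forall n j, (1 <= j <= n)%N ->
    {ae P, forall omega, 0 < S n j.-1 omega}.
Hypothesis SV_bounded : forall p : R, 1 < p -> exists C : R,
    forall n j, (1 <= j <= n)%N ->
      (Lpnorm P p (fun omega => (S n j.-1 omega)^-1)%R <= C%:E)%E.
Variables (gamma0 c : R).
Hypotheses (gamma0_gt0 : 0 < gamma0) (c_gt0 : 0 < c).
Hypothesis S_approx : forall p : R, 1 < p -> exists C : R,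
    forall n j, (1 <= j <= n)%N ->
      ((n%:R `^ gamma0)%:E *
       Lpnorm P p (fun omega =>
         (j \notin calL T (kappa n) n (J n) (sigma n) omega)%:R *
         (sigma n (tgrid T n j.-1) omega ^+ 2 - c * S n j.-1 omega))%R
       <= C%:E)%E.
Variables (xi beta0 : R).
Hypothesis xi_ge0 : 0 <= xi.
Hypothesis frakL_bigO : forall p : R, 1 < p ->
    bigO_pow (fun n => Lpnorm P p (fun omega =>
      (size (frakL T n (J n) (sigma n) omega))%:R%R)) xi.
Hypothesis xi_lt : xi < 2^-1.
Hypothesis beta0_lt : beta0 < Num.min gamma0 (2^-1 - xi).
Hypothesis kappa_bigO : bigO_pow (fun n => (kappa n)%:R%:E) (2^-1 : R).

Local Notation tl n j := (tgrid T n j.-1).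
Local Notation tr n j := (tgrid T n j).
Local Notation Z n j o := (winc w (tl n j) (tr n j) o).

(** Each random hypothesis of [pathwise_bound] holds with overwhelming probability; on their
    intersection the deterministic estimate applies for all large n. *)
Lemma whp_error : exists C, whp P (fun n o =>
  `|WRV T alpha calpha n (S n) (X n) o - Theta T (sigma n) o| <= C * n%:R `^ (- beta0)).
Proof.
pose beta := Num.min gamma0 (2^-1 - xi).
have beta_gt0 : 0 < beta by rewrite lt_min gamma0_gt0 subr_gt0.
have beta_gamma : beta <= gamma0 by rewrite ge_min lexx.
have beta_xi : beta <= 2^-1 - xi by rewrite ge_min lexx orbT.
(* 8 e <= beta - beta0 absorbs the factor u^7 of [pathwise_bound]. 8 e <= beta makes del u^4 vanish
   and, as beta <= 1/2, keeps 2 e below 1/4 for the truncation. *)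
pose e := Num.min (beta - beta0) beta / 8.
have e_gt0 : 0 < e by rewrite divr_gt0// lt_min subr_gt0 beta_gt0 andbT.
have e_beta : 8 * e <= beta by rewrite /e mulrC divfK// ge_min lexx orbT.
have e_beta0 : 8 * e <= beta - beta0 by rewrite /e mulrC divfK// ge_min lexx.
clearbody e beta.
have e4 : 0 < 4^-1 - 2 * e.
  have : beta <= 2^-1 by apply: (le_trans beta_xi); rewrite gerBl.
  lra.
have J_cadlag n : (0 < n)%N -> cadlag_adapted F T (J n) by move=> /J_active[].
have q_gt0 : 0 < Num.sqrt calpha by rewrite sqrtr_gt0 (quantile_gt0 alpha01 calphaP).
have q1_ge0 : 0 <= Num.sqrt calpha + 1 by rewrite addr_ge0// ltW.
have [dens dens_gt0 densP] := pabs_lower_density q1_ge0.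
have [Ck hCk] := kappa_bigO.
(* Bounds 4 kappa + 1 by Kw n^(1/2) when kappa <= Ck n^(1/2). *)
pose Kw := 4 * `|Ck| + 1.
have Kw_ge0 : 0 <= Kw by rewrite addr_ge0// mulr_ge0.
pose del n : R := n%:R `^ (- beta).
pose u n : R := n%:R `^ e.
pose r n : R := n%:R `^ (- 2^-1).
pose tau n := tau_const dens Kw * (del n * u n ^+ 4).
have [Ks hKs] := sigma_moments sigma_bounded (isT : (1 < 2)%N).
have [Kb hKb] := b_moments b_bounded (isT : (1 < 2)%N).
have w1 := whp_all (usmall_sigma T_gt0 filtF sigma_cadlag sigma_bounded e_gt0).
have w2 := whp_all (usmall_S_lower mS S_gt0 SV_bounded e_gt0).
have w3 := whp_all (usmall_S_approx T_gt0 filtF J_active sigma_cadlag kappa_le mS S_approx e_gt0).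
have w4 := whp_small (small_jump_cells T_gt0 filtF J_active sigma_cadlag sigma_active frakL_bigO e_gt0).
have w5 := whp_all (usmall_winc T_gt0 filtF wienerw e_gt0).
have w6 := whp_all (usmall_remainder T_gt0 filtF wienerw b_cadlag J_active sigma_cadlag X_semimart
  hKs hKb (fun e => @usmall_int_sigma_incr2 _ _ _ P T T_gt0 F filtF J sigma J_cadlag sigma_cadlag
     sigmat sigmat_adapted sigmatE sigmat_holder e)
  (fun e => @usmall_int_b _ _ _ P T T_gt0 F filtF b b_cadlag b_bounded e) e_gt0).
have w7 := whp_weighted_sum T_gt0 filtF wienerw e_gt0 sigma_cadlag alpha01 calphaP.
have w8 := whp_count T_gt0 filtF wienerw e_gt0 (fun n => Num.sqrt calpha + tau n).
have w8' := whp_count T_gt0 filtF wienerw e_gt0 (fun n => Num.sqrt calpha - tau n).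
have w9 := whp_all (usmall_int_sigma2 T_gt0 filtF sigma_cadlag sigma_bounded e_gt0).
have w10 := whp_all (usmall_int_sigma_incr T_gt0 filtF J_cadlag sigma_cadlag sigmat_adapted sigmatE sigmat_holder e_gt0).
have w11 := whp_all (usmall_int_sigma_incr2 T_gt0 filtF J_cadlag sigma_cadlag sigmat_adapted sigmatE sigmat_holder e_gt0).
have b4 : 0 < beta - 4 * e by lra.
exists `|pathwise_const T calpha c dens Kw|.
apply: whp_mono (whp_and (whp_and (whp_and w1 w2) (whp_and w3 w4))
  (whp_and (whp_and (whp_and w5 w6) (whp_and w7 w8)) (whp_and (whp_and w8' w9) (whp_and w10 w11)))).
near=> n; move=> o [[[g1 g2] [g3 g4]] [[[g5 g6] [g7 g8]] [[g8' g9] [g10 g11]]]].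
have n0 : (0 < n)%N by near: n; exact: nbhs_infty_gt.
have nN : 0 < n%:R :> R by rewrite ltr0n.
have r_gt0 : 0 < r n by exact: powRn_gt0.
have u_gt0 : 0 < u n by exact: powRn_gt0.
have del_gt0 : 0 < del n by exact: powRn_gt0.
have r_le1 : r n <= 1 by rewrite -[leRHS](powRr0 n%:R) powRn_le// oppr_le0.
have u_ge1 : 1 <= u n by rewrite -[leLHS](powRr0 n%:R) powRn_le// ltW.
have r_del : r n <= del n by rewrite powRn_le// lerN2 (le_trans beta_xi)// gerBl.
have r2E : r n ^+ 2 = n%:R `^ (- 1) by rewrite powRn_exp; congr (_ `^ _); field.
have Nr : n%:R * r n ^+ 2 = 1 by rewrite r2E powRN powRr1// divff// gt_eqF.
have TrE : T / n%:R = T * r n ^+ 2 by rewrite r2E powRN powRr1.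
have du4 : del n * u n ^+ 4 = n%:R `^ (- (beta - 4 * e)).
  by rewrite powRn_exp -powRnD//; congr (_ `^ _); ring.
pose cellb j := `[<cell_nojump T J sigma n j o>].
pose winb j := `[<window_nojump T J sigma kappa n j o>].
pose f u := `|sigma n (clamp T u) o ^+ 2|.
pose I j := \int[mu]_(u in `[tl n j, tr n j]) f u.
have mf : measurable_fun setT (f : measurableTypeR R -> R).
  apply: measurableT_comp => //; apply: measurable_funX.
  apply: (@measurable_section _ _ _ (fun u o => sigma n (clamp T u) o)).
  by apply: (measurable_clamped T_gt0 filtF); exact: sigma_cadlag.
have f0 x : 0 <= f x by exact: normr_ge0.
have g9' j : (1 <= j <= n)%N -> (\int[mu]_(x in `[tl n j, tr n j]) (f x)%:E <= (u n * r n ^+ 2)%:E)%E.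
  move=> jn; have /contrapT h := g9 j jn; rewrite r2E -powRnD//; exact: h.
have ThetaE : Theta T (sigma n) o = \sum_(1 <= j < n.+1) I j.
  rewrite Theta_clamp; apply: (Rintegral_cells T_gt0 n0 mf f0) => j jn.
  by apply: le_lt_trans (g9' j jn) _; exact: ltry.
rewrite ThetaE; apply: (@le_trans _ _ (pathwise_const T calpha c dens Kw * (del n * u n ^+ 7))); last first.
  apply: (@le_trans _ _ (`|pathwise_const T calpha c dens Kw| * (del n * u n ^+ 7))).
    by rewrite ler_wpM2r ?ler_norm// mulr_ge0 ?exprn_ge0// ltW.
  rewrite ler_wpM2l// powRn_exp -powRnD// powRn_le//; lra.
rewrite /WRV /K_ /Vord.
apply: (@pathwise_bound R n n0 T alpha calpha c dens (fun j => incr T n (X n) j o) (fun j => Z n j o)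
  (fun j => sigma n (tl n j) o) (fun j => S n j.-1 o) I cellb winb (r n) (u n) (del n) Kw) => //.
- move=> j jn /asboolP h; apply/asboolP; exact: (window_nojump_own_cell T_gt0 kappa_le).
- by move=> j jn; have /negP := g1 j jn; rewrite -ltNge => /ltW.
- by move=> j jn; have /negP := g2 j jn; rewrite -ltNge powRN => /ltW.
- move=> j jn /asboolP wj; rewrite leNgt; apply/negP => h; apply: (g3 j jn); split => //.
  apply: le_trans (ltW h); rewrite -powRnD// powRn_le//; lra.
(* Here beta <= 1/2 - xi enters: n^(xi + e) cells with jumps, weighted by n^(-1/2), stay below del
   u. *)
- have /negP := g4; rewrite -ltNge => h; rewrite -[X in X * _]/(jump_cells T J sigma n o).
  apply: (@le_trans _ _ (n%:R `^ (xi + e) * r n)).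
    by rewrite ler_pM2r// ltW.
  rewrite -!powRnD// powRn_le//; lra.
- have /negP := g4; rewrite -ltNge => h.
  rewrite -[X in X * _]/(jump_windows T J sigma kappa n o).
  have kn : (kappa n)%:R <= Ck * n%:R `^ 2^-1.
    by rewrite -lee_fin; near: n.
  have hk : ((kappa n).*2.*2.+1)%:R <= Kw * n%:R `^ 2^-1.
    have : Ck * n%:R `^ 2^-1 <= `|Ck| * n%:R `^ 2^-1 by rewrite ler_wpM2r ?powR_ge0// ler_norm.
    have : 1 <= n%:R `^ 2^-1 :> R by rewrite -[leLHS](powRr0 n%:R) powRn_le.
    have -> : ((kappa n).*2.*2.+1)%:R = 4 * (kappa n)%:R + 1 :> R.
      by rewrite -!mul2n mulnA -addn1 natrD natrM.
    rewrite /Kw mulrDl mul1r; lra.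
  apply: (@le_trans _ _ (Kw * n%:R `^ 2^-1 * n%:R `^ (xi + e) * r n ^+ 2)).
    rewrite ler_pM2r ?exprn_gt0//.
    apply: le_trans (jump_windows_le T_gt0 J sigma kappa_le o n0) _.
    apply: ler_pM => //; last exact: ltW.
    by apply: sumr_ge0.
  rewrite -!mulrA ler_wpM2l// r2E -!powRnD// powRn_le//; lra.
- by move=> j jn; have /negP := g5 j jn; rewrite -ltNge => /ltW.
- move=> j jn /asboolP cj; rewrite leNgt; apply/negP => h; apply: (g6 j jn); split => //.
  have [s0 st tT] := tgrid_cell T_gt0 jn.
  rewrite (wincE _ _ st) tgrid_pred; last by case/andP: jn.
  rewrite TrE sqrtrM ?(ltW T_gt0)// sqrtr_sqr (gtr0_norm r_gt0).
  by apply: le_trans (ltW h); rewrite r2E -powRnD.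
- by apply: g7 => j jn; have /negP := g1 j jn; rewrite -ltNge => /ltW.
- move=> j jn /asboolP cj.
  rewrite -TrE; apply: (Rintegral_cell_diff T_gt0 mf f0 jn).
    by apply: le_lt_trans (g9' j jn) _; exact: ltry.
  have m1 : measurable_fun setT (fun x : measurableTypeR R => `|sigma n (clamp T x) o - sigma n (tl n j) o|).
    apply: measurableT_comp => //; apply: measurable_funB => //.
    apply: (@measurable_section _ _ _ (fun u o => sigma n (clamp T u) o)).
    by apply: (measurable_clamped T_gt0 filtF); exact: sigma_cadlag.
  have u0 : 0 <= 2 * u n by rewrite mulr_ge0// ltW.
  have sj : `|sigma n (tl n j) o| <= u n by have /negP := g1 j jn; rewrite -ltNge => /ltW.
  (* From y^2 - s^2 = (y - s)^2 + 2 s (y - s) with |s| <= u: the square term contributes at most u^2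
     r^3 and the cross term twice that, hence the constant 3. *)
  apply: (@le_trans _ _ (\int[mu]_(x in `[tl n j, tr n j]) ((`|(sigma n (clamp T x) o - sigma n (tl n j) o) ^+ 2|)%:E
     + (2 * u n)%:E * (`|sigma n (clamp T x) o - sigma n (tl n j) o|)%:E))%E).
    apply: ge0_le_integral_in => x _; first by rewrite lee_fin.
    rewrite -EFinM -EFinD lee_fin /f [`|sigma n (clamp T x) o ^+ 2|]ger0_norm ?sqr_ge0//.
    move: (sigma n (clamp T x) o) (sigma n (tl n j) o) sj => y s ys.
    have -> : y ^+ 2 - s ^+ 2 = (y - s) ^+ 2 + 2 * s * (y - s) by ring.
    apply: le_trans (ler_normD _ _) _; rewrite lerD2l normrM ler_wpM2r//.
    by rewrite normrM ger0_norm// ler_wpM2l.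
  have m2 : measurable_fun setT (fun x : measurableTypeR R => `|(sigma n (clamp T x) o - sigma n (tl n j) o) ^+ 2|).
    by under eq_fun do rewrite normrX; exact: measurable_funX.
  rewrite ge0_integralD//=; last 3 first.
  - by apply/measurable_EFinP/measurable_funTS.
  - by move=> x _; rewrite -EFinM lee_fin mulr_ge0.
  - by apply: measurable_funeM; apply/measurable_EFinP/measurable_funTS.
  rewrite ge0_integralZl_EFin//; last by apply/measurable_EFinP/measurable_funTS.
  have i1 := contrapT (fun h => g10 j jn (conj cj h)).
  have i2 := contrapT (fun h => g11 j jn (conj cj h)).
  apply: (@le_trans _ _ ((n%:R `^ (e - 2))%:E + (2 * u n)%:E * (n%:R `^ (e - 1 - 2^-1))%:E)%E).
    by apply: leeD => //; apply: lee_wpmul2l; rewrite ?lee_fin.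
  rewrite -EFinM -EFinD lee_fin.
  have r3 : r n ^+ 3 = n%:R `^ (- (3 / 2)) by rewrite powRn_exp; congr (_ `^ _); field.
  have -> : n%:R `^ (e - 1 - 2^-1) = u n * r n ^+ 3 :> R.
    by rewrite r3 -powRnD//; congr (_ `^ _); field.
  have -> : n%:R `^ (e - 2) = u n * r n ^+ 3 * r n :> R.
    by rewrite r3 -!powRnD//; congr (_ `^ _); field.
  have ur3 : 0 <= u n * r n ^+ 3 by rewrite mulr_ge0 ?exprn_ge0// ltW.
  have h1 : u n * r n ^+ 3 * r n <= u n * r n ^+ 3 * u n.
    by rewrite ler_wpM2l// (le_trans r_le1).
  have -> : 3 * (u n ^+ 2 * r n ^+ 3) = u n * r n ^+ 3 * u n + 2 * u n * (u n * r n ^+ 3) by ring.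
  by rewrite lerD2r.
- move=> j jn; apply: (Rintegral_cell_le f0); last exact: g9'.
  by rewrite mulr_ge0 ?sqr_ge0// ltW.
(* The conditions tau <= 1, tau <= q and eta <= 1 hold for large n because del u^4 = n^(-(beta - 4
   e)) tends to 0. *)
- rewrite du4; near: n; exact: near_powRn_small.
- rewrite du4; near: n; exact: near_powRn_small.
- rewrite du4; near: n; exact: near_powRn_small.
- have -> : (Num.sqrt T + 1) * (r n * u n ^+ 2) = n%:R `^ (- 4^-1) * ((Num.sqrt T + 1) * n%:R `^ (- (4^-1 - 2 * e))).
    rewrite [RHS]mulrCA /r /u powRn_exp; by congr (_ * _); rewrite -!powRnD//; congr (_ `^ _); field.
  rewrite ler_piMr ?powR_ge0//; near: n; exact: near_powRn_small.
Unshelve. all: by end_near. Qed.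

End error.

Theorem theorem4p12
  (R : realType) (d : measure_display) (Omega : measurableType d)
  (P : probability Omega R) (T : R) (T_gt0 : 0 < T)
  (F : R -> set (set Omega)) (filtF : is_filtration F T)
  (w : R -> Omega -> R) (wienerw : wiener P F T w)
  (X0 : Omega -> R) (mX0 : measurable_at F 0 X0)
  (b : R -> Omega -> R) (b_cadlag : cadlag_adapted F T b)
  (* processes that depend on n >= 1: J, sigma, X *)
  (J sigma X : nat -> R -> Omega -> R)
  (J_active : forall n, (0 < n)%N -> finitely_active_jump_process P F T (J n))
  (sigma_cadlag : forall n, (0 < n)%N -> cadlag_adapted F T (sigma n))
  (sigma_active : forall n, (0 < n)%N ->
    {ae P, forall omega, (jump_count (sigma n ^~ omega) `]0%R, T] < +oo)%E})
  (* sigma~ = sigma - J^sigma does not depend on n *)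
  (sigmat : R -> Omega -> R) (sigmat_adapted : adapted F T sigmat)
  (sigmatE : forall n, (0 < n)%N -> {ae P, forall omega,
    forall t, 0 <= t <= T ->
      sigmat t omega = sigma n t omega - jump_part (sigma n ^~ omega) t})
  (X_semimart : forall n, (0 < n)%N ->
    ito_semimartingale P F T w X0 b (sigma n) (J n) (X n))
  (kappa : nat -> nat)
  (kappa_le : forall n, (0 < n)%N -> ((kappa n).*2.+1 <= n)%N)
  (S : nat -> nat -> Omega -> R)
  (mS : forall n j, (1 <= j <= n)%N -> measurable_fun setT (S n j.-1))
  (alpha : R) (alpha01 : 0 < alpha < 1)
  (calpha : R) (calphaP : is_chi2_quantile alpha calpha)
  (* (1) *)
  (sigma_bounded : forall p : R, 1 < p -> exists C : R,
    forall n t, (0 < n)%N -> 0 <= t <= T ->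
      (Lpnorm P p (sigma n t) <= C%:E)%E)
  (sigmat_holder : forall p : R, 1 < p -> exists C : R,
    forall s t, 0 <= s <= T -> 0 <= t <= T ->
      (Lpnorm P p (fun omega => sigmat t omega - sigmat s omega)%R
        <= (C * `|t - s| `^ 2^-1)%:E)%E)
  (b_bounded : forall p : R, 1 < p -> exists C : R,
    forall t, 0 <= t <= T -> (Lpnorm P p (b t) <= C%:E)%E)
  (sigma_neq0 : forall n t, (0 < n)%N -> 0 <= t <= T ->
    {ae P, forall omega, sigma n t omega <> 0})
  (sigmaV_bounded : forall p : R, 1 < p -> exists C : R,
    forall n t, (0 < n)%N -> 0 <= t <= T ->
      (Lpnorm P p (fun omega => (sigma n t omega)^-1)%R <= C%:E)%E)
  (* (2) *)
  (S_gt0 : forall n j, (1 <= j <= n)%N ->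
    {ae P, forall omega, 0 < S n j.-1 omega})
  (SV_bounded : forall p : R, 1 < p -> exists C : R,
    forall n j, (1 <= j <= n)%N ->
      (Lpnorm P p (fun omega => (S n j.-1 omega)^-1)%R <= C%:E)%E)
  (gamma0 c : R) (gamma0_gt0 : 0 < gamma0) (c_gt0 : 0 < c)
  (S_approx : forall p : R, 1 < p -> exists C : R,
    forall n j, (1 <= j <= n)%N ->
      ((n%:R `^ gamma0)%:E *
       Lpnorm P p (fun omega =>
         (j \notin calL T (kappa n) n (J n) (sigma n) omega)%:R *
         (sigma n (tgrid T n j.-1) omega ^+ 2 - c * S n j.-1 omega))%R
       <= C%:E)%E)
  (* (3) *)
  (xi : R) (xi_ge0 : 0 <= xi)
  (frakL_bigO : forall p : R, 1 < p ->
    bigO_pow (fun n => Lpnorm P p (fun omega =>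
      (size (frakL T n (J n) (sigma n) omega))%:R%R)) xi)
  (beta0 : R) (xi_lt : xi < 2^-1)
  (beta0_lt : beta0 < Num.min gamma0 (2^-1 - xi))
  (kappa_bigO : bigO_pow (fun n => (kappa n)%:R%:E) (2^-1 : R)) :
  forall p : R, 1 < p ->
    bigO_pow (fun n => Lpnorm P p (fun omega =>
      WRV T alpha calpha n (S n) (X n) omega - Theta T (sigma n) omega)%R)
      (- beta0).
Proof.
move=> p p1.
have [C hC] := whp_error T_gt0 filtF wienerw b_cadlag J_active sigma_cadlag sigma_active
  sigmat_adapted sigmatE X_semimart kappa_le mS alpha01 calphaP sigma_bounded sigmat_holder
  b_bounded S_gt0 SV_bounded gamma0_gt0 c_gt0 S_approx xi_ge0 frakL_bigO xi_lt beta0_lt kappa_bigO.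
apply: (Lpnorm_bigO p1 hC) => k k0.
have k2 : (1 < 2 * k)%N by rewrite (leq_trans _ (leq_mul (leqnn 2) k0)).
have [K hK] := sigma_moments sigma_bounded k2.
exact: (WRV_Theta_envelope T_gt0 filtF sigma_cadlag S X alpha01 calphaP k0 hK).
Qed.
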